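(* Suppose that service times are exponentially distributed and consider the sequence of systems described in the context, under the standing assumptions listed there. (a) Suppose that JLMU is used and let $q_n$ have the stationary distribution of the Markov chain $\boldsymbol{q}_n$. Then the random variables $q_n$ converge weakly in $\ell_1$ to $q_*$ as $n\to\infty$. (b) Suppose that SLTA is used and let $(q_n,r_n)$ have the stationary distribution of the Markov chain $(\boldsymbol{q}_n,\boldsymbol{r}_n)$. Then the random variables $(q_n,r_n)$ converge weakly in $\ell_1\times\mathbb{N}$ to $(q_*,r_* )$ as $n\to\infty$. Furthermore, if the policy is either JLMU or SLTA and the marginal utilities are bounded, i.e., $\sup_{(i,j)\in\mathcal{I}}|\Delta(i,j)|<\infty$, then the random variables $u(q_n)$ are uniformly integrable and $$\lim_{n\to\infty}E\left[u(q_n)\right]=u(q_* )=\lim_{n\to\infty}u\left(q_n^*\right).$$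
   Context: Ranking. Let $\mathbb{N}=\{0,1,2,\dots\}$ and $m\geq 1$. For $i=1,\dots,m$ let $u_i:[0,\infty)\to\mathbb{R}$ be a concave function (only its values on $\mathbb{N}$ matter) and $\Delta(i,j)=u_i(j+1)-u_i(j)$ for $j\in\mathbb{N}$. Let $\mathcal{I}=\{1,\dots,m\}\times\mathbb{N}$ and $\mathcal{I}_+=\{(i,j)\in\mathcal{I}:j\geq 1\}$. Define a total order $\vartriangleleft$ on $\mathcal{I}_+$ by: $(i,j)\vartriangleleft(i',j')$ iff either $\Delta(i,j-1)<\Delta(i',j'-1)$, or $\Delta(i,j-1)=\Delta(i',j'-1)$ and $(i,j)$ is strictly larger than $(i',j')$ in the lexicographic order. Write $\vartriangleright$ for the reverse order and $\trianglelefteq,\trianglerighteq$ for the non-strict versions. Every nonempty subset of $\mathcal{I}_+$ has a largest element for $\vartriangleleft$; $(i_k,j_k)$, $k\geq 1$, denotes the $k$-th largest element of $\mathcal{I}_+$. Systems. $\lambda,\mu>0$, $\rho=\lambda/\mu$. The $n$-th system ($n\ge m$) has $n$ server pools, $A_n(i)\geq 1$ of class $i$, and $\alpha_n(i)=A_n(i)/n$. Tasks arrive as a Poisson process of rate $n\lambda$ and have independent exponential service times with mean $1/\mu$; all tasks are executed in parallel. The occupancy state is $q=(q(i,j))_{(i,j)\in\mathcal{I}}$, where $q(i,j)$ is the number of server pools of class $i$ with at least $j$ tasks divided by $n$. $\ell_1$ is the space of absolutely summable elements of $\mathbb{R}^{\mathcal{I}}$ with norm $\|\cdot\|_1$; $Q_n$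 is the set of $q\in\ell_1$ with $nq(i,j)\in\mathbb{N}$ and $q(i,j+1)\leq q(i,j)\leq q(i,0)=\alpha_n(i)$ for all $(i,j)\in\mathcal{I}$. Departures: in state $q$, for each $(i,j)\in\mathcal{I}_+$, $q(i,j)$ decreases by $1/n$ at rate $n\mu j[q(i,j)-q(i,j+1)]$. Arrivals occur at rate $n\lambda$; a task assigned to coordinates $(i,j)\in\mathcal{I}_+$ (a pool of class $i$ with exactly $j-1$ tasks) increases $q(i,j)$ by $1/n$. JLMU: an arrival in state $q$ is assigned to coordinates $\sigma(q)=\max\{(i,j)\in\mathcal{I}_+:q(i,j-1)>q(i,j)\}$, the maximum being with respect to $\vartriangleleft$. Then $\boldsymbol{q}_n$ is a continuous-time Markov chain; its state space is the set of states in $Q_n$ reachable from the empty occupancy state. SLTA, with parameter $\beta_n>0$: the state is $(q,r)$ with $q\in Q_n$ and $r\geq 1$ an integer. Let $\ell_i(r)=\max\{j\geq 0: j=0\text{ or }(i,j)\vartriangleright(i_r,j_r)\}$. A server pool of class $i$ with exactly $j-1$ tasks has a green token if $j-1<\ell_i(r)$, and a yellow token if $i=i_r$ and $j-1\leq\ell_i(r)$ (it can have both). When a task arrives: if there are green tokens of classes $i\neq i_{r-1}$, one of these is picked uniformly at random and the task is sent to the corresponding pool; if the only green tokens are of class $i_{r-1}$, one of these is picked uniformly at random; if there are only yellow tokens, a yellow token is picked uniformly at random; if there are no tokens, the task is sent to a pool chosen uniformly at random. In addition, depending on the state right before the arrival, after the task is dispatched: $r$ is decreased by one if $r>1$, there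 are at least $n\beta_n$ green tokens and at least one of them belongs to a pool of class $i_{r-1}$; $r$ is increased by one if there are no green tokens and at most one yellow token; otherwise $r$ is unchanged. Then $(\boldsymbol{q}_n,\boldsymbol{r}_n)$ is a continuous-time Markov chain; its state space is the set of states reachable from the empty occupancy state with $r=1$. Limits. $\alpha(i)\in(0,1)$ are constants with $\alpha_n(i)\to\alpha(i)$ for all $i$. $\sigma_*=(i_{r_*},j_{r_*})$ is the unique element of $\mathcal{I}_+$ with $\sum_{(i,j)\vartriangleright\sigma_*}\alpha(i)\leq\rho<\sum_{(i,j)\trianglerighteq\sigma_*}\alpha(i)$, which also defines $r_*$. $q_*(i,0)=\alpha(i)$ and, for $(i,j)\in\mathcal{I}_+$, $q_*(i,j)=0$ if $(i,j)\vartriangleleft\sigma_*$, $q_*(i,j)=\alpha(i)$ if $(i,j)\vartriangleright\sigma_*$, $q_*(\sigma_* )=\rho-\sum_{(i,j)\vartriangleright\sigma_*}\alpha(i)$. The sequence $q_n^*$ is defined in the same way with $\alpha_n$ in place of $\alpha$ (also in the definition of the threshold element, denoted $\sigma_n^*$). The overall utility is $u(q)=\sum_{i=1}^m\sum_{j=0}^\infty u_i(j)[q(i,j)-q(i,j+1)]$. Standing assumptions. $\alpha_n(i)\to\alpha(i)$ for all $i$. The initial states satisfy $\|\boldsymbol{q}_n(0)-q_0\|_1\to0$ with probability one for some random $q_0$ (this does not affect stationary distributions). If the policy is SLTA, also: $\sum_{(i,j)\vartriangleright\sigma_*}\alpha(i)<\rho$ (strict); there is $\gamma_0\in(0,1/2)$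 with $\lim_{n\to\infty}\beta_n=0$ and $\liminf_{n\to\infty}n^{\gamma_0}\beta_n>0$; and there is a random variable $R\ge1$ such that, with probability one, for all $n$, $\boldsymbol{r}_n(0)\leq R$ and $\boldsymbol{q}_n(0,i,j)<\alpha_n(i)$ for all $(i,j)\trianglelefteq(i_{\boldsymbol{r}_n(0)},j_{\boldsymbol{r}_n(0)})$. *)

(* Defs.v *)
From HB Require Import structures.
From mathcomp Require Import all_boot all_order all_algebra.
From mathcomp Require Import all_classical all_reals all_analysis.
Set Implicit Arguments. Unset Strict Implicit. Unset Printing Implicit Defensive.
Import Order.TTheory GRing.Theory Num.Theory.
Import numFieldNormedType.Exports.
Local Open Scope classical_set_scope.
Local Open Scope ring_scope.

(* MathComp-Analysis is used throughout. *)

(* [l1 R I] is the space of absolutely summable families indexed by I, as a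
   normed module, so that [open] and [continuous] refer to the l1-norm. *)
Section l1_space.
Variables (R : realType) (I : choiceType).

Definition l1_pred : {pred I -> R} :=
  [pred f | `[< summable [set: I] (EFin \o f) >]].

Definition l1_norm (f : I -> R) : R :=
  fine (\esum_(i in [set: I]) `|(f i)%:E|)%E.

Lemma l1_predP (f : I -> R) :
  reflect (summable [set: I] (EFin \o f)) (f \in l1_pred).
Proof. by rewrite inE; exact: asboolP. Qed.

Lemma le_esumZ (c : R) (f : I -> R) :
  (\esum_(i in [set: I]) `|(c * f i)%:E| <=
   `|c|%:E * \esum_(i in [set: I]) `|(f i)%:E|)%E.
Proof.
apply: ge_ereal_sup => _ [A [fA _] <-].
have -> : (\sum_(i \in A) `|(c * f i)%:E| =
    `|c|%:E * \sum_(i \in A) `|(f i)%:E|)%E.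
  rewrite ge0_mule_fsumr; last by move=> i; exact: abse_ge0.
  by apply: eq_fsbigr => i _; rewrite EFinM abseM.
rewrite lee_wpmul2l ?lee_fin//.
apply: ereal_sup_ubound; exists A => //.
Qed.

Lemma l1_submod_closed : submod_closed l1_pred.
Proof.
split.
  apply/l1_predP; rewrite /summable esum1// => i _ /=; first by rewrite normr0.
move=> c f g /l1_predP lf /l1_predP lg; apply/l1_predP.
have lcf : summable [set: I] (EFin \o (c *: f)).
  apply: le_lt_trans (le_esumZ c f) _.
  by rewrite lte_mul_pinfty// lee_fin.
by have := summableD lcf lg.
Qed.

HB.instance Definition _ :=
  GRing.isSubmodClosed.Build R (I -> R) l1_pred l1_submod_closed.

Record l1 := L1 { l1_val :> I -> R ; l1_valP : l1_val \in l1_pred }.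

HB.instance Definition _ := [isSub for l1_val].
HB.instance Definition _ := [Choice of l1 by <:].
HB.instance Definition _ := [SubChoice_isSubLmodule of l1 by <:].

Lemma l1_norm_fin (f : l1) :
  (l1_norm f)%:E = (\esum_(i in [set: I]) `|(f i)%:E|)%E.
Proof.
have /l1_predP lf := l1_valP f.
by rewrite /l1_norm fineK// ge0_fin_numE// esum_ge0// => i _; exact: abse_ge0.
Qed.

Lemma ler_l1_normD (f g : l1) : l1_norm (f + g) <= l1_norm f + l1_norm g.
Proof.
rewrite -lee_fin EFinD. rewrite !l1_norm_fin -esumD;
  try by move=> i _; exact: abse_ge0.
by apply: le_esum => i _; rewrite /= lee_fin ler_normD.
Qed.

Lemma l1_normZ (c : R) (f : l1) : l1_norm (c *: f) = `|c| * l1_norm f.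
Proof.
have le0 a (g : l1) : l1_norm (a *: g) <= `|a| * l1_norm g.
  by rewrite -lee_fin EFinM !l1_norm_fin; exact: le_esumZ.
apply/eqP; rewrite eq_le le0 /=.
have [->|c0] := eqVneq c 0.
  by rewrite normr0 mul0r fine_ge0// esum_ge0.
rewrite -ler_pdivlMl ?normr_gt0//.
by have := le0 c^-1 (c *: f); rewrite scalerA mulVf// scale1r normfV.
Qed.

Lemma l1_norm0_eq0 (f : l1) : l1_norm f = 0 -> f = 0.
Proof.
move=> f0; apply/val_inj/funext => i /=.
have : (`|(f i)%:E| <= 0)%E.
  rewrite -[leRHS]/(0%:E) -f0 l1_norm_fin (esumID [set i])//.
  rewrite setTI esum_set1// leeDl// esum_ge0//.
by rewrite lee_fin normr_le0 => /eqP.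
Qed.

HB.instance Definition _ :=
  Lmodule_isNormed.Build R l1 ler_l1_normD l1_normZ l1_norm0_eq0.

Lemma unit_l1 (i : I) : (fun j => (j == i)%:R : R) \in l1_pred.
Proof.
apply/l1_predP; rewrite /summable (esumID [set i])//.
rewrite setTI esum_set1// esum1 ?adde0 /=.
  by rewrite eqxx normr1 ltry.
by move=> j [_ /eqP /negbTE ->]; rewrite normr0.
Qed.

Definition l1_unit (i : I) : l1 := L1 (unit_l1 i).

(* The point of l1 with coordinates f. The default 0 for families that are not
   absolutely summable is irrelevant for the uses below. *)
Definition l1_of (f : I -> R) : l1 := insubd 0 f.

End l1_space.

Section markov_chains.
Variables (R : realType) (S : choiceType) (E : set S) (rate : S -> S -> R).

Inductive reachable (x0 : S) : S -> Prop :=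
| reachable_refl : reachable x0 x0
| reachable_jump x y : reachable x0 x -> 0 < rate x y -> reachable x0 y.

Definition exit_rate (x : S) : R := fine (\esum_(y in E `\ x) (rate x y)%:E).

(* Probability that the chain on E with jump rates [rate], started at x, is at y
   at time t after at most k jumps: condition on the time s of the first jump,
   which is exponential with parameter [exit_rate x], and on the state z reached,
   which has probability [rate x z / exit_rate x]. *)
Fixpoint transition_upto (k : nat) (t : R) (x y : S) : \bar R :=
  ((if x == y then (expR (- (exit_rate x * t)))%:E else 0) +
   (if k is k'.+1 then
      \int[lebesgue_measure]_(s in `[0%R, t])
        ((expR (- (exit_rate x * s)))%:E *
         \esum_(z in E `\ x) ((rate x z)%:E * transition_upto k' (t - s)%R z y))
    else 0))%E.

(* Transition probabilities of the chain on E with jump rates [rate]. *)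
Definition transition (t : R) (x y : S) : \bar R :=
  ereal_sup (range (fun k => transition_upto k t x y)).

Definition stationary_distribution (p : S -> \bar R) : Prop :=
  [/\ forall x, E x -> (0 <= p x)%E,
      (\esum_(x in E) p x = 1)%E &
      forall t y, 0 <= t -> E y ->
        (\esum_(x in E) (p x * transition t x y) = p y)%E].

End markov_chains.

Section random_elements.
Variable R : realType.

(* X takes values in E and is measurable for the Borel sigma-algebra. *)
Definition random_element d (W : measurableType d) (S : topologicalType)
    (E : set S) (X : W -> S) : Prop :=
  (forall w, E (X w)) /\ (forall U : set S, open U -> measurable (X @^-1` U)).

Definition has_stationary_distribution d (W : measurableType d)
    (P : probability W R) (S : topologicalType) (E : set S)
    (rate : S -> S -> R) (X : W -> S) : Prop :=
  random_element E X /\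
  stationary_distribution E rate (fun x => P (X @^-1` [set x])).

(* The random variables X n may live on different probability spaces. *)
Definition converges_weakly (d : nat -> measure_display)
    (W : forall n, measurableType (d n)) (P : forall n, probability (W n) R)
    (S : topologicalType) (X : forall n, W n -> S) (x : S) : Prop :=
  forall f : S -> R, continuous f -> (exists M, forall y, `|f y| <= M) ->
    ('E_(P n)[f \o X n])%E @[n --> \oo] --> (f x)%:E.

Definition uniformly_integrable (N : set nat) (d : nat -> measure_display)
    (W : forall n, measurableType (d n)) (P : forall n, probability (W n) R)
    (Y : forall n, W n -> R) : Prop :=
  forall e : R, 0 < e -> exists K : R, forall n, N n ->
    (\int[P n]_(w in [set w | (K <= `|Y n w|)%R]) `|Y n w|%R%:E <= e%:E)%E.

End random_elements.

(* There are m.+1 classes, numbered from 0. *)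
Definition coord (m : nat) : choiceType := ('I_m.+1 * nat)%type.

Definition occ (R : realType) (m : nat) := l1 R (coord m).

Section model.
Variables (R : realType) (m : nat).
Variable u : 'I_m.+1 -> R -> R.
Variables lambda mu : R.

Local Notation coord := (coord m).
Local Notation occ := (occ R m).

Implicit Types (p : coord) (a : 'I_m.+1 -> R) (q : occ) (n : nat).

Definition concave_utilities : Prop :=
  forall i, @convex_function R R^o [set x | 0 <= x] (\- (u i) : R -> R).

Definition Delta (i : 'I_m.+1) (j : nat) : R := u i j.+1%:R - u i j%:R.

Definition bounded_marginals : Prop :=
  exists M : R, forall i j, `|Delta i j| <= M.

Definition Iplus : set coord := [set p | (1 <= p.2)%N].

(* p is strictly smaller than p'; in case of equal marginal utilities, the
   lexicographically larger coordinate is the smaller one. *)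
Definition prec p p' : bool :=
  (Delta p.1 p.2.-1 < Delta p'.1 p'.2.-1) ||
  ((Delta p.1 p.2.-1 == Delta p'.1 p'.2.-1) &&
   ((p'.1 < p.1)%N || ((p'.1 == p.1) && (p'.2 < p.2)%N))).

Definition preceq p p' : bool := (p == p') || prec p p'.

(* Value returned by [xget] when no element has the required property. *)
Let p0 : coord := (ord0, 1%N).

(* the k-th largest element of Iplus, for k >= 1 *)
Definition kth (k : nat) : coord :=
  xget p0 [set p | Iplus p /\
                   ([set p' | Iplus p' /\ prec p p'] #= `I_k.-1)%card].

Definition load_above a (s : coord) : \bar R :=
  (\esum_(p in [set p | Iplus p /\ prec s p]) (a p.1)%:E)%E.

Definition load_from a (s : coord) : \bar R :=
  (\esum_(p in [set p | Iplus p /\ preceq s p]) (a p.1)%:E)%E.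

Definition threshold a (rho : R) : coord :=
  xget p0 [set s | Iplus s /\
                   (load_above a s <= rho%:E < load_from a s)%E].

Definition threshold_rank a (rho : R) : nat :=
  xget 1%N [set r : nat | (1 <= r)%N /\ kth r = threshold a rho].

Definition qstar a (rho : R) : occ :=
  l1_of (fun p => if p.2 == 0%N then a p.1
                  else if prec p (threshold a rho) then 0
                  else if prec (threshold a rho) p then a p.1
                  else rho - fine (load_above a (threshold a rho))).

Definition utility q : R :=
  \sum_(i < m.+1)
    limn [series u i j%:R * (q (i, j) - q (i, j.+1))]_j.

Definition Qn n a : set occ :=
  [set q | (forall p, exists k : nat, n%:R * q p = k%:R) /\
           (forall i, q (i, 0%N) = a i /\
                      forall j, q (i, j.+1) <= q (i, j) <= q (i, 0%N))].

Definition empty_occ a : occ := l1_of (fun p => if p.2 == 0%N then a p.1 else 0).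

Definition departure_rate n q q' : R :=
  \sum_(p \in [set p | Iplus p /\ q' = q - n%:R^-1 *: l1_unit R p])
    n%:R * mu * p.2%:R * (q p - q (p.1, p.2.+1)).

(* Rate of arrivals that move q to q' when a task is assigned to coordinates p
   with probability [f p]. *)
Definition arrival_rate n (f : coord -> R) q q' : R :=
  \sum_(p \in [set p | Iplus p /\ q' = q + n%:R^-1 *: l1_unit R p])
    n%:R * lambda * f p.

Definition jlmu_target q : coord :=
  xget p0 [set p | [/\ Iplus p, q p < q (p.1, p.2.-1) &
    forall p', Iplus p' -> q p' < q (p'.1, p'.2.-1) -> preceq p' p]].

Definition jlmu_rate n q q' : R :=
  departure_rate n q q' +
  arrival_rate n (fun p => (p == jlmu_target q)%:R) q q'.

Definition jlmu_states n a : set occ :=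
  [set q | Qn n a q /\ reachable (jlmu_rate n) (empty_occ a) q].

Definition ell (r : nat) (i : 'I_m.+1) : nat :=
  xget 0%N [set j | (j = 0%N \/ prec (kth r) (i, j)) /\
    forall j', j' = 0%N \/ prec (kth r) (i, j') -> (j' <= j)%N].

(* number of pools of class i with exactly j-1 tasks, for p = (i, j) *)
Definition pools n q p : R := n%:R * (q (p.1, p.2.-1) - q p).

Definition pool_count n q (C : set coord) : R := \sum_(p \in C) pools n q p.

(* Token sets are sets of coordinates: a pool of class i with exactly j-1 tasks
   has the token iff (i, j) is in the set. For r = 1 the sets [green],
   [green_last] and [green_other] are empty, so [kth 0] does not matter. *)
Definition green (r : nat) : set coord :=
  [set p | Iplus p /\ (p.2.-1 < ell r p.1)%N].

Definition yellow (r : nat) : set coord :=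
  [set p | [/\ Iplus p, p.1 = (kth r).1 & (p.2.-1 <= ell r p.1)%N]].

Definition green_last (r : nat) : set coord :=
  [set p | green r p /\ p.1 = (kth r.-1).1].

Definition green_other (r : nat) : set coord :=
  [set p | green r p /\ p.1 <> (kth r.-1).1].

(* probability that a pool drawn uniformly among those with coordinates in C has
   coordinates p *)
Definition uniform_in n q (C : set coord) p : R :=
  if p \in C then pools n q p / pool_count n q C else 0.

Definition slta_assign n q (r : nat) p : R :=
  if 0 < pool_count n q (green_other r) then uniform_in n q (green_other r) p
  else if 0 < pool_count n q (green r) then uniform_in n q (green r) p
  else if 0 < pool_count n q (yellow r) then uniform_in n q (yellow r) p
  else uniform_in n q Iplus p.

Definition slta_next n (beta : R) q (r : nat) : nat :=
  if [&& (1 < r)%N, n%:R * beta <= pool_count n q (green r)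
       & 0 < pool_count n q (green_last r)] then r.-1
  else if (pool_count n q (green r) == 0) && (pool_count n q (yellow r) <= 1)
  then r.+1
  else r.

Definition slta_rate n (beta : R) (x y : occ * nat) : R :=
  (if y.2 == x.2 then departure_rate n x.1 y.1 else 0) +
  (if y.2 == slta_next n beta x.1 x.2
   then arrival_rate n (slta_assign n x.1 x.2) x.1 y.1 else 0).

Definition slta_states n (beta : R) a : set (occ * nat)%type :=
  [set x | [/\ Qn n a x.1, (1 <= x.2)%N &
    reachable (slta_rate n beta) (empty_occ a, 1%N) x]].

End model.

(* Main.v *)
Require Import Defs.
From HB Require Import structures.
From mathcomp Require Import all_boot all_order all_algebra.
From mathcomp Require Import all_classical all_reals all_analysis.
From mathcomp Require Import measurable_realfun.
From mathcomp Require Import ring lra zify.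
Set Implicit Arguments. Unset Strict Implicit. Unset Printing Implicit Defensive.
Import Order.TTheory GRing.Theory Num.Theory.
Import numFieldNormedType.Exports.
Local Open Scope classical_set_scope.
Local Open Scope ring_scope.

(* Both policies are analysed directly in stationarity, without fluid limits: if
   [f] is a nonnegative function of polynomial growth in the number of tasks, its
   drift has nonnegative mean, so a bound [drift f <= h - g] yields [E g <= E h].
   The number of tasks is an M/M/oo queue, whose mean, variance and tail (of order
   [n^-4] beyond any [rho + eps]) are obtained in this way.

   Let the deficit be the number of vacancies in the [r - 1] coordinates above the
   threshold. Under JLMU every arrival fills a vacancy while there is one, and the
   squared deficit is a Lyapunov function that makes its second moment [o(n^2)].
   Under SLTA one first shows that [r_n <> r_*] has vanishing probability. If
   [r_n > r_*], then, off an unlikely overload, no arrival goes to class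
   [i_(r-1)], whose tasks, a number of order [n], therefore leave at rate of order
   [n]. If [r_n < r_*], the deficit at the current rank is small because the load
   exceeds the capacity above it, so [r_n] increases, and a cubic function of
   that deficit bounds the frequency of the downward steps by [1 / (n beta_n)^2].
   The distance from [q_*] is controlled by the deficit, the fluctuation of the
   number of tasks, and the tasks below the threshold. Finally the utility is
   Lipschitz for the l1-norm by summation by parts, which together with the second
   moment of the number of tasks gives uniform integrability. *)

(** * The priority order *)

(** A stationary law is given only through transition probabilities, themselves a supremum over the
    number of jumps; neither a generator equation nor non-explosion is at hand. Keeping at most one
    jump and letting the time tend to zero gives, at each state, inflow at most outflow. This
    one-sided inequality already yields an exponential moment of the number of tasks; the exit rate
    then has finite mean, and the inequality applied to [C - f] gives the reverse one. The orders in
    [n] fix the remaining choices. At low ranks a switch can change the deficit by order [n], so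
    switches must have probability [o(1/n)]. A down step needs a deficit of at least [n beta_n]; a
    quadratic Lyapunov function would control only the first moment of the deficit, giving
    [1 / (n beta_n)], which is too weak. A cubic one controls the second moment, and
    [n / (n beta_n)^2 = 1 / (n beta_n^2)] tends to zero because [gamma_0 < 1/2]. The cubic is of
    order [n^3] at worst, and the tail of order [n^-4] pays for the returns from ranks above
    [r_*]. *)

Section priority_order.
Variables (R : realType) (m : nat) (u : 'I_m.+1 -> R -> R).
Hypothesis u_concave : concave_utilities u.

Local Notation coord := (Defs.coord m).
Local Notation prec := (prec u).
Local Notation kth := (kth u).
Implicit Types p : coord.

Lemma Delta_antitone i j k : (j <= k)%N -> Delta u i k <= Delta u i j.
Proof.
elim: k => [|k IH]; first by rewrite leqn0 => /eqP ->.
rewrite leq_eqVlt => /predU1P[->//|/IH]; apply: le_trans.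
have h0 : 0 <= (2 : R)^-1 by rewrite invr_ge0.
have h1 : (2 : R)^-1 <= 1 by rewrite invf_le1// ler1n.
have k0 n : (n%:R : R) \in [set x | 0 <= x] by rewrite inE/=.
have : - u i (2^-1 * k%:R + (1 - 2^-1) * k.+2%:R) <=
    2^-1 * - u i k%:R + (1 - 2^-1) * - u i k.+2%:R.
  exact: (@u_concave i (Itv01 h0 h1) k%:R k.+2%:R (k0 k) (k0 k.+2)).
rewrite (_ : _ + _ * k.+2%:R = k.+1%:R); last by rewrite -!natr1; field.
rewrite /Delta; lra.
Qed.

Lemma prec_irr p : prec p p = false.
Proof. by rewrite /Defs.prec ltxx eqxx !ltnn andbF. Qed.

Lemma prec_trans p1 p2 p3 : prec p1 p2 -> prec p2 p3 -> prec p1 p3.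
Proof.
rewrite /Defs.prec => /orP[h1|/andP[/eqP e1 l1]] /orP[h2|/andP[/eqP e2 l2]].
- by rewrite (lt_trans h1 h2).
- by rewrite -e2 h1.
- by rewrite e1 h2.
- rewrite e1 e2 eqxx /=; apply/orP; right; move: l1 l2; clear.
  rewrite -!(inj_eq val_inj) /=; lia.
Qed.

Lemma prec_total p p' : p != p' -> prec p p' || prec p' p.
Proof.
have : p != p' -> (p.1 != p'.1 :> nat) || (p.2 != p'.2).
  case: p p' => [i j] [i' j'] /= h; rewrite -negb_and; apply: contra h.
  by move=> /andP[/eqP/val_inj -> /eqP ->].
move=> /[apply]; rewrite /Defs.prec -!(inj_eq val_inj) /=.
case: ltgtP => //= _; lia.
Qed.

Lemma prec_asym p p' : prec p p' -> prec p' p = false.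
Proof. by move=> h; apply/negP => /(prec_trans h); rewrite prec_irr. Qed.

Lemma prec_level i j j' : (1 <= j < j')%N -> prec (i, j') (i, j).
Proof.
case: j j' => // j [//|j'] /= jj'; rewrite /Defs.prec /= eqxx jj' andbT orbT andbT.
by rewrite orbC -le_eqVlt Delta_antitone// ltnW.
Qed.

(** Within a class the order decreases with the level, so only the lowest level of [A] in each class
    can be maximal: the search is over at most [m.+1] candidates. *)
Lemma exists_max_prec (A : set coord) : A `<=` @Iplus m -> A !=set0 ->
  exists2 p, A p & forall p', A p' -> preceq u p' p.
Proof.
move=> AI A0.
have seqmax (s : seq coord) : (exists2 p, p \in s & A p) ->
    exists2 p, A p & forall p', p' \in s -> A p' -> preceq u p' p.
  elim: s => [[]//|x s IH] [p0 p0s Ap0].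
  have [/IH[p Ap pmax]|none] := pselect (exists2 p, p \in s & A p); last first.
    have ex : x = p0.
      move: p0s; rewrite inE => /predU1P[//|p0s]; exfalso; apply: none.
      by exists p0.
    exists x; first by rewrite ex.
    move=> p'; rewrite inE => /predU1P[->|p's Ap']; first by rewrite /preceq eqxx.
    by exfalso; apply: none; exists p'.
  have [Ax|nAx] := pselect (A x); last first.
    exists p => // p'; rewrite inE => /predU1P[->//|]; exact: pmax.
  have [px|] := boolP (prec p x).
    exists x => // p'; rewrite inE => /predU1P[->|p's Ap']; first by rewrite /preceq eqxx.
    have := pmax _ p's Ap'; rewrite /preceq => /predU1P[->|h]; first by rewrite px orbT.
    by rewrite (prec_trans h px) orbT.
  move=> npx; exists p => // p'; rewrite inE => /predU1P[-> _|]; last exact: pmax.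
  rewrite /preceq; case: eqVneq => //= xp; have := prec_total xp.
  by rewrite (negbTE npx) orbF.
have [[i0 j0] Aij] := A0.
pose Q i := [pred j | `[< A (i, j) >]].
(* A class that does not meet [A] contributes the known element [(i0, j0)], so every candidate lies
   in [A]. *)
pose f i := if pselect (exists j, Q i j) is left h then (i, ex_minn h) else (i0, j0).
have [|p Ap pmax] := seqmax [seq f i | i <- enum 'I_m.+1].
  exists (f i0); first by rewrite map_f// mem_enum.
  rewrite /f; case: pselect => // h; by case: ex_minnP => j /asboolP.
exists p => // -[i j] Ap'.
have fi : f i \in [seq f i | i <- enum 'I_m.+1] by rewrite map_f// mem_enum.
have Q0 : exists j, Q i j by exists j; apply/asboolP.
have : A (f i) /\ preceq u (i, j) (f i).
  rewrite /f; case: pselect => // h; case: ex_minnP => k /asboolP Ak kmin.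
  split=> //; have := kmin j (asboolT Ap'); rewrite leq_eqVlt => /predU1P[->|kj].
    by rewrite /preceq eqxx.
  by rewrite /preceq prec_level ?orbT// kj andbT; exact: (AI _ Ak).
move=> [Afi le1]; have := pmax _ fi Afi; move: le1.
rewrite /preceq => /predU1P[->//|h] /predU1P[<-|h']; first by rewrite h orbT.
by rewrite (prec_trans h h') orbT.
Qed.

(** The coordinates strictly above [kth r], in decreasing order; [kth r] itself is excluded, and
    [top_coords 0] is empty like [top_coords 1]. *)
Definition top_coords (r : nat) : seq coord := [seq kth k | k <- iota 1 r.-1].

(** [s] is an initial segment of the order, listed decreasingly: the coordinates above an entry are
    precisely the entries before it. *)
Let is_top (s : seq coord) := [/\ uniq s, forall p, p \in s -> Iplus p &
  forall i p, (i < size s)%N -> Iplus p ->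
    prec (nth (ord0, 1%N) s i) p = (p \in take i s)].

(** Greedy construction: append the maximum of the coordinates not yet listed. *)
Let exists_top k : exists2 s, is_top s & size s = k.
Proof.
elim: k => [|k [s [us sI sP] sk]]; first by exists [::].
have [||x [Ix xs] xmax] := @exists_max_prec [set p | Iplus p /\ p \notin s].
- by move=> p [].
(* A level higher than all those listed shows that some coordinate remains. *)
- pose j := (\max_(p <- s) p.2).+1; exists (ord0, j); split=> //.
  apply/negP => js; have := @leq_bigmax_seq _ s predT (fun p : coord => p.2) _ js erefl.
  by rewrite /= /j ltnn.
have smax p : Iplus p -> prec x p -> p \in s.
  move=> Ip xp; apply/negPn/negP => ps; have := xmax p (conj Ip ps).
  by rewrite /preceq (prec_asym xp) orbF => /eqP px; move: xp; rewrite px prec_irr.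
exists (rcons s x); last by rewrite size_rcons sk.
split=> [|p|i p].
- by rewrite rcons_uniq xs.
- by rewrite mem_rcons inE => /predU1P[->//|/sI].
- rewrite size_rcons ltnS leq_eqVlt => /predU1P[->|ik] Ip.
    rewrite nth_rcons ltnn eqxx -cats1 takel_cat// take_size.
    apply/idP/idP; first exact: smax.
    move=> ps; have [xp|] := boolP (prec x p) => // nxp.
    have xnp : x != p by apply: contraNneq xs => ->.
    have := prec_total xnp; rewrite (negbTE nxp)/= => px.
    have pi : (index p s < size s)%N by rewrite index_mem.
    have := sP _ x pi Ix; rewrite nth_index// px => /esym/mem_take.
    by rewrite (negbTE xs).
  by rewrite nth_rcons ik -cats1 takel_cat ?(ltnW ik)// sP.
Qed.

Let card_seq (T : choiceType) (x0 : T) (s : seq T) :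
  uniq s -> ([set` s] #= `I_(size s))%card.
Proof.
move=> us; have -> : [set` s] = nth x0 s @` `I_(size s).
  apply/seteqP; split=> [x /= xs|_ [i /= si <-]]; last exact: mem_nth.
  by exists (index x s); rewrite /= ?index_mem// nth_index.
apply: inj_card_eq => i j; rewrite !inE => si sj /eqP.
by rewrite nth_uniq// => /eqP.
Qed.

(** [kth] is defined by the cardinality of the set above. In an initial segment, entry [i] (counted
    from 0) has exactly [i] coordinates above it; a smaller element has at least [i.+1], a larger
    one fewer than [i]. *)
Let kth_top s i : is_top s -> (i < size s)%N -> kth i.+1 = nth (ord0, 1%N) s i.
Proof.
move=> [us sI sP] si; set x := nth _ _ _.
have xs : x \in s by exact: mem_nth.
have Ix := sI _ xs.
have above j : (j < size s)%N ->
    [set p | Iplus p /\ prec (nth (ord0, 1%N) s j) p] = [set` take j s].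
  move=> sj; apply/seteqP; split=> [p [Ip]|p /= pj] /=; first by rewrite sP.
  have Ip := sI _ (mem_take pj).
  by rewrite sP.
have card j : (j < size s)%N -> ([set` take j s] #= `I_j)%card.
  move=> sj; have := card_seq (ord0, 1%N) (take_uniq j us).
  by rewrite size_take sj.
apply: xget_unique => /=.
  by split=> //; rewrite above// card.
move=> y [Iy yc]; apply/eqP/negPn/negP => yx.
have /orP[yx'|xy] := prec_total yx.
  have : (`I_i.+1 #<= `I_i)%card.
    rewrite -(card_le_eqr yc).
    have c1 : ([set` rcons (take i s) x] #= `I_i.+1)%card.
      have ut : uniq (rcons (take i s) x).
        by rewrite -take_nth// take_uniq.
      have := card_seq (ord0, 1%N) ut.
      by rewrite size_rcons size_take si.
    rewrite -(card_le_eql c1).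
    apply: subset_card_le => p /=; rewrite mem_rcons inE => /predU1P[->//|pi].
    have Ip := sI _ (mem_take pi); split=> //.
    by apply: (prec_trans yx'); rewrite sP.
  by rewrite card_le_II ltnn.
have := xy; rewrite sP// => yi.
have yj : (index y (take i s) < i)%N.
  by rewrite -[ltnRHS](size_takel (ltnW si)) index_mem.
have sj : (index y (take i s) < size s)%N by exact: ltn_trans si.
have ye : nth (ord0, 1%N) s (index y (take i s)) = y.
  by rewrite -(nth_take _ yj) nth_index.
move: yc; rewrite -ye above// => /card_eqPle[_].
by rewrite (card_le_eqr (card _ sj)) card_le_II leqNgt yj.
Qed.

Let top_coordsE k : is_top (top_coords k).
Proof.
case: k => [|k]; first by split.
have [s ts sk] := exists_top k; suff -> : top_coords k.+1 = s by [].
apply: (@eq_from_nth _ (ord0, 1%N)); rewrite size_map size_iota//= => i ik.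
by rewrite (nth_map 0%N) ?size_iota// nth_iota// add1n (kth_top ts)// sk.
Qed.

Lemma top_coords_uniq k : uniq (top_coords k).
Proof. by have [] := top_coordsE k. Qed.

Lemma top_coords_Iplus k p : p \in top_coords k -> Iplus p.
Proof. by have [_ + _] := top_coordsE k; apply. Qed.

Lemma top_coordsS k : (0 < k)%N -> top_coords k.+1 = rcons (top_coords k) (kth k).
Proof.
case: k => // k _.
have e : iota 1 k.+1 = rcons (iota 1 k) k.+1.
  by rewrite -cats1 -[in LHS](addn1 k) iotaD add1n.
by rewrite /top_coords [k.+2.-1]/= e map_rcons.
Qed.

Lemma kth_Iplus k : (0 < k)%N -> Iplus (kth k).
Proof.
by move=> k0; apply: (@top_coords_Iplus k.+1); rewrite top_coordsS// mem_rcons inE eqxx.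
Qed.

Lemma mem_top_coords k p : (0 < k)%N -> Iplus p ->
  (p \in top_coords k) = prec (kth k) p.
Proof.
move=> k0 Ip; have [_ _ /(_ k.-1 p)] := top_coordsE k.+1.
have sk : size (top_coords k) = k.-1 by rewrite size_map size_iota.
rewrite top_coordsS// size_rcons sk prednK// leqnn nth_rcons sk ltnn eqxx.
by move=> ->//; rewrite -cats1 -sk takel_cat// take_size.
Qed.

Lemma kth_notin k : (0 < k)%N -> kth k \notin top_coords k.
Proof. by move=> k0; rewrite mem_top_coords ?prec_irr//; exact: kth_Iplus. Qed.

Lemma top_coords_sub k k' : (k <= k')%N -> {subset top_coords k <= top_coords k'}.
Proof.
move=> kk' p /mapP[j]; rewrite mem_iota => /andP[j1 jk] ->; apply: map_f.
by rewrite mem_iota j1 (leq_trans jk)// leq_add2l -!subn1 leq_sub2r.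
Qed.

Lemma kth_inj k k' : (0 < k)%N -> (0 < k')%N -> kth k = kth k' -> k = k'.
Proof.
move=> k0 k'0 e; apply/eqP; rewrite eqn_leq; apply/andP; split.
  rewrite leqNgt; apply/negP => h; have := kth_notin k0; rewrite e.
  by rewrite (@top_coords_sub k'.+1)// top_coordsS// mem_rcons inE eqxx.
rewrite leqNgt; apply/negP => h; have := kth_notin k'0; rewrite -e.
by rewrite (@top_coords_sub k.+1)// top_coordsS// mem_rcons inE eqxx.
Qed.

Lemma top_coords_down k i j j' : (1 <= j' <= j)%N ->
  (i, j) \in top_coords k -> (i, j') \in top_coords k.
Proof.
case: k => // k /andP[j0]; rewrite leq_eqVlt => /predU1P[->//|j'j] ij.
have Ij := top_coords_Iplus ij; rewrite mem_top_coords//.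
rewrite mem_top_coords// in ij; apply: (prec_trans ij); apply: prec_level.
by rewrite j0.
Qed.

End priority_order.

(** * Stationary expectations and Lyapunov functions *)

Section esum_extra.
Variables (R : realType) (T : choiceType).

Lemma esumZl (I : set T) (c : R) (a : T -> \bar R) : 0 <= c ->
  (forall i, I i -> 0 <= a i)%E ->
  (\esum_(i in I) (c%:E * a i) = c%:E * \esum_(i in I) a i)%E.
Proof.
move=> c0 a0.
have le d (b : T -> \bar R) : 0 <= d -> (forall i, I i -> 0 <= b i)%E ->
    (\esum_(i in I) (d%:E * b i) <= d%:E * \esum_(i in I) b i)%E.
  move=> d0 b0; apply: ge_ereal_sup => _ [A [fA AI] <-].
  have -> : (\sum_(i \in A) d%:E * b i = d%:E * \sum_(i \in A) b i)%E.
    rewrite !fsbig_finite//= big_seq [in RHS]big_seq ge0_sume_distrr//.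
    by move=> i; rewrite in_fset_set// inE => /AI/b0.
  rewrite lee_wpmul2l ?lee_fin//.
  by apply: ereal_sup_ubound; exists A.
apply/eqP; rewrite eq_le le//=.
have [->|cn0] := eqVneq c 0.
  by rewrite mul0e; apply: esum_ge0 => i Ii; rewrite mul0e.
have cgt0 : 0 < c by rewrite lt_neqAle eq_sym cn0.
have -> : (\esum_(i in I) a i = \esum_(i in I) ((c^-1)%:E * (c%:E * a i)))%E.
  by apply: eq_esum => i _; rewrite muleA -EFinM mulVf// mul1e.
apply: (@le_trans _ _ (c%:E * ((c^-1)%:E * \esum_(i in I) (c%:E * a i))))%E.
  rewrite lee_wpmul2l ?lee_fin//; apply: le; first by rewrite invr_ge0.
  by move=> i Ii; rewrite mule_ge0 ?lee_fin// a0.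
by rewrite muleA -EFinM divff// mul1e.
Qed.

Lemma exchange_esum (T' : choiceType) (I : set T) (J : set T')
    (a : T -> T' -> \bar R) : (forall i j, I i -> J j -> 0 <= a i j)%E ->
  (\esum_(i in I) \esum_(j in J) a i j = \esum_(j in J) \esum_(i in I) a i j)%E.
Proof.
move=> a0; rewrite (@esum_esum _ _ _ I (fun=> J))// esum_esum; last first.
  by move=> i j Ji Ij; exact: a0.
rewrite (reindex_esum (J `*`` (fun=> I)) _ (fun x => (x.2, x.1)))//; split=> //=.
- by move=> [i j] [/=].
- by move=> [i1 i2] [j1 j2] /= _ _ [] -> ->.
- by move=> [i j] [/= Ii Jj]; exists (j, i).
Qed.

Lemma esum_le_seq (I : set T) (a : T -> \bar R) (b : \bar R) :
  (forall s : seq T, uniq s -> (forall x, x \in s -> I x) ->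
     \sum_(x <- s) a x <= b)%E -> (\esum_(i in I) a i <= b)%E.
Proof.
move=> H; apply: ge_ereal_sup => _ [A [fA AI] <-]; rewrite fsbig_finite//=.
apply: H; first exact: finmap.fset_uniq.
move=> x xA; apply: AI; apply/set_mem.
by have <- : (x \in finmap.enum_fset (fset_set A)) = (x \in A) := in_fset_set fA x.
Qed.

Lemma esum_ge_seq (I : set T) (a : T -> \bar R) (s : seq T) : uniq s ->
  (forall x, x \in s -> I x) -> (\sum_(x <- s) a x <= \esum_(i in I) a i)%E.
Proof.
move=> us sI; apply: esum_ge; exists [set` s]; last by rewrite -fsbig_seq.
by split=> [|x /= /sI//]; exact: finite_seq.
Qed.

End esum_extra.

(** * Balance inequalities for a stationary law, and the Lyapunov bounds they imply *)

Section stationary_expectation.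
Variables (R : realType) (S : choiceType) (E : set S) (rate : S -> S -> R).
Variable p : S -> \bar R.
Variable gen : S -> seq (R * S).

(* [gen x] lists the jumps out of x with their rates; several entries may have
   the same target. *)
Definition generates : Prop :=
  [/\ forall x y, E x -> rate x y = \sum_(k <- gen x) k.1 * (y == k.2)%:R,
      forall x k, E x -> k \in gen x -> 0 <= k.1 &
      forall x k, E x -> k \in gen x -> 0 < k.1 -> E k.2 /\ k.2 != x].

Definition out_rate x := \sum_(k <- gen x) k.1.
Definition inflow (f : S -> R) x := \sum_(k <- gen x) k.1 * f k.2.
Definition drift (f : S -> R) x := \sum_(k <- gen x) k.1 * (f k.2 - f x).

Definition mean (g : S -> R) : \bar R :=
  (\esum_(x in E) (p x * (g x)%:E))%E.

(** [esum] is a supremum of finite partial sums and represents the sum only for nonnegative terms;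
    the sign condition therefore travels with the bound. *)
Definition mean_le (g : S -> R) (b : R) : Prop :=
  (forall x, E x -> 0 <= g x) /\ (mean g <= b%:E)%E.

Hypothesis genP : generates.
Hypothesis pP : stationary_distribution E rate p.

Let w x := fine (p x).

Let p_ge0 x : E x -> (0 <= p x)%E. Proof. by case: pP => + _ _; apply. Qed.

Let p_fin x : E x -> p x = (w x)%:E.
Proof.
move=> Ex; rewrite /w fineK// ge0_fin_numE ?p_ge0//.
apply: (@le_lt_trans _ _ 1%E); last exact: ltry.
case: pP => p0 <- _; apply: esum_ge; exists [set x].
  by split=> [|_ ->].
by rewrite fsbig_set1.
Qed.

Let w_ge0 x : E x -> 0 <= w x.
Proof. by move=> Ex; rewrite fine_ge0// p_ge0. Qed.

Let rate_ge0 x y : E x -> 0 <= rate x y.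
Proof.
move=> Ex; case: genP => rE r0 _; rewrite rE// big_seq sumr_ge0// => k kx.
by rewrite mulr_ge0// (r0 x).
Qed.

Lemma esum_rate f x : E x -> (forall y, E y -> 0 <= f y) ->
  (\esum_(y in E `\ x) (rate x y * f y)%:E = (inflow f x)%:E)%E.
Proof.
move=> Ex f0; case: genP => rE r0 rin.
transitivity (\esum_(y in E `\ x)
    (\sum_(k <- gen x | k \in gen x) (k.1 * (y == k.2)%:R * f y)%:E))%E.
  by apply: eq_esum => y _; rewrite rE// mulr_suml -sumEFin -big_seq.
rewrite esum_sum; last first.
  by move=> y k [Ey _] kx; rewrite lee_fin mulr_ge0 ?f0// mulr_ge0// (r0 x).
rewrite /inflow -sumEFin [RHS]big_seq; apply: eq_bigr => k kx.
have [k0|] := ltP 0 k.1; last first.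
  rewrite le_eqVlt ltNge (r0 _ _ Ex kx) orbF => /eqP ->.
  by rewrite mul0r esum1// => y _; rewrite !mul0r.
have [Ek kNx] := rin _ _ Ex kx k0.
rewrite (esumID [set k.2]); last first.
  by move=> y [Ey _]; rewrite lee_fin mulr_ge0 ?f0// mulr_ge0// (r0 x).
rewrite [X in (_ + X)%E]esum1 ?adde0; last first.
  by move=> y [_ /= /eqP/negbTE ->]; rewrite mulr0 mul0r.
rewrite setIidr ?esum_set1 ?eqxx ?mulr1//.
  by rewrite lee_fin mulr_ge0 ?f0// ltW.
by move=> _ ->; split=> //=; apply/eqP.
Qed.

Lemma exit_rateE x : E x -> exit_rate E rate x = out_rate x.
Proof.
move=> Ex; rewrite /exit_rate.
have := @esum_rate (fun=> 1) x Ex (fun _ _ => ler01).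
under eq_esum do rewrite mulr1.
move=> -> /=; rewrite /inflow /out_rate.
by apply: eq_bigr => k _; rewrite mulr1.
Qed.

Let out_rate_ge0 x : E x -> 0 <= out_rate x.
Proof.
move=> Ex; case: genP => _ r0 _; rewrite /out_rate big_seq sumr_ge0// => k.
exact: r0.
Qed.

Let transition_diag t y :
  E y -> 0 <= t -> ((expR (- (out_rate y * t)))%:E <= transition E rate t y y)%E.
Proof.
move=> Ey t0; apply: (@le_trans _ _ (transition_upto E rate 0 t y y)).
  by rewrite /= eqxx adde0 exit_rateE.
by apply: ereal_sup_ubound; exists 0%N.
Qed.

(** Only the paths with a single jump are kept. Extending both holding times to the whole of [t]
    bounds the integrand below by a constant. *)
Let transition_jump t x y : E x -> E y -> x != y -> 0 <= t ->
  ((t * rate x y * expR (- ((out_rate x + out_rate y) * t)))%:E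
     <= transition E rate t x y)%E.
Proof.
move=> Ex Ey xy t0; apply: (@le_trans _ _ (transition_upto E rate 1 t x y));
  last by apply: ereal_sup_ubound; exists 1%N.
rewrite /= (negbTE xy) add0e.
set F := (X in (_ <= integral _ _ X)%E).
have FE s : F s = (expR (- (out_rate x * s)) *
    (rate x y * expR (- (out_rate y * (t - s)))))%:E.
  rewrite /F EFinM exit_rateE//; congr (_ * _)%E.
  rewrite (esumID [set y]); last first.
    move=> z [Ez _]; rewrite mule_ge0 ?lee_fin ?rate_ge0//.
    by case: ifP => _; rewrite adde0// lee_fin expR_ge0.
  rewrite [X in (_ + X)%E]esum1 ?adde0; last first.
    by move=> z [_ /= /eqP/negbTE ->]; rewrite add0e mule0.
  rewrite setIidr ?esum_set1 ?eqxx ?adde0 ?exit_rateE//.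
    by rewrite mule_ge0 ?lee_fin ?rate_ge0 ?expR_ge0.
  by move=> _ ->; split=> //=; apply/eqP; rewrite eq_sym.
set c := rate x y * expR (- ((out_rate x + out_rate y) * t)).
rewrite -mulrA -/c mulrC EFinM.
have -> : (c%:E * t%:E =
    \int[lebesgue_measure]_(s in `[0%R, t]) (cst c%:E s))%E.
  rewrite integral_cst//= lebesgue_measure_itv/= lte_fin.
  case: ltP => [_|t0']; first by rewrite oppr0 adde0.
  by have -> : t = 0 by apply/eqP; rewrite eq_le t0 t0'.
have -> : F = EFin \o (fun s => expR (- (out_rate x * s)) *
    (rate x y * expR (- (out_rate y * (t - s))))).
  by apply/funext => s; rewrite FE.
apply: ge0_le_integral => //=.
- by move=> s _; rewrite lee_fin mulr_ge0 ?rate_ge0 ?expR_ge0.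
- apply/measurable_EFinP/measurable_funTS; apply: continuous_measurable_fun.
  move=> s; apply: cvgM.
    apply: continuous_comp; last exact: continuous_expR.
    by apply: cvgN; apply: cvgM; [exact: cvg_cst | exact: cvg_id].
  apply: cvgM; first exact: cvg_cst.
  apply: continuous_comp; last exact: continuous_expR.
  apply: cvgN; apply: cvgM; first exact: cvg_cst.
  by apply: cvgB; [exact: cvg_cst | exact: cvg_id].
- move=> s; rewrite in_itv/= => /andP[s0 st]; rewrite lee_fin /c mulrCA.
  rewrite ler_wpM2l ?rate_ge0// -expRD ler_expR.
  have := out_rate_ge0 Ex; have := out_rate_ge0 Ey; nra.
Qed.

(** Stationarity at time [t], restricted to finitely many sources and to at most one jump, reads [w
    y >= w y (1 - out y t) + t inflow - O(t^2)]; dividing by [t] and letting it tend to zero gives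
    the claim. The error is uniform because the set of sources is finite. *)
Lemma flow_le y : E y ->
  (\esum_(x in E) (w x * ((x != y)%:R * rate x y))%:E
     <= (w y * out_rate y)%:E)%E.
Proof.
move=> Ey; apply: ge_ereal_sup => _ [X0 [fX0 X0E] <-].
pose X := X0 `|` [set y].
have fX : finite_set X by rewrite finite_setU; split=> //; exact: finite_set1.
have XE x : X x -> E x by case=> [/X0E|->].
apply: (@le_trans _ _ (\sum_(x \in X) (w x * ((x != y)%:R * rate x y))%:E)%E).
  apply: lee_fsum_nneg_subset => //.
    by move=> x; rewrite !inE => Xx; left.
  move=> x; rewrite !inE => /andP[_]; rewrite inE => /XE Ex.
  by rewrite lee_fin mulr_ge0 ?w_ge0// mulr_ge0 ?rate_ge0.
rewrite fsbig_finite//= sumEFin lee_fin.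
pose s : seq S := finmap.enum_fset (fset_set X).
have in_s x : (x \in s) = (x \in X) := in_fset_set fX x.
have ys : y \in s by rewrite in_s inE; right.
have sE x : x \in s -> E x by rewrite in_s inE => /XE.
have us : uniq s := finmap.fset_uniq _.
rewrite -/s.
pose c x := out_rate x + out_rate y.
(* [t * K] collects the errors of [expR (- c t) >= 1 - c t] after division by [t]. *)
pose K := \sum_(x <- s) (w x * ((x != y)%:R * rate x y)) * c x.
have K0 : 0 <= K.
  rewrite /K big_seq sumr_ge0// => x /sE Ex.
  by rewrite !mulr_ge0 ?w_ge0 ?rate_ge0// addr_ge0 ?out_rate_ge0.
have step t : 0 < t ->
    \sum_(x <- s) w x * ((x != y)%:R * rate x y) - t * K <= w y * out_rate y.
  move=> t0; have tge0 := ltW t0.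
  have : \sum_(x <- s) w x * ((x == y)%:R * expR (- (out_rate y * t)) +
      (x != y)%:R * (t * rate x y * expR (- (c x * t)))) <= w y.
    rewrite -lee_fin -p_fin//; case: pP => _ _ /(_ t y tge0 Ey) <-.
    apply: esum_ge; exists X; first by split.
    rewrite fsbig_finite//= -sumEFin [leLHS]big_seq [leRHS]big_seq lee_sum// => x xs.
    have Ex := sE x xs.
    rewrite p_fin// EFinM lee_wpmul2l ?lee_fin ?w_ge0//.
    have [->|xy] := eqVneq x y.
      by rewrite mul1r mul0r addr0 transition_diag.
    by rewrite mul0r mul1r add0r transition_jump.
  under eq_bigr do rewrite mulrDr.
  rewrite big_split/= (bigD1_seq y)//= eqxx mul1r big1 ?addr0; last first.
    by move=> x /negbTE ->; rewrite mul0r mulr0.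
  have e1 := expR_ge1Dx (- (out_rate y * t)).
  set S1 := \sum_(x <- s) _; set S2 := \sum_(x <- s) _.
  have : t * (S2 - t * K) <= S1.
    rewrite /S1 /S2 /K mulr_sumr -sumrB mulr_sumr big_seq [leRHS]big_seq.
    apply: ler_sum => x /sE Ex; have := expR_ge1Dx (- (c x * t)).
    have : 0 <= w x * ((x != y)%:R * rate x y).
      by rewrite mulr_ge0 ?w_ge0// mulr_ge0 ?rate_ge0.
    set a := w x * _ => a0 e2.
    have -> : w x * ((x != y)%:R * (t * rate x y * expR (- (c x * t)))) =
      a * (t * expR (- (c x * t))) by rewrite /a; ring.
    rewrite [leLHS](_ : _ = a * (t * (1 - c x * t))); last by ring.
    by rewrite ler_wpM2l// ler_wpM2l.
  move=> h1 h2; rewrite -(ler_pM2l t0).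
  have := w_ge0 Ey; move: e1 h1 h2; set e := expR _ => e1 h1 h2 wy.
  have : w y * (1 + - (out_rate y * t)) <= w y * e by rewrite ler_wpM2l.
  lra.
(* The choice [t = e / (K + 1)] makes the error at most [e], also when [K = 0]. *)
apply/ler_addgt0Pr => e e0.
have K1 : 0 < K + 1 by lra.
have := step (e / (K + 1)) (divr_gt0 e0 K1).
have : e / (K + 1) * K <= e.
  by rewrite mulrAC ler_pdivrMr// ler_wpM2l ?ltW//; lra.
lra.
Qed.

Let meanE g : mean g = (\esum_(x in E) (w x * g x)%:E)%E.
Proof. by apply: eq_esum => x Ex; rewrite p_fin. Qed.

Lemma mean_ge0 g : (forall x, E x -> 0 <= g x) -> (0 <= mean g)%E.
Proof. by move=> g0; apply: esum_ge0 => x Ex; rewrite mule_ge0 ?p_ge0 ?lee_fin ?g0. Qed.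

Lemma le_mean g h : (forall x, E x -> g x <= h x) -> (mean g <= mean h)%E.
Proof.
by move=> gh; apply: le_esum => x Ex; rewrite lee_wpmul2l ?p_ge0 ?lee_fin ?gh.
Qed.

Lemma meanD g h : (forall x, E x -> 0 <= g x) -> (forall x, E x -> 0 <= h x) ->
  mean (fun x => g x + h x) = (mean g + mean h)%E.
Proof.
move=> g0 h0; rewrite !meanE -esumD; last 2 first.
- by move=> x Ex; rewrite lee_fin mulr_ge0 ?w_ge0 ?g0.
- by move=> x Ex; rewrite lee_fin mulr_ge0 ?w_ge0 ?h0.
by apply: eq_esum => x _; rewrite mulrDr EFinD.
Qed.

Lemma meanZ c g : 0 <= c -> (forall x, E x -> 0 <= g x) ->
  mean (fun x => c * g x) = (c%:E * mean g)%E.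
Proof.
move=> c0 g0; rewrite !meanE -esumZl//; last first.
  by move=> x Ex; rewrite lee_fin mulr_ge0 ?w_ge0 ?g0.
by apply: eq_esum => x _; rewrite mulrCA EFinM.
Qed.

Lemma mean_le_mono g h b c : (forall x, E x -> 0 <= g x <= h x) -> b <= c ->
  mean_le h b -> mean_le g c.
Proof.
move=> gh bc [h0 hb]; split=> [x /gh/andP[]//|].
apply: (le_trans (le_mean (h := h) _)); first by move=> x /gh/andP[].
by apply: (le_trans hb); rewrite lee_fin.
Qed.

Lemma mean_leD g h b c : mean_le g b -> mean_le h c ->
  mean_le (fun x => g x + h x) (b + c).
Proof.
move=> [g0 gb] [h0 hc]; split=> [x Ex|]; first by rewrite addr_ge0 ?g0 ?h0.
by rewrite meanD// EFinD leeD.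
Qed.

Lemma mean_leZ a g b : 0 <= a -> mean_le g b ->
  mean_le (fun x => a * g x) (a * b).
Proof.
move=> a0 [g0 gb]; split=> [x Ex|]; first by rewrite mulr_ge0 ?g0.
by rewrite meanZ// EFinM lee_wpmul2l ?lee_fin.
Qed.

Lemma mean_le_cst c : 0 <= c -> mean_le (fun=> c) c.
Proof.
move=> c0; split=> //; have -> : (fun _ : S => c) = (fun x => c * 1).
  by apply/funext => x; rewrite mulr1.
rewrite meanZ// -[leRHS]mule1 lee_wpmul2l ?lee_fin//.
case: pP => _ p1 _; rewrite -[leRHS]p1; apply: le_esum => x Ex.
by rewrite mule1.
Qed.

(** A finite partial sum involves only states with [N] below some [K], so truncated bounds uniform
    in [K] pass to the supremum. This replaces an a priori integrability. *)
Lemma mean_le_sup (N : S -> nat) g b : (forall x, E x -> 0 <= g x) ->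
  (forall K, mean_le (fun x => g x * (N x <= K)%N%:R) b) -> mean_le g b.
Proof.
move=> g0 H; split=> //; rewrite meanE; apply: esum_le_seq => s us sE.
pose K := (\sum_(x <- s) N x)%N.
have [_] := H K; rewrite meanE; apply: le_trans.
apply: le_trans (esum_ge_seq _ us sE).
rewrite big_seq [leRHS]big_seq; apply: lee_sum => x xA.
suff -> : (N x <= K)%N by rewrite mulr1.
rewrite /K (big_rem x)//=; exact: leq_addr.
Qed.

Let inflow_ge0 f x : (forall x, E x -> 0 <= f x) -> E x -> 0 <= inflow f x.
Proof.
move=> f0 Ex; rewrite -lee_fin -esum_rate// esum_ge0// => y [Ey _].
by rewrite lee_fin mulr_ge0 ?rate_ge0 ?f0.
Qed.

Let outM_ge0 f x : (forall x, E x -> 0 <= f x) -> E x -> 0 <= out_rate x * f x.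
Proof. by move=> f0 Ex; rewrite mulr_ge0 ?out_rate_ge0 ?f0. Qed.

Lemma driftE f x : drift f x = inflow f x - out_rate x * f x.
Proof.
rewrite /drift /inflow /out_rate mulr_suml -sumrB.
by apply: eq_bigr => k _; rewrite mulrBr.
Qed.

(** Weight the balance inequality of [flow_le] by [f] and sum over the states; all terms are
    nonnegative, so the sums may be exchanged. *)
Lemma mean_inflow_le f : (forall x, E x -> 0 <= f x) ->
  (mean (inflow f) <= mean (fun x => (out_rate x * f x)%R))%E.
Proof.
move=> f0; rewrite !meanE.
have -> : (\esum_(x in E) (w x * inflow f x)%:E =
    \esum_(x in E) \esum_(y in E)
      ((f y)%:E * (w x * ((x != y)%:R * rate x y))%:E))%E.
  apply: eq_esum => x Ex; rewrite EFinM -esum_rate//.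
  rewrite -esumZl ?w_ge0//; last first.
    by move=> y [Ey _]; rewrite lee_fin mulr_ge0 ?rate_ge0 ?f0.
  rewrite [RHS](esumID [set x]); last first.
    move=> y Ey; rewrite mule_ge0 ?lee_fin ?f0// mulr_ge0 ?w_ge0//.
    by rewrite mulr_ge0 ?rate_ge0.
  rewrite [X in (X + _)%E]esum1 ?add0e; last first.
    by move=> y [_ /= ->]; rewrite eqxx mul0r mulr0 mule0.
  apply: eq_esum => y [_ /= /eqP yx]; rewrite eq_sym yx mul1r -!EFinM.
  by congr EFin; ring.
rewrite exchange_esum; last first.
  move=> x y Ex Ey; rewrite mule_ge0 ?lee_fin ?f0// mulr_ge0 ?w_ge0//.
  by rewrite mulr_ge0 ?rate_ge0.
apply: le_esum => y Ey; rewrite esumZl ?f0//; last first.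
  by move=> x Ex; rewrite lee_fin mulr_ge0 ?w_ge0// mulr_ge0 ?rate_ge0.
rewrite mulrA [X in (_ <= X%:E)%E]mulrC EFinM lee_wpmul2l ?lee_fin ?f0//.
exact: flow_le.
Qed.

(** Inflow at most outflow says that the drift of [f] has nonpositive mean, once the outflow of [f]
    is finite and can be cancelled. No moment of the exit rate itself enters, so this form comes
    before any moment bound. *)
Lemma lower_lyapunov f g h b : (forall x, E x -> 0 <= f x) ->
  (mean (fun x => (out_rate x * f x)%R) < +oo)%E ->
  (forall x, E x -> 0 <= g x <= drift f x + h x) ->
  mean_le h b -> mean_le g b.
Proof.
move=> f0 qf gh [h0 hb]; split=> [x /gh/andP[]//|].
have fin : mean (fun x => out_rate x * f x) \is a fin_num.
  by rewrite ge0_fin_numE ?mean_ge0// => x; exact: (outM_ge0 f0).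
rewrite -(leeD2lE _ _ fin) -meanD; last 2 first.
- by move=> x; exact: (outM_ge0 f0).
- by move=> x /gh/andP[].
apply: (@le_trans _ _ (mean (fun x => inflow f x + h x))).
  by apply: le_mean => x /gh/andP[_]; rewrite driftE; lra.
rewrite meanD; last 2 first.
- by move=> x Ex; exact: (inflow_ge0 f0 Ex).
- by [].
by rewrite leeD// mean_inflow_le.
Qed.

(** For bounded [g], apply the opposite inequality to [C - g]: the contributions of the constant [C]
    balance, and the sign is reversed. The finite mean of the exit rate allows the cancellation; the
    general case follows by truncation. *)
Lemma mean_inflow_ge f : (mean out_rate < +oo)%E ->
  (forall x, E x -> 0 <= f x) ->
  (mean (fun x => (out_rate x * f x)%R) <= mean (inflow f))%E.
Proof.
move=> qfin f0.
have bounded g C : (forall x, 0 <= g x <= C) ->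
    (mean (fun x => (out_rate x * g x)%R) <= mean (inflow g))%E.
  move=> gC; have C0 : 0 <= C.
    have [x0|] := pselect (exists x : S, E x).
      by have [x _] := x0; have := gC x; lra.
    move=> nE; have : E = set0.
      by apply/seteqP; split=> // x Ex; apply: nE; exists x.
    case: pP => _ + _ => /[swap] ->; rewrite esum_set0.
    by move=> /eqP; rewrite eq_sym onee_eq0.
  have g0 x : E x -> 0 <= g x by have := gC x; lra.
  have Cg0 x : E x -> 0 <= C - g x by have := gC x; lra.
  have := mean_inflow_le Cg0.
  have fin : mean (fun x => out_rate x * (C - g x)) \is a fin_num.
    rewrite ge0_fin_numE ?mean_ge0//; last by move=> x; exact: (outM_ge0 Cg0).
    apply: (@le_lt_trans _ _ (C%:E * mean out_rate)%E); last first.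
      by rewrite lte_mul_pinfty// ge0_fin_numE ?mean_ge0.
    rewrite -meanZ//; apply: le_mean => x Ex.
    by rewrite mulrC ler_wpM2r ?out_rate_ge0//; have := gC x; lra.
  move=> h; rewrite -(leeD2rE _ _ fin).
  apply: (@le_trans _ _ (mean (inflow g) + mean (inflow (fun x => (C - g x)%R)))%E).
    rewrite -!meanD; last 4 first.
    - by move=> x Ex; exact: (outM_ge0 g0 Ex).
    - by move=> x Ex; exact: (outM_ge0 Cg0 Ex).
    - by move=> x Ex; exact: (inflow_ge0 g0 Ex).
    - by move=> x Ex; exact: (inflow_ge0 Cg0 Ex).
    apply: le_mean => x Ex; rewrite /inflow -big_split/=.
    rewrite -mulrDr addrCA subrr addr0 /out_rate mulr_suml.
    by apply: ler_sum => k _; rewrite -mulrDr addrCA subrr addr0.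
  by rewrite leeD2l.
rewrite [leLHS]meanE; apply: esum_le_seq => s us sE.
pose C := \sum_(x <- s) f x.
have C0 : 0 <= C by rewrite /C big_seq sumr_ge0// => x /sE; exact: f0.
(* On the finite list [s] the truncation at [C] is inactive, while [inflow g <= inflow f]. The
   maximum with 0 bounds [g] on all of [S], since [f] has a sign on [E] only. *)
pose g x := Num.min (Num.max 0 (f x)) C.
apply: (@le_trans _ _ (mean (fun x => (out_rate x * g x)%R))).
  rewrite meanE; apply: le_trans (esum_ge_seq _ us sE).
  rewrite big_seq [leRHS]big_seq; apply: lee_sum => x xs.
  have fC : f x <= C.
    rewrite /C (big_rem x)//= lerDl big_seq sumr_ge0// => z /mem_rem /sE.
    exact: f0.
  by rewrite /g max_r ?f0// ?min_l//; exact: sE.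
apply: (le_trans (bounded g C _)).
  by move=> x; rewrite /g le_min C0 le_max lexx/= ge_min lexx orbT.
apply: le_mean => x Ex; case: genP => _ r0 rin; rewrite /inflow big_seq [leRHS]big_seq.
apply: ler_sum => k kx; have k0 := r0 _ _ Ex kx.
have [->|kn0] := eqVneq k.1 0; first by rewrite !mul0r.
have k_gt0 : 0 < k.1 by rewrite lt_neqAle eq_sym kn0.
have [Ek _] := rin _ _ Ex kx k_gt0.
by rewrite ler_wpM2l// /g max_r ?f0// ge_min lexx.
Qed.

Lemma lyapunov f g h b : (mean out_rate < +oo)%E ->
  (forall x, E x -> 0 <= f x) ->
  (mean (fun x => (out_rate x * f x)%R) < +oo)%E ->
  (forall x, E x -> 0 <= g x <= h x - drift f x) ->
  mean_le h b -> mean_le g b.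
Proof.
move=> qfin f0 qf gh [h0 hb]; split=> [x /gh/andP[]//|].
have fin : mean (fun x => out_rate x * f x) \is a fin_num.
  by rewrite ge0_fin_numE ?mean_ge0// => x; exact: (outM_ge0 f0).
rewrite -(leeD2lE _ _ fin); apply: (@le_trans _ _ (mean (inflow f) + mean g)%E).
  by rewrite leeD2r// mean_inflow_ge.
rewrite -meanD; last 2 first.
- by move=> x Ex; exact: (inflow_ge0 f0 Ex).
- by move=> x /gh/andP[].
apply: (@le_trans _ _ (mean (fun x => out_rate x * f x + h x))).
  by apply: le_mean => x /gh/andP[_]; rewrite driftE; lra.
by rewrite meanD ?leeD2l// => x; exact: (outM_ge0 f0).
Qed.

End stationary_expectation.

(** * Moments and tail of the M/M/oo queue *)

Lemma cube_le_exp2 n : (n.+1 ^ 3 <= 8 * 2 ^ n)%N.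
Proof.
case: n => // -[//|[//|n]].
elim: n => // n IH; rewrite [in leqRHS]expnS mulnCA.
apply: leq_trans (leq_mul (leqnn 2) IH); rewrite !expnS expn0; nia.
Qed.

Section death_counter.
Variables (R : realType) (S : choiceType) (E : set S) (rate : S -> S -> R).
Variables (p : S -> \bar R) (gen : S -> seq (R * S)).
Hypothesis genP : generates E rate gen.
Hypothesis pP : stationary_distribution E rate p.
Variables (lam mu : R) (N : S -> nat).
Hypotheses (lam0 : 0 < lam) (mu0 : 0 < mu).

(* Under every policy the number of tasks is an M/M/oo queue. *)
Definition infinite_server : Prop :=
  (forall x (phi : nat -> R), E x ->
    drift gen (fun x => phi (N x)) x =
      lam * (phi (N x).+1 - phi (N x)) +
      mu * (N x)%:R * (phi (N x).-1 - phi (N x))) /\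
  (forall x, E x -> out_rate gen x = lam + mu * (N x)%:R).

Hypothesis NP : infinite_server.

(** The function [2^K - 2^k], cut to zero above [K], is bounded and vanishes for large [k]: its
    outflow is finite, and [lower_lyapunov] applies before any moment is known. On [k <= K] its
    drift is at least [2^k] up to a constant independent of [K]. *)
Lemma mean_exp2 : exists C : R, mean_le E p (fun x => 2 ^+ N x) C.
Proof.
have [driftN outN] := NP.
(* From [M] on, [mu k / 2 - lam >= 1]; below [M] the loss is at most [(lam + 1) 2^M]. *)
pose M := (Num.truncn ((2 * lam + 2) / mu)).+1.
have HM : 2 * lam + 2 <= mu * M%:R.
  by rewrite [leRHS]mulrC -ler_pdivrMr// ltW// truncnS_gt.
exists ((lam + 1) * 2 ^+ M).
apply: (@mean_le_sup _ _ _ _ _ pP N) => [x _|K]; first exact: exprn_ge0.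
pose phi k : R := if (k <= K)%N then 2 ^+ K - 2 ^+ k else 0.
have phi0 k : 0 <= phi k <= 2 ^+ K.
  rewrite /phi; case: leqP => kK; last by rewrite lexx exprn_ge0.
  by rewrite subr_ge0 ler_eXn2l ?ltr1n// kK/= lerBlDr lerDl exprn_ge0.
apply: (lower_lyapunov genP pP (f := fun x => phi (N x)) (h := fun=> (lam + 1) * 2 ^+ M)).
- by move=> x _; have /andP[] := phi0 (N x).
- apply: (@le_lt_trans _ _ ((lam + mu * K%:R) * 2 ^+ K)%:E); last exact: ltry.
  apply: (le_trans (le_mean pP (h := fun=> (lam + mu * K%:R) * 2 ^+ K) _)).
    move=> x Ex; rewrite outN// /phi; case: leqP => xK; last first.
      by rewrite mulr0 mulr_ge0 ?exprn_ge0// addr_ge0 ?mulr_ge0 // ltW.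
    apply: ler_pM.
    + by rewrite addr_ge0 ?mulr_ge0 ?(ltW lam0) ?(ltW mu0).
    + by rewrite subr_ge0 ler_eXn2l ?ltr1n.
    + by rewrite lerD2l ler_pM2l// ler_nat.
    + by rewrite lerBlDr lerDl exprn_ge0.
  have [] // := mean_le_cst pP (c := (lam + mu * K%:R) * 2 ^+ K).
  by rewrite mulr_ge0 ?exprn_ge0 ?addr_ge0 ?mulr_ge0 // ltW.
- move=> x Ex; rewrite driftN//; apply/andP; split.
    by rewrite mulr_ge0 ?exprn_ge0.
  have e0 : (0 : R) < 2 ^+ N x by rewrite exprn_gt0.
  have eM : (0 : R) < 2 ^+ M by rewrite exprn_gt0.
  have key : 2 ^+ N x <= mu * (N x)%:R * (2 ^+ N x / 2) - lam * 2 ^+ N x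
                         + (lam + 1) * 2 ^+ M.
    case: (leqP M (N x)) => MN.
      have : mu * M%:R <= mu * (N x)%:R by rewrite ler_pM2l// ler_nat.
      move=> h; have : 0 <= (mu * (N x)%:R - (2 * lam + 2)) * (2 ^+ N x / 2).
        by rewrite mulr_ge0 ?divr_ge0 ?(ltW e0)//; lra.
      have : 0 <= (lam + 1) * 2 ^+ M by rewrite mulr_ge0 ?(ltW eM)// addr_ge0// ltW.
      nra.
    have : (2 : R) ^+ N x <= 2 ^+ M by rewrite ler_eXn2l ?ltr1n// ltnW.
    move=> h; have : 0 <= (lam + 1) * (2 ^+ M - 2 ^+ N x).
      by rewrite mulr_ge0 ?subr_ge0// addr_ge0// ltW.
    have : 0 <= mu * (N x)%:R * (2 ^+ N x / 2).
      by rewrite !mulr_ge0 ?invr_ge0 ?(ltW e0) ?(ltW mu0).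
    lra.
  have half : (0 < N x)%N -> (2 : R) ^+ (N x).-1 = 2 ^+ N x / 2.
    by move=> n0; rewrite -[in RHS](prednK n0) exprS mulrC mulKf// pnatr_eq0.
  rewrite /phi; case: (leqP (N x) K) => NK; last first.
    rewrite leqNgt (ltn_trans NK)// mulr0 subrr mulr0 add0r.
    have [->|NK1] := eqVneq (N x).-1 K.
      rewrite leqnn !subrr mulr0 add0r mulr_ge0 ?(ltW eM)// addr_ge0//.
      exact: ltW.
    rewrite leqNgt (_ : (K < (N x).-1)%N) ?subrr ?mulr0 ?add0r; last first.
      by rewrite ltn_neqAle eq_sym NK1/=; case: (N x) NK.
    by rewrite mulr_ge0 ?(ltW eM)// addr_ge0// ltW.
  rewrite (leq_trans (leq_pred _) NK) mulr1.
  have -> : mu * (N x)%:R * (2 ^+ K - 2 ^+ (N x).-1 - (2 ^+ K - 2 ^+ N x)) =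
            mu * (N x)%:R * (2 ^+ N x / 2).
    case: (posnP (N x)) => [->|/half ->]; first by rewrite mulr0 !mul0r.
    by field.
  case: ltnP => NK'; first by rewrite exprS; move: key; nra.
  have -> : N x = K by apply/eqP; rewrite eqn_leq NK.
  rewrite subrr subr0 mulr0; move: key.
  have -> : N x = K by apply/eqP; rewrite eqn_leq NK.
  have : (0 : R) <= lam * 2 ^+ K by rewrite mulr_ge0 ?exprn_ge0 // ltW.
  lra.
- by apply: (mean_le_cst pP); rewrite mulr_ge0 ?exprn_ge0// addr_ge0// ltW.
Qed.

(** The exit rate is affine in [N], so this growth condition and the exponential moment make the
    outflow of [f] integrable. *)
Definition tame (f : S -> R) : Prop :=
  exists C : R, forall x, E x -> (N x).+1%:R * f x <= C * 2 ^+ N x.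

Lemma mean_out_tame f : (forall x, E x -> 0 <= f x) -> tame f ->
  (mean E p (fun x => (out_rate gen x * f x)%R) < +oo)%E.
Proof.
move=> f0 [C HC]; have [driftN outN] := NP.
have [D HD] := mean_exp2.
have C0 : 0 <= Num.max C 0 by rewrite le_max lexx orbT.
have lm0 : 0 <= lam + mu by rewrite addr_ge0// ltW.
have [_] := mean_leZ pP (mulr_ge0 lm0 C0) HD.
move=> h; apply: (le_lt_trans _ (ltry _)); apply: le_trans h.
apply: (le_mean pP) => x Ex; rewrite outN// -mulrA.
apply: (@le_trans _ _ ((lam + mu) * ((N x).+1%:R * f x))).
  rewrite mulrA ler_wpM2r ?f0// -natr1.
  have : 0 <= lam * (N x)%:R by rewrite mulr_ge0// ltW.
  by move: mu0; lra.
rewrite ler_wpM2l//; apply: (le_trans (HC x Ex)).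
by rewrite ler_wpM2r ?exprn_ge0// le_max lexx.
Qed.

Lemma tame_lyapunov f g h b : (forall x, E x -> 0 <= f x) -> tame f ->
  (forall x, E x -> 0 <= g x <= h x - drift gen f x) ->
  mean_le E p h b -> mean_le E p g b.
Proof.
move=> f0 tf; apply: (lyapunov genP pP _ f0); last exact: mean_out_tame.
have -> : out_rate gen = (fun x => out_rate gen x * 1).
  by apply/funext => x; rewrite mulr1.
apply: (mean_out_tame (f := fun=> 1)) => //.
exists 8 => x _; rewrite mulr1 -natrX -natrM ler_nat.
apply: leq_trans (cube_le_exp2 _).
by rewrite -[leqLHS]expn1 leq_pexp2l.
Qed.

Lemma tame_quadratic f C : (forall x, E x -> f x <= C * (N x).+1%:R ^+ 2) ->
  tame f.
Proof.
move=> fC; exists (8 * Num.max C 0) => x Ex.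
have C0 : 0 <= Num.max C 0 by rewrite le_max lexx orbT.
apply: (@le_trans _ _ (Num.max C 0 * (N x).+1%:R ^+ 3)).
  rewrite exprS mulrCA ler_wpM2l//; apply: (le_trans (fC x Ex)).
  by rewrite ler_wpM2r ?exprn_ge0// le_max lexx.
rewrite mulrAC [leLHS]mulrC ler_wpM2r// -!natrX -natrM ler_nat.
exact: cube_le_exp2.
Qed.

Lemma mean_count : mean_le E p (fun x => (N x)%:R) (lam / mu).
Proof.
have [driftN _] := NP.
have : mean_le E p (fun x => mu * (N x)%:R) lam.
  apply: (@tame_lyapunov (fun x => (N x)%:R) _ (fun=> lam)) => //.
  - apply: (@tame_quadratic _ 1) => x Ex; rewrite mul1r -natrX ler_nat.
    by rewrite expnS expn1; nia.
  - move=> x Ex; rewrite (driftN x (fun k => k%:R))//.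
    rewrite mulr_ge0 ?(ltW mu0)//=; case: (N x) => [|k] /=.
      by rewrite subr0 mulr0; lra.
    by rewrite -!natr1; lra.
  - by apply: (mean_le_cst pP); exact: ltW.
move=> /(mean_leZ pP (ltW (_ : 0 < mu^-1))); rewrite invr_gt0 => /(_ mu0).
rewrite mulrC; apply: (mean_le_mono pP) => // x Ex.
by rewrite ler0n mulKf ?gt_eqF// lexx.
Qed.

(** With [c = lam / mu] the drift of [(N - c)^2] equals [lam + mu N - 2 mu (N - c)^2], and the mean
    of [N] is at most [c]. *)
Lemma mean_count_var :
  mean_le E p (fun x => ((N x)%:R - lam / mu) ^+ 2) (lam / mu).
Proof.
have [driftN _] := NP; set c := lam / mu.
have c0 : 0 < c by rewrite divr_gt0.
have lamE : lam = mu * c by rewrite /c mulrCA divff ?mulr1 // gt_eqF.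
have : mean_le E p (fun x => 2 * mu * ((N x)%:R - c) ^+ 2)
    (lam + mu * c).
  apply: (@tame_lyapunov (fun x => ((N x)%:R - c) ^+ 2) _
      (fun x => lam + mu * (N x)%:R)) => //.
  - by move=> x _; exact: sqr_ge0.
  - apply: (@tame_quadratic _ ((1 + c) ^+ 2)) => x Ex; rewrite -natr1.
    have : (0 : R) <= (N x)%:R by []. set k := (N x)%:R => k0.
    by nra.
  - move=> x Ex; rewrite (driftN x (fun k => (k%:R - c) ^+ 2))//.
    have m2 : 0 <= 2 * mu by rewrite mulr_ge0// ltW.
    rewrite (mulr_ge0 m2 (sqr_ge0 _))/=; case: (N x) => [|k] /=.
      by rewrite subrr mulr0 !mulr0 lamE; nra.
    by rewrite -!natr1 lamE; nra.
  - exact: (mean_leD pP (mean_le_cst pP (ltW lam0))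
      (mean_leZ pP (ltW mu0) mean_count)).
have m2 : 0 <= (2 * mu)^-1 by rewrite invr_ge0 mulr_ge0 // ltW.
move=> /(mean_leZ pP m2); apply: (mean_le_mono pP).
  by move=> x Ex; rewrite sqr_ge0 mulKf ?gt_eqF ?mulr_gt0//= lexx.
rewrite lamE (_ : (2 * mu)^-1 * _ = c) //; field; exact: lt0r_neq0.
Qed.

(** The drift of the excess [(N - j)^+] is [lam] on [N >= j] minus [mu N] on [N > j], where
    [mu N >= mu (j + 1)]. *)
Lemma mean_tail_step j b :
  mean_le E p (fun x => (j <= N x)%N%:R) b ->
  mean_le E p (fun x => (j.+1 <= N x)%N%:R) (lam / (mu * j.+1%:R) * b).
Proof.
move=> hb; have [driftN _] := NP.
have : mean_le E p (fun x => mu * j.+1%:R * (j.+1 <= N x)%N%:R) (lam * b).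
  apply: (@tame_lyapunov (fun x => (N x - j)%N%:R) _
      (fun x => lam * (j <= N x)%N%:R)) => //.
  - apply: (@tame_quadratic _ 1) => x Ex; rewrite mul1r -natrX ler_nat.
    by rewrite expnS expn1; nia.
  - move=> x Ex; rewrite (driftN x (fun k => (k - j)%N%:R))//.
    rewrite !mulr_ge0 ?(ltW mu0)//=.
    have [jN|Nj|<-] := ltngtP j (N x).
    + rewrite (subSn (ltnW jN)) (_ : (N x - j)%N = ((N x).-1 - j).+1).
        have : mu * j.+1%:R <= mu * (N x)%:R by rewrite ler_pM2l// ler_nat.
        by rewrite -!natr1 /=; lra.
      by move: jN; clear; lia.
    + have e1 : ((N x).+1 - j)%N = 0%N by move: Nj; clear; lia.
      have e2 : (N x - j)%N = 0%N by move: Nj; clear; lia.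
      have e3 : ((N x).-1 - j)%N = 0%N by move: Nj; clear; lia.
      by rewrite e1 e2 e3 /= !subrr !mulr0; lra.
    + rewrite subSn// subnn (_ : (j.-1 - j)%N = 0%N) /=; last by clear; lia.
      by rewrite !subrr !mulr0 !subr0 addr0 !mulr1 subrr.
  - by apply: (mean_leZ pP) => //; exact: ltW.
have m0 : 0 < mu * j.+1%:R by rewrite mulr_gt0.
have mi : 0 <= (mu * j.+1%:R)^-1 by rewrite invr_ge0 ltW.
move=> /(mean_leZ pP mi); apply: (mean_le_mono pP).
  by move=> x Ex; rewrite ler0n mulKf ?gt_eqF ?lexx.
by rewrite mulrA [_^-1 * _]mulrC.
Qed.

(* Geometric decay of the tail, in the polynomial form [(1+s)^(4k) >= (1+sk)^4]. *)
Lemma mean_tail j k s : 0 < s -> (1 + s) * lam <= mu * j.+1%:R ->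
  mean_le E p (fun x => (j + 4 * k <= N x)%N%:R) (((1 + s * k%:R) ^+ 4)^-1).
Proof.
move=> s0 js; have s1 : 0 < 1 + s by lra.
have geo i : mean_le E p (fun x => (j + i <= N x)%N%:R) ((1 + s)^-1 ^+ i).
  elim: i => [|i IH].
    apply: (mean_le_mono pP _ _ (mean_le_cst pP ler01)) => // x _.
    by rewrite ler0n lern1 leq_b1.
  rewrite addnS exprS; apply: (mean_le_mono pP _ _ (mean_tail_step IH)).
    by move=> x _; rewrite ler0n lexx.
  rewrite ler_wpM2r ?exprn_ge0 ?invr_ge0 ?(ltW s1)//.
  rewrite ler_pdivrMr ?mulr_gt0// mulrC ler_pdivlMr// mulrC.
  apply: (le_trans js); rewrite ler_pM2l// ler_nat ltnS; exact: leq_addr.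
apply: (mean_le_mono pP _ _ (geo (4 * k)%N)) => [x _|]; first by rewrite ler0n lexx.
have bern : 1 + s * k%:R <= (1 + s) ^+ k.
  elim: k => [|k IH]; first by rewrite mulr0 addr0 expr0.
  rewrite exprS -natr1; have : 0 <= s * (s * k%:R) by rewrite !mulr_ge0// ltW.
  have : (1 + s) * (1 + s * k%:R) <= (1 + s) * (1 + s) ^+ k by rewrite ler_pM2l.
  lra.
have b0 : 0 < 1 + s * k%:R by rewrite ltr_pwDl ?mulr_ge0 ?(ltW s0).
rewrite mulnC exprVn exprM lef_pV2 ?posrE ?exprn_gt0//.
rewrite ler_pXn2r ?nnegrE ?exprn_ge0 ?(ltW b0) ?(ltW s1)//.
Qed.

End death_counter.

(** * Occupancy states *)

Lemma ler_sum_sub (R : numDomainType) (T : eqType) (s s' : seq T) (F : T -> R) :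
  uniq s -> {subset s <= s'} -> (forall x, 0 <= F x) ->
  \sum_(x <- s) F x <= \sum_(x <- s') F x.
Proof.
move=> + + F0; elim: s s' => [|x s IH] s' /=; first by rewrite big_nil sumr_ge0.
move=> /andP[xs us] ss'; have xs' : x \in s' by rewrite ss' ?mem_head.
rewrite big_cons (big_rem x xs')/= lerD2l; apply: IH => // y ys.
have : y \in s' by rewrite ss'// inE ys orbT.
rewrite (perm_mem (perm_to_rem xs')) inE => /predU1P[e|//].
by rewrite -e ys in xs.
Qed.

Section summation_by_parts.
Variables (R : numDomainType) (f : nat -> R).

Lemma sum_parts J :
  \sum_(0 <= j < J) j.+1%:R * (f j.+1 - f j.+2) + J%:R * f J.+1 =
  \sum_(0 <= j < J) f j.+1.
Proof.
elim: J => [|J IH]; first by rewrite !big_geq// mul0r addr0.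
rewrite !big_nat_recr//= -IH -!natr1; ring.
Qed.

Lemma sum_parts_le (D : pred nat) J : (forall j, D j.+1 -> D j) ->
  (forall j, 0 <= f j) ->
  \sum_(0 <= j < J | D j) j.+1%:R * (f j.+1 - f j.+2) <=
  \sum_(0 <= j < J | D j) f j.+1.
Proof.
move=> Ddown f0; suff : \sum_(0 <= j < J | D j) j.+1%:R * (f j.+1 - f j.+2) +
    (if D J then J%:R * f J.+1 else 0) <= \sum_(0 <= j < J | D j) f j.+1.
  by apply: le_trans; rewrite lerDl; case: ifP => // _; rewrite mulr_ge0.
elim: J => [|J IH]; first by rewrite !big_geq// mul0r; case: ifP; rewrite addr0.
rewrite ![\sum_(0 <= j < J.+1 | D j) _]big_mkcond/= !big_nat_recr//= -!big_mkcond/=.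
case: ifPn IH => DJ IH; last first.
  rewrite (negbTE (contra (Ddown J) DJ)); move: IH; rewrite !addr0 => IH.
  exact: IH.
apply: (@le_trans _ _ (\sum_(0 <= j < J | D j) j.+1%:R * (f j.+1 - f j.+2) +
    J.+1%:R * (f J.+1 - f J.+2) + J.+1%:R * f J.+2)).
  by rewrite lerD2l; case: ifP => // _; rewrite mulr_ge0.
rewrite -[X in X <= _]addrA -mulrDr subrK -natr1 mulrDl mul1r addrA lerD2r.
exact: IH.
Qed.

End summation_by_parts.

Section occupancies.
Variables (R : realType) (m : nat).
Local Notation coord := (Defs.coord m).
Local Notation occ := (occ R m).
Implicit Types (p : coord) (q : occ) (a : 'I_m.+1 -> R).

Definition box (J : nat) : seq coord :=
  [seq (i, j) | i <- enum 'I_m.+1, j <- iota 1 J].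

Lemma mem_box J p : (p \in box J) = (1 <= p.2 <= J)%N.
Proof.
case: p => i j; apply/allpairsP/idP => /=.
  by move=> [[i' j'] /= [_ + [_ ->]]]; rewrite mem_iota add1n ltnS.
by move=> h; exists (i, j); rewrite mem_enum mem_iota add1n ltnS.
Qed.

Lemma box_uniq J : uniq (box J).
Proof.
apply: allpairs_uniq; rewrite ?enum_uniq ?iota_uniq//.
by move=> [i j] [i' j'] _ _ [-> ->].
Qed.

Lemma box_Iplus J p : p \in box J -> Iplus p.
Proof. by rewrite mem_box => /andP[]. Qed.

Lemma big_box J (P : pred coord) (F : coord -> R) :
  \sum_(p <- box J | P p) F p =
  \sum_(i < m.+1) \sum_(0 <= j < J | P (i, j.+1)) F (i, j.+1).
Proof.
rewrite /box big_mkcond big_allpairs /= big_enum /=; apply: eq_bigr => i _.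
rewrite [RHS]big_mkcond /= -[in iota 1 J](addn0 1%N) iotaDl big_map.
by rewrite /index_iota subn0.
Qed.

Lemma sum_seq_eq (s : seq coord) p : uniq s ->
  \sum_(p' <- s) (p' == p)%:R = (p \in s)%:R :> R.
Proof.
move=> us; have [ps|pns] := boolP (p \in s).
  rewrite (bigD1_seq p)//= eqxx big1 ?addr0// => p' /negbTE ->//.
rewrite big_seq big1// => p' p's; case: eqVneq => // e.
by rewrite -e p's in pns.
Qed.

(** The rates and token counts are sums over infinite sets of coordinates with finitely many nonzero
    terms; this rewrites them over an explicit duplicate-free list. *)
Lemma fsum_seq (A : set coord) (s : seq coord) (c : coord -> R) : uniq s ->
  (forall p, A p -> p \notin s -> c p = 0) ->
  \sum_(p \in A) c p = \sum_(p <- s) c p * `[< A p >]%:R.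
Proof.
move=> us c0; transitivity (\sum_(p \in [set` s] `&` A) c p).
  apply/esym/fsbig_widen; first by move=> p [].
  move=> p [Ap nsp] /=; apply: c0 => //; apply/negP => ps; exact: nsp.
rewrite fsbig_mkcondr -fsbig_seq//; apply: eq_bigr => p _.
rewrite /in_mem /=; rewrite -[X in if X then _ else _]/(p \in A).
have -> : (p \in A) = `[< A p >] by apply/idP/asboolP => [/set_mem|/mem_set].
by case: asboolP => _; rewrite ?mulr1 ?mulr0.
Qed.

Definition arrive n q p : occ := q + n%:R^-1 *: l1_unit R p.
Definition depart n q p : occ := q - n%:R^-1 *: l1_unit R p.

Lemma arriveE n q p p' : arrive n q p p' = q p' + n%:R^-1 * (p' == p)%:R.
Proof. by []. Qed.

Lemma departE n q p p' : depart n q p p' = q p' - n%:R^-1 * (p' == p)%:R.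
Proof. by []. Qed.

Lemma occ_ext q q' : (forall p, q p = q' p) -> q = q'.
Proof. by move=> h; apply/val_inj/funext. Qed.

(** Some level from which on [q] vanishes, not necessarily the least one; by [class_tasksE] the
    choice is immaterial. The existence behind [heightP] keeps states of [Qn] away from the
    default. *)
Definition height q : nat :=
  xget 0%N [set J | forall i j, (J <= j)%N -> q (i, j) = 0].

Definition tasks q : R := \sum_(p <- box (height q)) q p.

Definition class_tasks (C : pred 'I_m.+1) q : R :=
  \sum_(p <- box (height q) | C p.1) q p.

Section fixed_size.
Variables (n : nat) (a : 'I_m.+1 -> R).
Hypothesis n0 : (0 < n)%N.
Let nR : 0 < n%:R :> R. Proof. by rewrite ltr0n. Qed.
Let nRn0 : n%:R != 0 :> R. Proof. by rewrite gt_eqF. Qed.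
Variable q : occ.
Hypothesis Qq : Qn n a q.

Lemma Qn_nat p : exists k : nat, n%:R * q p = k%:R.
Proof. by case: Qq. Qed.

Lemma Qn_ge0 p : 0 <= q p.
Proof.
by have [k e] := Qn_nat p; rewrite -(pmulr_rge0 _ nR) e.
Qed.

Lemma Qn_0 i : q (i, 0%N) = a i.
Proof. by case: Qq => _ /(_ i)[]. Qed.

Lemma Qn_le_a p : q p <= a p.1.
Proof.
case: p => i [|j]; first by rewrite Qn_0.
by case: Qq => _ /(_ i)[e /(_ j)/andP[h1 h2]]; rewrite /= -e (le_trans h1).
Qed.

Lemma Qn_leS i j : q (i, j.+1) <= q (i, j).
Proof. by case: Qq => _ /(_ i)[_ /(_ j)/andP[]]. Qed.

Lemma Qn_le i j k : (j <= k)%N -> q (i, k) <= q (i, j).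
Proof.
elim: k => [|k IH]; first by rewrite leqn0 => /eqP ->.
rewrite leq_eqVlt => /predU1P[->//|/IH]; apply: le_trans; exact: Qn_leS.
Qed.

Lemma Qn_gap p p' : q p < q p' -> q p + n%:R^-1 <= q p'.
Proof.
have [k ek] := Qn_nat p; have [k' ek'] := Qn_nat p'.
rewrite -(ltr_pM2l nR) -(ler_pM2l nR) mulrDr divff// ek ek' ltr_nat.
by rewrite natr1 ler_nat.
Qed.

(** Nonzero coordinates are at least [1/n] and each class is nonincreasing in the level, so an
    occupied level [j] forces [j + 1] entries of at least [1/n]; summability bounds their number. *)
Lemma heightP i j : (height q <= j)%N -> q (i, j) = 0.
Proof.
suff [J HJ] : exists J, forall i j, (J <= j)%N -> q (i, j) = 0.
  by move: i j; rewrite -/([set J | forall i j, (J <= j)%N -> q (i, j) = 0] _);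
    apply: (xgetPex 0%N); exists J.
pose J := (Num.truncn (n%:R * l1_norm q)).+1; exists J => {}i {}j Jj.
apply/eqP; rewrite -[_ == _]negbK; apply/negP => qij.
have q1 : n%:R^-1 <= q (i, j).
  have [k e] := Qn_nat (i, j).
  rewrite -(ler_pM2l nR) e divff// ler1n lt0n; apply: contra qij => /eqP k0.
  by rewrite -(mulrI_eq0 _ (lregP nRn0)) e k0.
have : J%:R * n%:R^-1 <= l1_norm q.
  rewrite -lee_fin l1_norm_fin.
  have us : uniq [seq (i, k) | k <- iota 0 J].
    by rewrite map_inj_uniq ?iota_uniq// => x y [].
  apply: le_trans (esum_ge_seq _ us _); last by [].
  rewrite big_map sumEFin lee_fin.
  apply: (@le_trans _ _ (\sum_(k <- iota 0 J) n%:R^-1)).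
    by rewrite big_const_seq count_predT size_iota iter_addr_0 mulr_natl.
  rewrite big_seq [leRHS]big_seq; apply: ler_sum => k; rewrite mem_iota add0n /=.
  move=> kJ; rewrite ger0_norm ?Qn_ge0//; apply: (le_trans q1).
  by apply: Qn_le; apply: ltnW; exact: leq_trans Jj.
rewrite ler_pdivrMr// mulrC => h.
by have := truncnS_gt (n%:R * l1_norm q); rewrite ltNge -/J h.
Qed.

Lemma class_tasksE C J : (forall i j, (J <= j)%N -> q (i, j.+1) = 0) ->
  class_tasks C q = \sum_(p <- box J | C p.1) q p.
Proof.
move=> HJ; rewrite /class_tasks.
have sub K L : (K <= L)%N -> (forall i j, (K <= j)%N -> q (i, j.+1) = 0) ->
    \sum_(p <- box K | C p.1) q p = \sum_(p <- box L | C p.1) q p.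
  move=> KL H; rewrite !big_box; apply: eq_bigr => i _.
  rewrite [RHS](big_cat_nat _ (n := K))//= [X in _ + X]big_nat_cond.
  by rewrite [X in _ + X]big1 ?addr0// => j /andP[/andP[/H]].
have Hh i j : (height q <= j)%N -> q (i, j.+1) = 0.
  by move=> h; apply: heightP; exact: leqW.
by case: (leqP J (height q)) => h; [apply/esym|]; apply: sub => //; exact: ltnW.
Qed.

Lemma tasks_ge0 : 0 <= tasks q.
Proof. by apply: sumr_ge0 => p _; exact: Qn_ge0. Qed.

Lemma tasks_nat : (Num.truncn (n%:R * tasks q))%:R = n%:R * tasks q.
Proof.
apply: truncnK; rewrite /tasks mulr_sumr; apply: rpred_sum => p _.
by have [k ->] := Qn_nat p; exact: natr_nat.
Qed.

Lemma sum_le_tasks (s : seq coord) : uniq s -> (forall p, p \in s -> Iplus p) ->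
  \sum_(p <- s) q p <= tasks q.
Proof.
move=> us sI; pose J := maxn (height q) (\max_(p <- s) p.2).
rewrite -[leRHS]/(class_tasks predT q) (@class_tasksE predT J); last first.
  by move=> i j h; apply: heightP; apply: leqW; apply: leq_trans h; exact: leq_maxl.
apply: ler_sum_sub => //; last by move=> p; exact: Qn_ge0.
move=> p ps; rewrite mem_box; apply/andP; split; first exact: sI.
have := @leq_bigmax_seq _ s predT (fun p : coord => p.2) _ ps erefl.
by move=> /leq_trans; apply; exact: leq_maxr.
Qed.

Lemma Qn_arrive p : Iplus p -> q p < q (p.1, p.2.-1) -> Qn n a (arrive n q p).
Proof.
move=> Ip qp; split=> [p'|i].
  have [k ek] := Qn_nat p'; exists (k + (p' == p))%N.
  by rewrite arriveE mulrDr ek mulVKf// natrD; case: (p' == p).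
split=> [|j].
  rewrite arriveE Qn_0; case: eqP => [e|_]; last by rewrite mulr0 addr0.
  by move: Ip; rewrite -e.
rewrite !arriveE.
have [e0|_] := eqVneq (i, 0%N) p; first by move: Ip; rewrite -e0.
have [e|ne] := eqVneq (i, j) p.
  have -> : ((i, j.+1) == p) = false.
    by rewrite -e xpair_eqE eqxx/= -{2}[j]addn0 -addn1 eqn_add2l.
  rewrite mulr1 !mulr0 !addr0; apply/andP; split.
    by apply: (le_trans (Qn_leS i j)); rewrite lerDl invr_ge0 ltW.
  move: qp; rewrite -e => /Qn_gap h; apply: (le_trans h).
  exact: Qn_le.
rewrite !mulr0 !addr0 (Qn_le i (leq0n j)) andbT.
have [e|_] := eqVneq (i, j.+1) p; last by rewrite mulr0 addr0 Qn_leS.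
by rewrite mulr1; move: qp; rewrite -e => /Qn_gap.
Qed.

Lemma Qn_depart p : Iplus p -> q (p.1, p.2.+1) < q p -> Qn n a (depart n q p).
Proof.
move=> Ip qp; split=> [p'|i].
  have [k ek] := Qn_nat p'; exists (k - (p' == p))%N.
  rewrite departE mulrBr ek mulVKf//; have [e|_] := eqVneq p' p; last first.
    by rewrite subr0 subn0.
  have : (0 < k)%N.
    rewrite -(ltr_nat R) -ek pmulr_rgt0// e; apply: le_lt_trans qp.
    exact: Qn_ge0.
  by move=> k0; rewrite natrB.
split=> [|j].
  rewrite departE Qn_0; case: eqP => [e|_]; last by rewrite mulr0 subr0.
  by move: Ip; rewrite -e.
rewrite !departE.
have [e0|_] := eqVneq (i, 0%N) p; first by move: Ip; rewrite -e0.
have [e|ne] := eqVneq (i, j) p.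
  have -> : ((i, j.+1) == p) = false.
    by rewrite -e xpair_eqE eqxx/= -{2}[j]addn0 -addn1 eqn_add2l.
  rewrite mulr1 !mulr0 !subr0; apply/andP; split.
    by rewrite lerBrDr; move: qp; rewrite -e => /Qn_gap.
  rewrite lerBlDr; apply: (le_trans (Qn_le i (leq0n j))).
  by rewrite lerDl invr_ge0 ltW.
rewrite !mulr0 !subr0 (Qn_le i (leq0n j)) andbT.
have [e|_] := eqVneq (i, j.+1) p; last by rewrite mulr0 subr0 Qn_leS.
by rewrite mulr1 lerBlDr; apply: (le_trans (Qn_leS i j)); rewrite lerDl invr_ge0 ltW.
Qed.

End fixed_size.

Lemma sum_arrive n q p (s : seq coord) : uniq s ->
  \sum_(p' <- s) arrive n q p p' = \sum_(p' <- s) q p' + n%:R^-1 * (p \in s)%:R.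
Proof.
move=> us; under eq_bigr do rewrite arriveE.
by rewrite big_split/= -mulr_sumr sum_seq_eq.
Qed.

Lemma sum_depart n q p (s : seq coord) : uniq s ->
  \sum_(p' <- s) depart n q p p' = \sum_(p' <- s) q p' - n%:R^-1 * (p \in s)%:R.
Proof.
move=> us; under eq_bigr do rewrite departE.
by rewrite sumrB -mulr_sumr sum_seq_eq.
Qed.

Lemma class_tasks_arrive C n a q p : (0 < n)%N -> Qn n a q -> Iplus p ->
  Qn n a (arrive n q p) ->
  class_tasks C (arrive n q p) = class_tasks C q + n%:R^-1 * (C p.1)%:R.
Proof.
move=> n0 Qq Ip Qa; pose J := maxn (maxn (height q) (height (arrive n q p))) p.2.
rewrite (class_tasksE n0 Qa C (J := J)); last first.
  move=> i j h; apply: (heightP n0 Qa); apply: leqW; apply: leq_trans h.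
  by rewrite /J leq_max leq_maxr.
rewrite -big_filter sum_arrive ?filter_uniq ?box_uniq// mem_filter mem_box.
rewrite /J leq_maxr andbT (idP Ip : (1 <= p.2)%N) andbT; congr (_ + _).
rewrite big_filter; apply/esym/(class_tasksE n0 Qq) => i j h.
apply: (heightP n0 Qq); apply: leqW; apply: leq_trans h.
by rewrite !leq_max leqnn.
Qed.

Lemma class_tasks_depart C n a q p : (0 < n)%N -> Qn n a q -> Iplus p ->
  Qn n a (depart n q p) ->
  class_tasks C (depart n q p) = class_tasks C q - n%:R^-1 * (C p.1)%:R.
Proof.
move=> n0 Qq Ip Qa; pose J := maxn (maxn (height q) (height (depart n q p))) p.2.
rewrite (class_tasksE n0 Qa C (J := J)); last first.
  move=> i j h; apply: (heightP n0 Qa); apply: leqW; apply: leq_trans h.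
  by rewrite /J leq_max leq_maxr.
rewrite -big_filter sum_depart ?filter_uniq ?box_uniq// mem_filter mem_box.
rewrite /J leq_maxr andbT (idP Ip : (1 <= p.2)%N) andbT; congr (_ - _).
rewrite big_filter; apply/esym/(class_tasksE n0 Qq) => i j h.
apply: (heightP n0 Qq); apply: leqW; apply: leq_trans h.
by rewrite !leq_max leqnn.
Qed.

Lemma tasks_arrive n a q p : (0 < n)%N -> Qn n a q -> Iplus p ->
  Qn n a (arrive n q p) -> tasks (arrive n q p) = tasks q + n%:R^-1.
Proof.
by move=> n0 Qq Ip /(class_tasks_arrive predT n0 Qq Ip)/=; rewrite mulr1.
Qed.

Lemma tasks_depart n a q p : (0 < n)%N -> Qn n a q -> Iplus p ->
  Qn n a (depart n q p) -> tasks (depart n q p) = tasks q - n%:R^-1.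
Proof.
by move=> n0 Qq Ip /(class_tasks_depart predT n0 Qq Ip)/=; rewrite mulr1.
Qed.

Lemma class_tasks_ge n a q p : (0 < n)%N -> Qn n a q -> Iplus p ->
  q p <= class_tasks (pred1 p.1) q.
Proof.
move=> n0 Qq Ip; rewrite (class_tasksE n0 Qq _ (J := maxn (height q) p.2)).
  rewrite (big_rem p) /=; last by rewrite mem_box leq_maxr andbT; exact: Ip.
  by rewrite eqxx lerDl sumr_ge0// => p' _; exact: (Qn_ge0 n0 Qq).
move=> i j h; apply: (heightP n0 Qq); apply: leqW; apply: leq_trans h.
exact: leq_maxl.
Qed.

Lemma class_tasks_le n a q C : (0 < n)%N -> Qn n a q ->
  class_tasks C q <= tasks q.
Proof.
move=> n0 Qq; rewrite /class_tasks /tasks big_mkcond; apply: ler_sum => p _.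
by case: ifP => // _; exact: (Qn_ge0 n0 Qq).
Qed.

Section departures.
Variables (mu : R) (n : nat) (a : 'I_m.+1 -> R) (q : occ).
Hypotheses (mu0 : 0 <= mu) (n0 : (0 < n)%N) (Qq : Qn n a q).

Definition departs p : R := n%:R * mu * p.2%:R * (q p - q (p.1, p.2.+1)).

Lemma departs_ge0 p : 0 <= departs p.
Proof.
rewrite /departs !mulr_ge0// subr_ge0; case: p => i j; exact: (Qn_leS Qq).
Qed.

(** Each pool with exactly [j] tasks loses one at rate [j mu]; summation by parts turns these rates
    into at most [mu] per task held in a downward closed set of coordinates. *)
Lemma sum_departs_le (D : pred coord) J :
  (forall i j, D (i, j.+2) -> D (i, j.+1)) ->
  \sum_(p <- box J | D p) departs p <= n%:R * mu * \sum_(p <- box J | D p) q p.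
Proof.
move=> Ddown; rewrite !big_box mulr_sumr; apply: ler_sum => i _.
rewrite /departs; under eq_bigr do rewrite -mulrA.
rewrite -mulr_sumr ler_wpM2l ?mulr_ge0//.
apply: (@sum_parts_le _ (fun j => q (i, j)) (fun j => D (i, j.+1))) => j.
  exact: Ddown.
exact: (Qn_ge0 n0 Qq).
Qed.

Lemma sum_departs_class (C : pred 'I_m.+1) :
  \sum_(p <- box (height q) | C p.1) departs p =
  n%:R * mu * class_tasks C q.
Proof.
rewrite /class_tasks !big_box mulr_sumr; apply: eq_bigr => i _ /=.
case: (C i); last by rewrite !big_pred0_eq mulr0.
rewrite -(sum_parts (fun j => q (i, j))).
rewrite (heightP n0 Qq i (leqnSn _)) mulr0 addr0 mulr_sumr.
by apply: eq_bigr => j _; rewrite /departs /= mulrA.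
Qed.

Lemma sum_departs : \sum_(p <- box (height q)) departs p = n%:R * mu * tasks q.
Proof. exact: (sum_departs_class predT). Qed.

End departures.
End occupancies.

(** * Markov chains of occupancies *)

Section occupancy_chain.
Variables (R : realType) (m : nat) (lambda mu : R).
Hypotheses (lambda0 : 0 < lambda) (mu0 : 0 < mu).
Local Notation coord := (Defs.coord m).
Local Notation occ := (occ R m).
Variables (n : nat) (a : 'I_m.+1 -> R).
Variables (S : choiceType) (E : set S) (rate : S -> S -> R) (pr : S -> \bar R).
Variables (occ_of : S -> occ) (dep arr : S -> coord -> S) (asg : S -> coord -> R).

Let bx x := box m (height (occ_of x)).

(** The box of the current height suffices: above it the departure rates vanish and no pool can
    receive a task. *)
Definition jumps (x : S) : seq (R * S) :=
  [seq (departs mu n (occ_of x) p, dep x p) | p <- bx x] ++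
  [seq (n%:R * lambda * asg x p, arr x p) | p <- bx x].

(** Interface shared by the two policies: a state is an occupancy for JLMU and an occupancy with a
    rank for SLTA, and [asg] is the law of the coordinates that receive an arrival. *)
Record occ_chain : Prop := OccChain {
  oc_Qn : forall x, E x -> Qn n a (occ_of x);
  oc_gen : generates E rate jumps;
  oc_dep : forall x p, occ_of (dep x p) = depart n (occ_of x) p;
  oc_arr : forall x p, occ_of (arr x p) = arrive n (occ_of x) p;
  oc_asg0 : forall x p, E x -> 0 <= asg x p;
  oc_asg1 : forall x, E x -> \sum_(p <- bx x) asg x p = 1;
  oc_valid : forall x p, E x -> 0 < asg x p ->
    Iplus p /\ occ_of x p < occ_of x (p.1, p.2.-1) }.

Hypothesis oc : occ_chain.
Hypothesis n0 : (0 < n)%N.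
Let nR : 0 < n%:R :> R. Proof. by rewrite ltr0n. Qed.
Let nRn0 : n%:R != 0 :> R. Proof. by rewrite gt_eqF. Qed.

Lemma drift_jumps f x : drift jumps f x =
  \sum_(p <- bx x) departs mu n (occ_of x) p * (f (dep x p) - f x) +
  n%:R * lambda * \sum_(p <- bx x) asg x p * (f (arr x p) - f x).
Proof.
rewrite /drift /jumps big_cat !big_map /= mulr_sumr; congr (_ + _).
by apply: eq_bigr => p _; rewrite mulrA.
Qed.

Lemma departs_gt0 x p : 0 < departs mu n (occ_of x) p ->
  Iplus p /\ occ_of x (p.1, p.2.+1) < occ_of x p.
Proof.
rewrite /departs; case: p => i [|j] /=; first by rewrite mulr0 mul0r ltxx.
by rewrite pmulr_rgt0 ?subr_gt0// !mulr_gt0.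
Qed.

Lemma Qn_dep x p : E x -> 0 < departs mu n (occ_of x) p -> Qn n a (occ_of (dep x p)).
Proof.
move=> Ex /departs_gt0[Ip h]; rewrite (oc_dep oc).
exact: (Qn_depart n0 (oc_Qn oc Ex)).
Qed.

Lemma Qn_arr x p : E x -> 0 < asg x p -> Qn n a (occ_of (arr x p)).
Proof.
move=> Ex h; have [Ip qp] := oc_valid oc Ex h; rewrite (oc_arr oc).
exact: (Qn_arrive n0 (oc_Qn oc Ex)).
Qed.

Lemma dep_drift_le (f : S -> R) (dl : S -> coord -> R) x : E x ->
  (forall p, 0 < departs mu n (occ_of x) p -> f (dep x p) - f x <= dl x p) ->
  \sum_(p <- bx x) departs mu n (occ_of x) p * (f (dep x p) - f x) <=
  \sum_(p <- bx x) departs mu n (occ_of x) p * dl x p.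
Proof.
move=> Ex H; apply: ler_sum => p _.
have := departs_ge0 (ltW mu0) (oc_Qn oc Ex) p.
rewrite le_eqVlt => /predU1P[<-|h]; first by rewrite !mul0r.
by rewrite ler_pM2l// H.
Qed.

Lemma arr_drift_le (f : S -> R) c x : E x ->
  (forall p, 0 < asg x p -> f (arr x p) - f x <= c) ->
  n%:R * lambda * \sum_(p <- bx x) asg x p * (f (arr x p) - f x) <=
  n%:R * lambda * c.
Proof.
move=> Ex H; rewrite ler_wpM2l ?mulr_ge0 ?(ltW lambda0)//.
rewrite -[leRHS]mul1r -(oc_asg1 oc Ex) mulr_suml; apply: ler_sum => p _.
have := oc_asg0 oc p Ex.
rewrite le_eqVlt => /predU1P[<-|h]; first by rewrite !mul0r.
by rewrite ler_pM2l// H.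
Qed.

Lemma sum_departs_seq_le (s : seq coord) x : E x -> uniq s ->
  (forall i j, (i, j.+2) \in s -> (i, j.+1) \in s) ->
  \sum_(p <- bx x) departs mu n (occ_of x) p * (p \in s)%:R <=
  n%:R * mu * \sum_(p <- s) occ_of x p.
Proof.
move=> Ex us sdown; have Qx := oc_Qn oc Ex.
rewrite (eq_bigr (fun p => if p \in s then departs mu n (occ_of x) p else 0));
  last by move=> p _; case: ifP; rewrite ?mulr1 ?mulr0.
rewrite -big_mkcond/=.
apply: le_trans (sum_departs_le (ltW mu0) n0 Qx (D := mem s) _ sdown) _.
rewrite ler_wpM2l ?mulr_ge0 ?(ltW mu0)// -[leLHS]big_filter.
apply: ler_sum_sub; first by rewrite filter_uniq// box_uniq.
- by move=> p; rewrite mem_filter => /andP[].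
- by move=> p; exact: (Qn_ge0 n0 Qx).
Qed.

(** Template for most drift estimates: a departure changes [f] by at most [C] on [s], minus [c0]
    everywhere, an arrival by at most [c]. As [s] is downward closed, its departure rate is at most
    [n mu] times its occupancy, while the total departure rate is exactly [n mu] times the tasks. *)
Lemma drift_le (f : S -> R) (s : seq coord) C c0 c x : E x -> uniq s ->
  (forall i j, (i, j.+2) \in s -> (i, j.+1) \in s) -> 0 <= C ->
  (forall p, 0 < departs mu n (occ_of x) p ->
     f (dep x p) - f x <= C * (p \in s)%:R - c0) ->
  (forall p, 0 < asg x p -> f (arr x p) - f x <= c) ->
  drift jumps f x <= C * (n%:R * mu * \sum_(p <- s) occ_of x p)
    - c0 * (n%:R * mu * tasks (occ_of x)) + n%:R * lambda * c.
Proof.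
move=> Ex us sdown C0 Hd Ha; rewrite drift_jumps lerD ?arr_drift_le//.
apply: (le_trans (@dep_drift_le f (fun x p => C * (p \in s)%:R - c0) x Ex Hd)).
under eq_bigr do rewrite mulrBr.
rewrite sumrB lerB//.
  under eq_bigr do rewrite mulrCA.
  by rewrite -mulr_sumr ler_wpM2l// sum_departs_seq_le.
by rewrite -mulr_suml (sum_departs mu n0 (oc_Qn oc Ex)) mulrC.
Qed.

Definition task_count x : nat := Num.truncn (n%:R * tasks (occ_of x)).

Lemma task_countE x : E x -> (task_count x)%:R = n%:R * tasks (occ_of x).
Proof. by move=> Ex; rewrite /task_count (tasks_nat (oc_Qn oc Ex)). Qed.

Lemma task_count_dep x p : E x -> 0 < departs mu n (occ_of x) p ->
  task_count (dep x p) = (task_count x).-1.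
Proof.
move=> Ex h; have [Ip qp] := departs_gt0 h.
have Qx := oc_Qn oc Ex; have Qd := Qn_dep Ex h.
have e : n%:R * tasks (occ_of (dep x p)) = (task_count x)%:R - 1.
  rewrite task_countE//; move: Qd; rewrite (oc_dep oc) => Qd.
  by rewrite (tasks_depart n0 Qx Ip Qd) mulrBr divff.
have t1 : (0 < task_count x)%N.
  have := tasks_ge0 n0 Qd; rewrite -(pmulr_rge0 _ nR) e subr_ge0.
  by rewrite ler1n.
by rewrite /task_count e -{1}(prednK t1) -natr1 addrK natrK.
Qed.

Lemma task_count_arr x p : E x -> 0 < asg x p ->
  task_count (arr x p) = (task_count x).+1.
Proof.
move=> Ex h; have [Ip qp] := oc_valid oc Ex h.
have Qx := oc_Qn oc Ex; have := Qn_arr Ex h; rewrite (oc_arr oc) => Qd.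
have e : n%:R * tasks (occ_of (arr x p)) = (task_count x).+1%:R.
  by rewrite (oc_arr oc) (tasks_arrive n0 Qx Ip Qd) mulrDr divff// -natr1 task_countE.
by rewrite [LHS]/task_count e natrK.
Qed.

Lemma occ_infinite_server :
  infinite_server E jumps (n%:R * lambda) mu task_count.
Proof.
split=> [x phi Ex|x Ex].
  rewrite drift_jumps; rewrite addrC; congr (_ + _).
    rewrite -[in RHS](mul1r (phi _ - _)) -(oc_asg1 oc Ex) mulr_suml.
    congr (_ * _); apply: eq_bigr => p _; have := oc_asg0 oc p Ex.
    rewrite le_eqVlt => /predU1P[<-|h]; first by rewrite !mul0r.
    by rewrite task_count_arr.
  rewrite task_countE// mulrCA mulrA -(sum_departs mu n0 (oc_Qn oc Ex)) mulr_suml.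
  apply: eq_bigr => p _.
  have := departs_ge0 (ltW mu0) (oc_Qn oc Ex) p.
  rewrite le_eqVlt => /predU1P[<-|h]; first by rewrite !mul0r.
  by rewrite task_count_dep.
rewrite /out_rate /jumps big_cat !big_map /= -mulr_sumr (oc_asg1 oc Ex) mulr1 addrC.
by rewrite (sum_departs mu n0 (oc_Qn oc Ex)) task_countE// mulrCA mulrA.
Qed.

End occupancy_chain.

(** * JLMU and SLTA as chains of occupancies *)

Section chain_instances.
Variables (R : realType) (m : nat) (u : 'I_m.+1 -> R -> R) (lambda mu : R).
Hypothesis u_concave : concave_utilities u.
Hypotheses (lambda0 : 0 < lambda) (mu0 : 0 < mu).
Local Notation coord := (Defs.coord m).
Local Notation occ := (occ R m).
Variables (n : nat) (a : 'I_m.+1 -> R).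
Hypotheses (n0 : (0 < n)%N) (a0 : forall i, 0 < a i).
Let nR : 0 < n%:R :> R. Proof. by rewrite ltr0n. Qed.

Lemma generates_jumps (S : choiceType) (E : set S) (rate : S -> S -> R)
    (occ_of : S -> occ) (dep arr : S -> coord -> S) (asg : S -> coord -> R) :
  (forall x, E x -> Qn n a (occ_of x)) ->
  (forall x y, E x -> rate x y =
    \sum_(p <- box m (height (occ_of x)))
      departs mu n (occ_of x) p * (y == dep x p)%:R +
    \sum_(p <- box m (height (occ_of x)))
      n%:R * lambda * asg x p * (y == arr x p)%:R) ->
  (forall x p, occ_of (dep x p) = depart n (occ_of x) p) ->
  (forall x p, occ_of (arr x p) = arrive n (occ_of x) p) ->
  (forall x p, E x -> 0 <= asg x p) ->
  (forall x p, E x -> 0 < asg x p ->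
    Iplus p /\ occ_of x p < occ_of x (p.1, p.2.-1)) ->
  (forall x p, E x -> 0 < rate x (dep x p) -> Qn n a (occ_of (dep x p)) ->
     E (dep x p)) ->
  (forall x p, E x -> 0 < rate x (arr x p) -> Qn n a (occ_of (arr x p)) ->
     E (arr x p)) ->
  generates E rate (jumps lambda mu n occ_of dep arr asg).
Proof.
move=> EQ rateE depE arrE asg0 asgV Edep Earr.
have jge0 x k : E x -> k \in jumps lambda mu n occ_of dep arr asg x -> 0 <= k.1.
  move=> Ex; rewrite /jumps mem_cat => /orP[] /mapP[p _ ->] /=.
    exact: departs_ge0 (ltW mu0) (EQ _ Ex) p.
  by rewrite !mulr_ge0 ?asg0 ?(ltW lambda0).
have rateJ x y : E x -> rate x y =
    \sum_(k <- jumps lambda mu n occ_of dep arr asg x) k.1 * (y == k.2)%:R.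
  by move=> Ex; rewrite rateE// /jumps big_cat !big_map.
have rate0 x k : E x -> k \in jumps lambda mu n occ_of dep arr asg x ->
    0 < k.1 -> 0 < rate x k.2.
  move=> Ex kx k0; rewrite rateJ// (big_rem k)//= eqxx mulr1.
  rewrite (lt_le_trans k0)// lerDl big_seq sumr_ge0// => l /mem_rem lx.
  by rewrite mulr_ge0// (jge0 _ _ Ex lx).
split=> // x k Ex kx k0; have r0 := rate0 _ _ Ex kx k0.
move: kx r0 k0; rewrite /jumps mem_cat => /orP[] /mapP[p _ ->] /= r0 k0.
  have [Ip qp] := departs_gt0 mu0 n0 k0; split.
    by apply: Edep => //; rewrite depE; exact: (Qn_depart n0 (EQ _ Ex)).
  apply/eqP => e; have := depE x p; rewrite e => /(congr1 (fun q : occ => q p)).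
  rewrite departE eqxx mulr1 => /eqP; rewrite eq_sym -subr_eq0 addrAC subrr add0r.
  by rewrite oppr_eq0 invr_eq0 gt_eqF.
have h : 0 < asg x p by rewrite pmulr_rgt0// mulr_gt0// in k0.
have [Ip qp] := asgV _ _ Ex h; split.
  by apply: Earr => //; rewrite arrE; exact: (Qn_arrive n0 (EQ _ Ex)).
apply/eqP => e; have := arrE x p; rewrite e => /(congr1 (fun q : occ => q p)).
rewrite arriveE eqxx mulr1 => /eqP; rewrite eq_sym -subr_eq0 addrAC subrr add0r.
by rewrite invr_eq0 gt_eqF.
Qed.

Lemma departure_rateE q q' : Qn n a q -> departure_rate mu n q q' =
  \sum_(p <- box m (height q)) departs mu n q p * (q' == depart n q p)%:R.
Proof.
move=> Qq; rewrite /departure_rate (@fsum_seq R m _ (box m (height q))); last 2 first.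
- exact: box_uniq.
- move=> [i j] [/= Ip _]; rewrite mem_box /= negb_and.
  move=> /orP[/negP[]//|]; rewrite -ltnNge => hj.
  rewrite (heightP n0 Qq i (ltnW hj)) (heightP n0 Qq i (leqW (ltnW hj))).
  by rewrite subrr mulr0.
apply: eq_big_seq => p /box_Iplus Ip; congr (_ * (nat_of_bool _)%:R).
by apply/idP/idP => [/asboolP[_ ->]|/eqP ->]; [exact: eqxx | apply/asboolP].
Qed.

Lemma arrival_rateE q q' (f : coord -> R) : Qn n a q ->
  (forall p, Iplus p -> p \notin box m (height q) -> f p = 0) ->
  arrival_rate lambda n f q q' =
  \sum_(p <- box m (height q)) n%:R * lambda * f p * (q' == arrive n q p)%:R.
Proof.
move=> Qq f0; rewrite /arrival_rate (@fsum_seq R m _ (box m (height q))); last 2 first.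
- exact: box_uniq.
- by move=> p [Ip _] /(f0 _ Ip) ->; rewrite mulr0.
apply: eq_big_seq => p /box_Iplus Ip; congr (_ * (nat_of_bool _)%:R).
by apply/idP/idP => [/asboolP[_ ->]|/eqP ->]; [exact: eqxx | apply/asboolP].
Qed.

Lemma room_in_box q p : Qn n a q -> Iplus p -> q p < q (p.1, p.2.-1) ->
  p \in box m (height q).
Proof.
move=> Qq; case: p => i [//|j] _ /= h; rewrite mem_box /= ltnNge.
apply/negP => hj; move: h; rewrite (heightP n0 Qq i hj).
by rewrite ltNge (Qn_ge0 n0 Qq).
Qed.

(** Otherwise class [ord0] would be full at every level, against the finite height. *)
Lemma exists_room q : Qn n a q -> exists2 p, Iplus p & q p < q (p.1, p.2.-1).
Proof.
move=> Qq; have [//|none] := pselect (exists2 p, Iplus p & q p < q (p.1, p.2.-1)).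
have full j : a ord0 <= q (ord0, j).
  elim: j => [|j IH]; first by rewrite (Qn_0 Qq).
  apply: (le_trans IH); rewrite leNgt; apply/negP => h; apply: none.
  by exists (ord0, j.+1).
by have := full (height q); rewrite (heightP n0 Qq)// leNgt a0.
Qed.

Lemma jlmu_targetP q : Qn n a q ->
  [/\ Iplus (jlmu_target u q),
      q (jlmu_target u q) < q ((jlmu_target u q).1, (jlmu_target u q).2.-1) &
      forall p, Iplus p -> q p < q (p.1, p.2.-1) -> preceq u p (jlmu_target u q)].
Proof.
move=> Qq; pose A := [set p : coord | Iplus p /\ q p < q (p.1, p.2.-1)].
have [||p [Ip qp] pmax] := @exists_max_prec R m u u_concave A.
- by move=> p [].
- by have [p Ip qp] := exists_room Qq; exists p.
pose B := [set p | [/\ Iplus p, q p < q (p.1, p.2.-1) &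
  forall p', Iplus p' -> q p' < q (p'.1, p'.2.-1) -> preceq u p' p]].
have /(xgetPex (ord0, 1%N)) : exists p, B p; last by [].
by exists p; split=> // p' Ip' qp'; apply: pmax.
Qed.

Definition jlmu_assign (q : occ) p : R := (p == jlmu_target u q)%:R.

Lemma jlmu_chain : occ_chain lambda mu n a (jlmu_states u lambda mu n a)
  (jlmu_rate u lambda mu n) id (depart n) (arrive n) jlmu_assign.
Proof.
have V x p : jlmu_states u lambda mu n a x -> 0 < jlmu_assign x p ->
    Iplus p /\ x p < x (p.1, p.2.-1).
  move=> [Qx _]; rewrite /jlmu_assign; case: eqP => [->|]; last by rewrite ltxx.
  by have [] := jlmu_targetP Qx.
split=> //.
- by move=> x [].
- apply: generates_jumps => //.
  + by move=> x [].
  + move=> x y [Qx _]; rewrite /jlmu_rate departure_rateE// arrival_rateE// => p Ip.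
    rewrite /jlmu_assign; case: eqP => // -> /negP[].
    by have [It qt _] := jlmu_targetP Qx; exact: room_in_box.
  + by move=> x p [_ xr] r0 Q; split=> //; exact: reachable_jump xr r0.
  + by move=> x p [_ xr] r0 Q; split=> //; exact: reachable_jump xr r0.
- move=> x [Qx _]; have [It qt _] := jlmu_targetP Qx.
  rewrite /jlmu_assign sum_seq_eq ?box_uniq//.
  by rewrite (room_in_box Qx It qt).
Qed.

Lemma pools_ge0 q p : Qn n a q -> 0 <= pools n q p.
Proof.
move=> Qq; rewrite /pools mulr_ge0// subr_ge0; case: p => i [|j]//=.
exact: (Qn_leS Qq).
Qed.

Lemma pool_countE q (C : set coord) : Qn n a q -> C `<=` @Iplus m ->
  pool_count n q C = \sum_(p <- box m (height q)) pools n q p * (p \in C)%:R.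
Proof.
move=> Qq CI; rewrite /pool_count (@fsum_seq R m _ (box m (height q))); last 2 first.
- exact: box_uniq.
- move=> p Cp np; apply/eqP; rewrite eq_le pools_ge0// andbT leNgt.
  apply: contra np; rewrite /pools pmulr_rgt0// subr_gt0 => h.
  by apply: room_in_box => //; exact: CI.
by apply: eq_bigr => p _; congr (_ * (nat_of_bool _)%:R).
Qed.

Lemma pool_count_ge q (C : set coord) p : Qn n a q -> C `<=` @Iplus m -> C p ->
  pools n q p <= pool_count n q C.
Proof.
move=> Qq CI Cp; rewrite pool_countE//.
have [pb|np] := boolP (p \in box m (height q)).
  rewrite (big_rem p)//= mem_set// mulr1 lerDl sumr_ge0// => p' _.
  by rewrite mulr_ge0 ?pools_ge0.
apply: (@le_trans _ _ 0); last first.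
  by apply: sumr_ge0 => p' _; rewrite mulr_ge0 ?pools_ge0.
rewrite leNgt; apply: contra np; rewrite /pools pmulr_rgt0// subr_gt0 => h.
by apply: room_in_box => //; exact: CI.
Qed.

Lemma pool_count_ge0 q (C : set coord) : Qn n a q -> C `<=` @Iplus m ->
  0 <= pool_count n q C.
Proof.
move=> Qq CI; rewrite pool_countE//; apply: sumr_ge0 => p _.
by rewrite mulr_ge0 ?pools_ge0.
Qed.

(** SLTA always picks uniformly within one set of coordinates; naming that set treats the four cases
    of the dispatching rule at once. *)
Definition slta_set (q : occ) (r : nat) : set coord :=
  if 0 < pool_count n q (green_other u r) then green_other u r
  else if 0 < pool_count n q (green u r) then green u r
  else if 0 < pool_count n q (yellow u r) then yellow u r
  else @Iplus m.

Lemma slta_assignE q r : slta_assign u n q r = uniform_in n q (slta_set q r).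
Proof.
by apply/funext => p; rewrite /slta_assign /slta_set; do 3 case: ifP => //.
Qed.

Lemma slta_set_Iplus q r : slta_set q r `<=` @Iplus m.
Proof.
rewrite /slta_set; case: ifP => _; first by move=> p [[]].
by case: ifP => _; [move=> p []|case: ifP => _ p // []].
Qed.

Lemma slta_set_gt0 q r : Qn n a q -> 0 < pool_count n q (slta_set q r).
Proof.
move=> Qq; rewrite /slta_set; do 3 case: ifP => //.
move=> _ _ _; have [p Ip qp] := exists_room Qq.
apply: lt_le_trans (pool_count_ge Qq _ Ip) => //.
by rewrite /pools pmulr_rgt0// subr_gt0.
Qed.

Lemma slta_assign_gt0 q r p : Qn n a q -> 0 < slta_assign u n q r p ->
  [/\ Iplus p, slta_set q r p & q p < q (p.1, p.2.-1)].
Proof.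
move=> Qq; rewrite slta_assignE /uniform_in; case: ifP; last by rewrite ltxx.
move=> /set_mem pC; have c0 := slta_set_gt0 r Qq.
rewrite pmulr_lgt0 ?invr_gt0// /pools pmulr_rgt0// subr_gt0 => h.
by split=> //; exact: slta_set_Iplus pC.
Qed.

Lemma slta_assign_ge0 q r p : Qn n a q -> 0 <= slta_assign u n q r p.
Proof.
move=> Qq; rewrite slta_assignE /uniform_in; case: ifP => // _.
by rewrite divr_ge0 ?pools_ge0// ltW// slta_set_gt0.
Qed.

Lemma slta_assign_sum q r : Qn n a q ->
  \sum_(p <- box m (height q)) slta_assign u n q r p = 1.
Proof.
move=> Qq; have c0 := slta_set_gt0 r Qq.
rewrite slta_assignE; rewrite -(divff (lt0r_neq0 c0)) {1}pool_countE//; last first.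
  exact: slta_set_Iplus.
rewrite mulr_suml; apply: eq_bigr => p _; rewrite /uniform_in.
by case: ifP; rewrite ?mulr1// mulr0 mul0r.
Qed.

Definition slta_depart (x : occ * nat) p : occ * nat := (depart n x.1 p, x.2).
Definition slta_arrive beta (x : occ * nat) p : occ * nat :=
  (arrive n x.1 p, slta_next u n beta x.1 x.2).

Lemma slta_next_ge1 beta q r : (0 < r)%N -> (0 < slta_next u n beta q r)%N.
Proof.
move=> r0; rewrite /slta_next; case: ifP => [/and3P[r1 _ _]|_]; last by case: ifP.
by case: r r1 {r0} => // -[].
Qed.

Lemma slta_chain beta : occ_chain lambda mu n a (slta_states u lambda mu n beta a)
  (slta_rate u lambda mu n beta) fst slta_depart (slta_arrive beta)
  (fun x => slta_assign u n x.1 x.2).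
Proof.
have V (x : occ * nat) p : slta_states u lambda mu n beta a x ->
    0 < slta_assign u n x.1 x.2 p -> Iplus p /\ x.1 p < x.1 (p.1, p.2.-1).
  by move=> [Qx _ _] /(slta_assign_gt0 Qx)[].
split=> //.
- by move=> x [].
- apply: generates_jumps => //.
  + by move=> x [].
  + move=> x y [Qx _ _]; rewrite /slta_rate departure_rateE// arrival_rateE//; last first.
      move=> p Ip np; apply/eqP; rewrite eq_le slta_assign_ge0// andbT leNgt.
      by apply: contra np => /(slta_assign_gt0 Qx)[_ _]; exact: room_in_box.
    congr (_ + _).
      case: eqP => [e|ne].
        apply: eq_bigr => p _; congr (_ * (nat_of_bool _)%:R).
        by rewrite /slta_depart -pair_eqE /= /pair_eq /= e eqxx andbT.
      rewrite big1// => p _; rewrite (_ : _ == _ = false) ?mulr0//.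
      by apply/eqP => e; apply: ne; rewrite e.
    case: eqP => [e|ne].
      apply: eq_bigr => p _; congr (_ * (nat_of_bool _)%:R).
      by rewrite /slta_arrive -pair_eqE /= /pair_eq /= e eqxx andbT.
    rewrite big1// => p _; rewrite (_ : _ == _ = false) ?mulr0//.
    by apply/eqP => e; apply: ne; rewrite e.
  + by move=> x p [Qx _ _]; exact: slta_assign_ge0.
  + move=> x p [_ r0 xr] rt Q; split=> //; exact: reachable_jump xr rt.
  + move=> x p [_ r0 xr] rt Q; split=> //; first exact: slta_next_ge1.
    exact: reachable_jump xr rt.
- by move=> x p [Qx _ _]; exact: slta_assign_ge0.
- by move=> x [Qx _ _]; exact: slta_assign_sum.
Qed.

End chain_instances.

(** * Deficits *)

Section deficits.
Variables (R : realType) (m n : nat) (a : 'I_m.+1 -> R).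
Local Notation coord := (Defs.coord m).
Hypothesis n0 : (0 < n)%N.
Implicit Types (s : seq coord) (q : occ R m).

Definition capacity s : R := \sum_(p <- s) a p.1.

(** The number of vacancies in [s], in pools rather than as a fraction, so that each jump of the
    chain changes it by at most one. *)
Definition deficit s q : R := n%:R * (capacity s - \sum_(p <- s) q p).

Let nR : 0 < n%:R :> R. Proof. by rewrite ltr0n. Qed.
Let nRn0 : n%:R != 0 :> R. Proof. by rewrite gt_eqF. Qed.

Lemma deficit_arrive s q p : uniq s ->
  deficit s (arrive n q p) = deficit s q - (p \in s)%:R.
Proof. by move=> us; rewrite /deficit sum_arrive//; field. Qed.

Lemma deficit_depart s q p : uniq s ->
  deficit s (depart n q p) = deficit s q + (p \in s)%:R.
Proof. by move=> us; rewrite /deficit sum_depart//; field. Qed.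

Lemma deficitE s q : deficit s q = \sum_(p <- s) n%:R * (a p.1 - q p).
Proof. by rewrite /deficit /capacity -sumrB mulr_sumr. Qed.

Variable q : occ R m.
Hypothesis Qq : Qn n a q.

Lemma deficit1_ge0 p : 0 <= n%:R * (a p.1 - q p).
Proof. by rewrite mulr_ge0// subr_ge0 (Qn_le_a Qq). Qed.

Lemma deficit_ge0 s : 0 <= deficit s q.
Proof. by rewrite deficitE sumr_ge0// => p _; exact: deficit1_ge0. Qed.

Lemma deficit1_le s p : p \in s -> n%:R * (a p.1 - q p) <= deficit s q.
Proof.
move=> ps; rewrite deficitE (big_rem p)//= lerDl sumr_ge0// => p' _.
exact: deficit1_ge0.
Qed.

Lemma deficit_eq0 s p : deficit s q = 0 -> p \in s -> q p = a p.1.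
Proof.
move=> d0 ps; have := deficit1_le ps; rewrite d0 pmulr_rle0// subr_le0 => h.
by apply/eqP; rewrite eq_le h (Qn_le_a Qq).
Qed.

Lemma deficit_le s : deficit s q <= n%:R * capacity s.
Proof.
rewrite /deficit ler_wpM2l// lerBlDr lerDl sumr_ge0// => p _.
exact: (Qn_ge0 n0 Qq).
Qed.

Lemma deficit_sub s s' : uniq s -> {subset s <= s'} ->
  deficit s q <= deficit s' q.
Proof.
move=> us ss'; rewrite !deficitE; apply: ler_sum_sub => // p.
exact: deficit1_ge0.
Qed.

Lemma full_tasks s : uniq s -> (forall p, p \in s -> Iplus p) ->
  capacity s - n%:R^-1 * deficit s q <= tasks q.
Proof.
move=> us sI; rewrite /deficit mulKf// opprB addrCA subrr addr0.
exact: (sum_le_tasks n0 Qq).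
Qed.

End deficits.

(** * Stationary bounds common to both policies *)

Section stationary_bounds.
Variables (R : realType) (m : nat) (lambda mu : R).
Hypotheses (lambda0 : 0 < lambda) (mu0 : 0 < mu).
Local Notation coord := (Defs.coord m).
Local Notation occ := (occ R m).
Variables (n : nat) (a : 'I_m.+1 -> R).
Variables (S : choiceType) (E : set S) (rate : S -> S -> R) (pr : S -> \bar R).
Variables (occ_of : S -> occ) (dep arr : S -> coord -> S) (asg : S -> coord -> R).
Hypothesis oc : occ_chain lambda mu n a E rate occ_of dep arr asg.
Hypothesis st : stationary_distribution E rate pr.
Hypothesis n0 : (0 < n)%N.

Local Notation rho := (lambda / mu).
Local Notation gen := (jumps lambda mu n occ_of dep arr asg).

Let nR : 0 < n%:R :> R. Proof. by rewrite ltr0n. Qed.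
Let nRn0 : n%:R != 0 :> R. Proof. by rewrite gt_eqF. Qed.
Let nl0 : 0 < n%:R * lambda. Proof. exact: mulr_gt0. Qed.
Let rho0 : 0 < rho. Proof. exact: divr_gt0. Qed.
Let is_server := occ_infinite_server mu0 oc n0.
Let nlmu : n%:R * lambda / mu = n%:R * rho. Proof. by rewrite mulrA. Qed.

Lemma chain_lyapunov f g h b C : (forall x, E x -> 0 <= f x) ->
  (forall x, E x -> f x <= C * (1 + n%:R * tasks (occ_of x)) ^+ 2) ->
  (forall x, E x -> 0 <= g x <= h x - drift gen f x) ->
  mean_le E pr h b -> mean_le E pr g b.
Proof.
move=> f0 fC; apply: (tame_lyapunov (oc_gen oc) st nl0 mu0 is_server f0).
apply: (tame_quadratic (C := C)) => x Ex; rewrite -natr1 (task_countE oc Ex).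
by rewrite [_ + 1]addrC; exact: fC.
Qed.

Lemma mean_tasks_var :
  mean_le E pr (fun x => (tasks (occ_of x) - rho) ^+ 2) (rho / n%:R).
Proof.
have := mean_count_var (oc_gen oc) st nl0 mu0 is_server.
have ni : 0 <= (n%:R^-1) ^+ 2 :> R by rewrite exprn_ge0// invr_ge0 ltW.
move=> /(mean_leZ st ni); apply: (mean_le_mono st).
  move=> x Ex; rewrite (task_countE oc Ex) nlmu sqr_ge0/=.
  by rewrite -exprMn -mulrBr mulKf.
rewrite (_ : n%:R^-1 ^+ 2 * _ = rho / n%:R)//; field.
by rewrite !gt_eqF.
Qed.

(** With [s = eps / (4 rho)], the geometric decay starts at about [(1 + s) n rho] tasks and runs
    through [k], about [n eps / 8], blocks of four. Then [1 + s k >= min(1, s) (k + 1) >= min(1, s)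
    n eps / 8], the minimum absorbing the rounding of [k]. *)
Definition tail_const (eps : R) : R :=
  ((Num.min 1 (eps / (4 * rho))%R * (eps / 8)) ^+ 4)^-1.

Lemma mean_tasks_tail eps : 0 < eps ->
  mean_le E pr (fun x => (rho + eps <= tasks (occ_of x))%R%:R)
    (tail_const eps / n%:R ^+ 4).
Proof.
move=> e0; pose s := eps / (4 * rho).
have s0 : 0 < s by rewrite divr_gt0// mulr_gt0.
pose j := Num.truncn ((1 + s) * (n%:R * rho)).
pose k := Num.truncn (n%:R * eps / 8).
have hj : (1 + s) * (n%:R * lambda) <= mu * j.+1%:R.
  have h : mu * ((1 + s) * (n%:R * rho)) <= mu * j.+1%:R.
    by rewrite ler_pM2l//; exact/ltW/truncnS_gt.
  apply: le_trans h; rewrite [leRHS](_ : _ = (1 + s) * (n%:R * lambda) * (mu / mu)); last by ring.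
  by rewrite divff ?mulr1// gt_eqF.
have := mean_tail (oc_gen oc) st nl0 mu0 is_server k s0 hj.
have s1 : 0 < 1 + s by rewrite addr_gt0.
have hn : 0 <= (1 + s) * (n%:R * rho).
  by apply: mulr_ge0; [exact: ltW | apply: mulr_ge0 => //; exact: ltW].
have hk0 : 0 <= n%:R * eps / 8 by rewrite !mulr_ge0 ?invr_ge0// ltW.
apply: (mean_le_mono st).
  move=> x Ex; rewrite ler0n ler_nat /=.
  case: (leP (rho + eps) (tasks (occ_of x))) => // h.
  rewrite (_ : (j + 4 * k <= _)%N)// -(ler_nat R) (task_countE oc Ex).
  have h1 : j%:R <= (1 + s) * (n%:R * rho) by rewrite truncn_le.
  have h2 : k%:R <= n%:R * eps / 8 by rewrite truncn_le.
  have h3 : n%:R * (rho + eps) <= n%:R * tasks (occ_of x) by rewrite ler_pM2l.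
  have h4 : (1 + s) * (n%:R * rho) = n%:R * rho + n%:R * eps / 4.
    by rewrite /s; field; rewrite !gt_eqF.
  rewrite natrD natrM; have : 0 <= n%:R * eps by rewrite mulr_ge0// ltW.
  by move: h1 h2 h3; rewrite h4; lra.
have m0 : 0 < Num.min 1 s by rewrite lt_min ltr01.
set c := Num.min 1 s * (eps / 8).
have c0 : 0 < c by rewrite mulr_gt0// divr_gt0.
rewrite /tail_const -/s -/c -invfM -exprMn lef_pV2 ?posrE ?exprn_gt0//; last 2 first.
- by rewrite ltr_pwDl// mulr_ge0// ltW.
- by rewrite mulr_gt0.
rewrite ler_pXn2r ?nnegrE//; last 2 first.
- by rewrite ltW// mulr_gt0.
- by rewrite addr_ge0// mulr_ge0// ltW.
have hk : n%:R * eps / 8 <= k%:R + 1.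
  by rewrite natr1; exact/ltW/truncnS_gt.
apply: (@le_trans _ _ (Num.min 1 s * (k%:R + 1))).
  by rewrite /c -mulrA ler_pM2l// (le_trans _ hk)// [leLHS]mulrC mulrA.
have : Num.min 1 s <= 1 by rewrite ge_min lexx.
have : Num.min 1 s <= s by rewrite ge_min lexx orbT.
have : (0 : R) <= k%:R by [].
set M := Num.min 1 s; nra.
Qed.

(* Drift of the number of tasks plus the number of vacancies in [s]: outside [B]
   an arrival fills a vacancy, so the two changes cancel. *)
Lemma mean_tasks_outside (s : seq coord) (B : S -> bool) b : uniq s ->
  (forall p, p \in s -> Iplus p) ->
  (forall i j, (i, j.+2) \in s -> (i, j.+1) \in s) ->
  (forall x p, E x -> ~~ B x -> 0 < asg x p -> p \in s) ->
  mean_le E pr (fun x => (B x)%:R) b ->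
  mean_le E pr (fun x => tasks (occ_of x) - \sum_(p <- s) occ_of x p) (rho * b).
Proof.
move=> us sI sdown HB hb.
pose f x := n%:R * tasks (occ_of x) + deficit n a s (occ_of x).
have W0 x : E x -> 0 <= tasks (occ_of x) - \sum_(p <- s) occ_of x p.
  by move=> Ex; rewrite subr_ge0; exact: (sum_le_tasks n0 (oc_Qn oc Ex)).
have nl : 0 <= n%:R * lambda by exact: ltW.
have f0 x : E x -> 0 <= f x.
  move=> Ex; have Qx := oc_Qn oc Ex.
  by rewrite addr_ge0 ?(deficit_ge0 Qx)// mulr_ge0// (tasks_ge0 n0 Qx).
have fC x : E x -> f x <= (1 + `|n%:R * capacity a s|) * (1 + n%:R * tasks (occ_of x)) ^+ 2.
  move=> Ex; have Qx := oc_Qn oc Ex.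
  have := deficit_le n0 Qx s; have := ler_norm (n%:R * capacity a s).
  have : 0 <= n%:R * tasks (occ_of x) by rewrite mulr_ge0// (tasks_ge0 n0 Qx).
  have := normr_ge0 (n%:R * capacity a s).
  by rewrite /f; set c := `|_|; set t := _ * tasks _; nra.
have Hd x : E x -> 0 <= n%:R * mu * (tasks (occ_of x) - \sum_(p <- s) occ_of x p)
    <= n%:R * lambda * (B x)%:R - drift gen f x.
  move=> Ex; have Qx := oc_Qn oc Ex.
  rewrite mulr_ge0 ?W0 ?mulr_ge0 ?(ltW mu0)//= lerBrDr -lerBrDl.
  rewrite [leRHS](_ : _ = 1 * (n%:R * mu * \sum_(p <- s) occ_of x p)
    - 1 * (n%:R * mu * tasks (occ_of x)) + n%:R * lambda * (B x)%:R); last by ring.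
  apply: (drift_le lambda0 mu0 oc n0 Ex us sdown) => // p.
    move=> h; have [Ip qp] := departs_gt0 mu0 n0 h.
    rewrite /f (oc_dep oc) deficit_depart//.
    rewrite (tasks_depart n0 Qx Ip (Qn_depart n0 Qx Ip qp)) mulrBr divff//; lra.
  move=> h; have [Ip qp] := oc_valid oc Ex h.
  rewrite /f (oc_arr oc) deficit_arrive//.
  rewrite (tasks_arrive n0 Qx Ip (Qn_arrive n0 Qx Ip qp)) mulrDr divff//.
  case: (boolP (B x)) => [_|nB]; last by rewrite (HB _ _ Ex nB h) /=; lra.
  have ps0 : (0 : R) <= (p \in s)%:R by [].
  by rewrite /=; move: ps0; lra.
have := chain_lyapunov f0 fC Hd (mean_leZ st nl hb).
have nmi : 0 <= (n%:R * mu)^-1 by rewrite invr_ge0 mulr_ge0// ltW.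
move=> /(mean_leZ st nmi); apply: (mean_le_mono st).
  by move=> x Ex; rewrite W0//= mulKf// gt_eqF// mulr_gt0.
rewrite (_ : (n%:R * mu)^-1 * _ = rho * b)//; field; by rewrite !gt_eqF.
Qed.

End stationary_bounds.

(** * Vacancies above a given rank, and the estimates for JLMU *)

Section top_coords_occupancy.
Variables (R : realType) (m : nat) (u : 'I_m.+1 -> R -> R).
Hypothesis u_concave : concave_utilities u.
Local Notation coord := (Defs.coord m).
Local Notation occ := (occ R m).
Local Notation top := (top_coords u).
Local Notation kth := (kth u).

Lemma top_coords_downS r i j : (i, j.+2) \in top r -> (i, j.+1) \in top r.
Proof. by apply: top_coords_down => //=. Qed.

Variables (n : nat) (a : 'I_m.+1 -> R).
Hypotheses (n0 : (0 < n)%N) (a0 : forall i, 0 < a i).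
Let nR : 0 < n%:R :> R. Proof. by rewrite ltr0n. Qed.

(** The levels of a class in [top r] form an initial segment and level 0 is full; without room,
    fullness propagates upwards. *)
Lemma room_in_top r (q : occ) : Qn n a q -> 0 < deficit n a (top r) q ->
  exists2 p, p \in top r & q p < q (p.1, p.2.-1).
Proof.
move=> Qq d0; have [//|none] := pselect (exists2 p, p \in top r & q p < q (p.1, p.2.-1)).
have full i j : (i, j.+1) \in top r -> a i <= q (i, j.+1).
  elim: j => [|j IH] ij.
    rewrite -(Qn_0 Qq) leNgt; apply/negP => h; apply: none.
    by exists (i, 1%N).
  apply: (le_trans (IH (top_coords_downS ij))); rewrite leNgt; apply/negP => h.
  by apply: none; exists (i, j.+2).
move: d0; rewrite deficitE big_seq big1 ?ltxx// => -[i [|j]] ij.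
  by have := top_coords_Iplus u_concave ij.
apply/eqP; rewrite mulf_eq0 gt_eqF//= subr_eq0 eq_le full//=.
exact: (Qn_le_a Qq).
Qed.

Lemma capacityS r : (0 < r)%N ->
  capacity a (top r.+1) = capacity a (top r) + a (kth r).1.
Proof.
by move=> r0; rewrite /capacity top_coordsS// -cats1 big_cat big_seq1.
Qed.

Lemma capacity_le r r' : (r <= r')%N -> capacity a (top r) <= capacity a (top r').
Proof.
move=> rr'; apply: ler_sum_sub; first exact: top_coords_uniq.
  exact: top_coords_sub.
by move=> p; exact: ltW.
Qed.

Lemma capacity_ge0 r : 0 <= capacity a (top r).
Proof. by apply: sumr_ge0 => p _; exact: ltW. Qed.

Section jlmu.
Variables (lambda mu : R) (pr : occ -> \bar R).
Hypotheses (lambda0 : 0 < lambda) (mu0 : 0 < mu).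
Hypothesis st : stationary_distribution (jlmu_states u lambda mu n a)
  (jlmu_rate u lambda mu n) pr.
Local Notation E := (jlmu_states u lambda mu n a).
Local Notation rho := (lambda / mu).
Let oc := jlmu_chain u_concave lambda0 mu0 n0 a0.

Lemma jlmu_assign_top r (q : occ) p : (0 < r)%N -> Qn n a q ->
  0 < deficit n a (top r) q -> 0 < jlmu_assign u q p -> p \in top r.
Proof.
move=> r0 Qq d0; rewrite /jlmu_assign; case: eqP => [->|]; last by rewrite ltxx.
have [It qt tmax] := jlmu_targetP u_concave n0 a0 Qq.
have [p' p't room] := room_in_top Qq d0.
have Ip' := top_coords_Iplus u_concave p't.
rewrite mem_top_coords// in p't; rewrite mem_top_coords// => _.
by have := tmax _ Ip' room; rewrite /preceq => /predU1P[<-//|]; exact: prec_trans.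
Qed.

(** With capacity [A] and deficit [X], the drift of [X^2] is at most [mu ((2 X + 1) (n A - X) + n
    rho (1 - 2 X))]. The positive part [M] appears because at the threshold rank [A] may exceed
    [rho] for finite [n], by an amount that vanishes in the limit. *)
Lemma jlmu_deficit_sq r : (0 < r)%N ->
  mean_le E pr (fun q => (deficit n a (top r) q) ^+ 2)
    (n%:R ^+ 2 * (Num.max 0 (capacity a (top r) - rho)) ^+ 2 +
     n%:R * (capacity a (top r) + rho)).
Proof.
move=> r0; set A := capacity _ _; set M := Num.max _ _.
pose X (q : occ) := deficit n a (top r) q.
have M0 : 0 <= M by rewrite /M le_max lexx.
have MA : A - rho <= M by rewrite /M le_max lexx orbT.
have A0 : 0 <= A by exact: capacity_ge0.
have rho0 : 0 < rho by exact: divr_gt0.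
have lamE : lambda = mu * rho by rewrite mulrCA divff ?mulr1 // gt_eqF.
set b := _ + _; have b0 : 0 <= b.
  by rewrite addr_ge0 ?mulr_ge0 ?exprn_ge0 ?addr_ge0 ?(ltW rho0).
have X0 q : E q -> 0 <= X q by move=> [Qq _]; exact: (deficit_ge0 Qq).
have XA q : E q -> X q <= n%:R * A by move=> [Qq _]; exact: (deficit_le n0 Qq).
have key : mean_le E pr (fun q => mu * X q ^+ 2) (mu * b).
  apply: (@chain_lyapunov _ _ _ _ lambda0 mu0 _ _ _ _ _ _ _ _ _ _ oc st n0
    (fun q => X q ^+ 2) _ (fun=> mu * b) _ ((n%:R * A) ^+ 2)).
  - by move=> q _; exact: sqr_ge0.
  - move=> q Eq; have [Qq _] := Eq; rewrite -[leLHS]mulr1; apply: ler_pM => //.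
    + exact: sqr_ge0.
    + by rewrite ler_pXn2r ?nnegrE ?X0 ?XA// mulr_ge0.
    + have := tasks_ge0 n0 Qq; have := nR; nra.
  - move=> q Eq; have [Qq _] := Eq; rewrite mulr_ge0 ?sqr_ge0 ?(ltW mu0)//=.
    have nF : n%:R * mu * \sum_(p <- top r) q p = mu * (n%:R * A - X q).
      by rewrite /X /deficit -/A; ring.
    have dl : drift (jumps lambda mu n id (depart n) (arrive n) (jlmu_assign u))
        (fun q => X q ^+ 2) q <= (2 * X q + 1) * (n%:R * mu * \sum_(p <- top r) q p)
        - 0 * (n%:R * mu * tasks q) + n%:R * lambda * (1 - 2 * X q).
      apply: (drift_le lambda0 mu0 oc n0 Eq (top_coords_uniq u_concave r)
        (@top_coords_downS r)).
      + by have := X0 q Eq; lra.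
      + move=> p _; rewrite /X (deficit_depart _ n0) ?top_coords_uniq//.
        by case: (p \in top r) => /=; rewrite ?addr0; lra.
      + move=> p hp; rewrite /X (deficit_arrive _ n0) ?top_coords_uniq//.
        have := X0 q Eq; rewrite le_eqVlt => /predU1P[e|d0]; last first.
          by rewrite (jlmu_assign_top r0 Qq d0 hp) /=; lra.
        by rewrite -/(X q) -e; case: (p \in top r) => /=; lra.
    rewrite nF mul0r subr0 in dl.
    have nl : n%:R * lambda = mu * (n%:R * rho) by rewrite {1}lamE; ring.
    rewrite nl in dl; rewrite lerBrDr -lerBrDl; apply: (le_trans dl).
    rewrite [leLHS](_ : _ = mu * ((2 * X q + 1) * (n%:R * A - X q) +
      n%:R * rho * (1 - 2 * X q))); last by ring.
    rewrite -(mulrBr mu) ler_pM2l// /b.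
    (* [2 X n M <= X^2 + n^2 M^2] absorbs half of the quadratic term of the drift. *)
    have h1 : 0 <= (n%:R * M - X q) ^+ 2 by exact: sqr_ge0.
    have h2 := X0 q Eq; have h3 : X q * (n%:R * (A - rho)) <= X q * (n%:R * M).
      by rewrite ler_wpM2l// ler_pM2l.
    by rewrite sqrrB in h1; rewrite exprMn in h1; lra.
  - by apply: (mean_le_cst st); rewrite mulr_ge0// ltW.
have mi : 0 <= mu^-1 by rewrite invr_ge0 ltW.
have := mean_leZ st mi key; apply: (mean_le_mono st).
  by move=> q Eq; rewrite sqr_ge0 mulKf ?gt_eqF//= lexx.
by rewrite mulKf// gt_eqF.
Qed.

(** Arrivals go outside [top r] only when it is full, and then there are at least [rho + eps]
    tasks. *)
Lemma jlmu_outside r eps : (0 < r)%N -> 0 < eps ->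
  rho + eps <= capacity a (top r) ->
  mean_le E pr (fun q => tasks q - \sum_(p <- top r) q p)
    (rho * (tail_const lambda mu eps / n%:R ^+ 4)).
Proof.
move=> r0 e0 hcap; have ut := top_coords_uniq u_concave r.
have tI := @top_coords_Iplus _ _ _ u_concave r.
apply: (mean_tasks_outside lambda0 mu0 oc st n0 ut tI (@top_coords_downS r)
  (B := fun q => deficit n a (top r) q == 0)).
  move=> q p Eq; have [Qq _] := Eq => nB; apply: jlmu_assign_top => //.
  by rewrite lt_neqAle eq_sym nB (deficit_ge0 Qq).
apply: (mean_le_mono st) (mean_tasks_tail lambda0 mu0 oc st n0 e0) => // q Eq.
have [Qq _] := Eq; rewrite ler0n ler_nat /=; case: eqP => // d0.
rewrite (_ : (_ <= _)%R = true)//; apply: (le_trans hcap).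
by have := full_tasks n0 Qq ut tI; rewrite d0 mulr0 subr0.
Qed.

End jlmu.
End top_coords_occupancy.

(** * Tokens *)

Section tokens.
Variables (R : realType) (m : nat) (u : 'I_m.+1 -> R -> R).
Hypothesis u_concave : concave_utilities u.
Local Notation coord := (Defs.coord m).
Local Notation occ := (occ R m).
Local Notation top := (top_coords u).
Local Notation kth := (kth u).
Local Notation ell := (ell u).
Implicit Types (p : coord) (q : occ) (r : nat).

(** The levels of class [i] above [kth r] form an initial segment, bounded because [top r] is
    finite; its maximum decides membership. *)
Lemma ellP r i j : (0 < r)%N -> (0 < j)%N -> (j <= ell r i)%N = ((i, j) \in top r).
Proof.
move=> r0 j0; pose P j := (j == 0%N) || prec u (kth r) (i, j).
have PE k : (0 < k)%N -> P k = ((i, k) \in top r).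
  by case: k => // k _; rewrite /P /= mem_top_coords.
have Pmax k : P k -> (k <= \max_(p <- top r) p.2)%N.
  case: k => // k; rewrite PE// => h.
  exact: (@leq_bigmax_seq _ (top r) predT (fun p : coord => p.2) _ h erefl).
have P0 : exists k, P k by exists 0%N.
have -> : ell r i = ex_maxn P0 Pmax.
  apply: xget_unique => [|k [Pk kmax]]; case: ex_maxnP => M PM Mmax.
    split; first by case/orP: PM => [/eqP|]; [left | right].
    by move=> k [->|h]//; apply: Mmax; rewrite /P h orbT.
  apply/eqP; rewrite eqn_leq Mmax ?kmax//.
    by case/orP: PM => [/eqP|]; [left | right].
  by case: Pk => [->|h]; rewrite /P ?eqxx// h orbT.
case: ex_maxnP => M PM Mmax; apply/idP/idP => [jM|]; last by rewrite -PE//; exact: Mmax.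
have M0 : (0 < M)%N by exact: leq_trans jM.
rewrite PE// in PM; apply: (top_coords_down u_concave _ PM).
by rewrite j0.
Qed.

Lemma greenP r p : (0 < r)%N -> Iplus p -> green u r p <-> p \in top r.
Proof.
move=> r0 Ip; case: p Ip => i [//|j] Ip; rewrite -ellP//.
by split=> [[_]|] //= h; split.
Qed.

Lemma green_Iplus r : green u r `<=` @Iplus m. Proof. by move=> p []. Qed.
Lemma yellow_Iplus r : yellow u r `<=` @Iplus m. Proof. by move=> p []. Qed.
Lemma green_other_Iplus r : green_other u r `<=` @Iplus m.
Proof. by move=> p [[]]. Qed.
Lemma green_last_Iplus r : green_last u r `<=` @Iplus m.
Proof. by move=> p [[]]. Qed.

Lemma kth_pair r : kth r = ((kth r).1, (kth r).2). Proof. by case: (kth r). Qed.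

(** [kth r] is the first level of its class that is not above [kth r]. This off-by-one is why yellow
    tokens, but not green ones, cover [kth r]. *)
Lemma ell_kth r : (0 < r)%N -> (ell r (kth r).1).+1 = (kth r).2.
Proof.
move=> r0; have Ik := kth_Iplus u_concave r0.
have nk := kth_notin u_concave r0.
apply/eqP; rewrite eqn_leq; apply/andP; split.
  by rewrite ltnNge ellP// -kth_pair.
rewrite leqNgt; apply/negP => h.
have := @ellP r (kth r).1 (ell r (kth r).1).+1 r0 isT.
rewrite ltnn mem_top_coords//; rewrite [X in prec u X _]kth_pair.
by rewrite (prec_level u_concave).
Qed.

Lemma yellowP r p : (0 < r)%N -> yellow u r p -> p \in top r \/ p = kth r.
Proof.
move=> r0; case: p => i [[]//|j] [_ /= ie].
rewrite leq_eqVlt => /predU1P[e|h]; last by left; rewrite -ellP.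
right; rewrite kth_pair -ell_kth//; move: e; rewrite ie => <-.
by rewrite -ie.
Qed.

Lemma yellow_kth r j : (0 < r)%N -> (0 < j <= (kth r).2)%N ->
  yellow u r ((kth r).1, j).
Proof.
move=> r0 /andP[j0 jk]; split=> //=.
by rewrite -ell_kth// in jk; case: j j0 jk.
Qed.

Lemma green_last_kth r j : (1 < r)%N -> (0 < j <= (kth r.-1).2)%N ->
  green_last u r ((kth r.-1).1, j).
Proof.
case: r => [//|r] r0 /andP[j0 jk]; split=> //.
apply/greenP => //; apply: (top_coords_down u_concave (j := (kth r).2)).
  by rewrite j0.
by rewrite -kth_pair top_coordsS// mem_rcons inE eqxx.
Qed.

Variables (n : nat) (a : 'I_m.+1 -> R).
Hypotheses (n0 : (0 < n)%N) (a0 : forall i, 0 < a i).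
Let nR : 0 < n%:R :> R. Proof. by rewrite ltr0n. Qed.
Variable q : occ.
Hypothesis Qq : Qn n a q.
Local Notation X r := (deficit n a (top r) q).

(* The pools of class i with fewer than j tasks are counted by telescoping. *)
Lemma vacancies_le_count (C : set coord) i j : C `<=` @Iplus m ->
  (forall k, (0 < k <= j)%N -> C (i, k)) ->
  n%:R * (a i - q (i, j)) <= pool_count n q C.
Proof.
move=> CI HC; pose t : seq coord := [seq (i, k.+1) | k <- iota 0 j].
have ut : uniq t by rewrite map_inj_uniq ?iota_uniq// => x y [].
have tC p : p \in t -> C p.
  by move=> /mapP[k]; rewrite mem_iota add0n /= => kj ->; exact: HC.
have -> : n%:R * (a i - q (i, j)) = \sum_(p <- t) pools n q p.
  rewrite /t big_map -(Qn_0 Qq i); elim: (j) => [|k IH].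
    by rewrite big_nil subrr mulr0.
  by rewrite -[in iota _ _]addn1 iotaD big_cat big_seq1 /= -IH /pools add0n /=; ring.
rewrite /pool_count (@fsum_seq R m C (undup (t ++ box m (height q)))); last 2 first.
- exact: undup_uniq.
- move=> p Cp; rewrite mem_undup mem_cat negb_or => /andP[_ np].
  apply/eqP; rewrite eq_le (pools_ge0 _ Qq) andbT leNgt.
  apply: contra np; rewrite /pools pmulr_rgt0// subr_gt0 => h.
  by apply: (room_in_box n0 Qq) => //; exact: CI.
rewrite [leLHS](_ : _ = \sum_(p <- t) pools n q p * `[< C p >]%:R); last first.
  by apply: eq_big_seq => p pt; rewrite asboolT ?mulr1//; exact: tC.
apply: ler_sum_sub => //.
  by move=> p pt; rewrite mem_undup mem_cat pt.
by move=> p; rewrite mulr_ge0// (pools_ge0 _ Qq).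
Qed.

Lemma vacancy_le_green r p : (0 < r)%N -> p \in top r ->
  n%:R * (a p.1 - q p) <= pool_count n q (green u r).
Proof.
move=> r0 pt; case: p pt => i j pt; apply: vacancies_le_count.
  exact: green_Iplus.
move=> k /andP[k0 kj]; apply/greenP => //.
by apply: (top_coords_down u_concave _ pt); rewrite k0.
Qed.

Lemma pools_full p : Iplus p -> q p = a p.1 -> pools n q p = 0.
Proof.
move=> Ip e; apply/eqP; rewrite eq_le (pools_ge0 _ Qq) andbT /pools pmulr_rle0//.
by rewrite subr_le0 e (Qn_le_a Qq (p.1, _)).
Qed.

Lemma green_count_le r : (0 < r)%N -> pool_count n q (green u r) <= X r.
Proof.
move=> r0; rewrite /pool_count (@fsum_seq R m _ (top r)); last 2 first.
- exact: top_coords_uniq.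
- by move=> p gp np; have Ip := green_Iplus gp; move/greenP : gp np => ->.
rewrite deficitE big_seq [leRHS]big_seq; apply: ler_sum => p pt.
have Ip := top_coords_Iplus u_concave pt.
rewrite asboolT ?mulr1; last by apply/greenP.
by rewrite /pools ler_pM2l// lerD2r (Qn_le_a Qq (p.1, _)).
Qed.

(** A vacancy at level [j] is a pool with fewer than [j] tasks, hence one with a green token. The
    same pool may be counted once for each coordinate of [s], whence the factor [size s]. *)
Lemma deficit_le_green r s : (0 < r)%N -> {subset s <= top r} ->
  deficit n a s q <= (size s)%:R * pool_count n q (green u r).
Proof.
move=> r0 st; rewrite deficitE; elim: s st => [|p s IH] st.
  by rewrite big_nil mul0r.
rewrite big_cons /= -natr1 mulrDl mul1r addrC lerD//.
  by apply: IH => p' ps; apply: st; rewrite inE ps orbT.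
by apply: vacancy_le_green => //; apply: st; rewrite mem_head.
Qed.

Lemma green_count_gt0 r : (0 < r)%N -> (0 < pool_count n q (green u r)) = (0 < X r).
Proof.
move=> r0; apply/idP/idP => [h|d0]; first exact: lt_le_trans (green_count_le r0).
have [p pt room] := room_in_top u_concave n0 Qq d0.
have Ip := top_coords_Iplus u_concave pt.
apply: lt_le_trans (pool_count_ge n0 Qq (@green_Iplus r) (p := p) _).
  by rewrite /pools pmulr_rgt0// subr_gt0.
by apply/greenP.
Qed.

Lemma deficit_topS r : (0 < r)%N ->
  X r.+1 = X r + n%:R * (a (kth r).1 - q (kth r)).
Proof.
by move=> r0; rewrite !deficitE top_coordsS// -cats1 big_cat big_seq1.
Qed.

Lemma vacancy_le_yellow r : (0 < r)%N ->
  n%:R * (a (kth r).1 - q (kth r)) <= pool_count n q (yellow u r).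
Proof.
move=> r0; rewrite [in q _]kth_pair; apply: vacancies_le_count.
  exact: yellow_Iplus.
by move=> k kj; exact: yellow_kth.
Qed.

Lemma yellow_count_full r : (0 < r)%N -> X r.+1 = 0 ->
  pool_count n q (yellow u r) = 0.
Proof.
move=> r0 X0; rewrite /pool_count fsbig1// => p yp.
have Ip := yellow_Iplus yp; apply: pools_full => //.
apply: (deficit_eq0 n0 Qq X0); rewrite top_coordsS// mem_rcons inE.
by case: (yellowP r0 yp) => [->|->]; rewrite ?orbT ?eqxx.
Qed.

Lemma green_last_full r : (1 < r)%N -> pool_count n q (green_last u r) <= 0 ->
  q (kth r.-1) = a (kth r.-1).1.
Proof.
move=> r1 h; have := @vacancies_le_count (green_last u r) (kth r.-1).1 (kth r.-1).2
  (@green_last_Iplus r).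
move=> /(_ _)/le_trans -/(_ _ _ h); rewrite -kth_pair pmulr_rle0// subr_le0.
move=> /(_ (fun k => @green_last_kth r k r1)) h'.
by apply/eqP; rewrite eq_le h' (Qn_le_a Qq).
Qed.

Lemma pool_count_gt0P (C : set coord) : C `<=` @Iplus m ->
  0 < pool_count n q C -> exists2 p, C p & 0 < pools n q p.
Proof.
move=> CI h; have [//|none] := pselect (exists2 p, C p & 0 < pools n q p).
move: h; rewrite /pool_count fsbig1 ?ltxx// => p Cp.
apply/eqP; rewrite eq_le (pools_ge0 _ Qq) andbT leNgt; apply/negP => h.
by apply: none; exists p.
Qed.

Lemma green_other_gt0 r : pool_count n q (green_last u r) <= 0 ->
  0 < pool_count n q (green u r) -> 0 < pool_count n q (green_other u r).
Proof.
move=> last0 /(pool_count_gt0P (@green_Iplus r))[p gp pp].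
have [e|ne] := pselect (p.1 = (kth r.-1).1).
  have : pools n q p <= 0.
    apply: le_trans last0; apply: (pool_count_ge n0 Qq) => //.
    exact: green_last_Iplus.
  by rewrite leNgt pp.
apply: (lt_le_trans pp); apply: (pool_count_ge n0 Qq) => //.
exact: green_other_Iplus.
Qed.

Lemma slta_assign_top r p : (0 < r)%N -> 0 < X r ->
  0 < slta_assign u n q r p -> p \in top r.
Proof.
move=> r0 X0 /(slta_assign_gt0 n0 a0 Qq)[Ip Cp _]; move: Cp.
rewrite /slta_set green_count_gt0// X0; case: ifP => _; last by move/greenP; exact.
by move=> [/greenP h _]; exact: h.
Qed.

Lemma slta_assign_other r p : 0 < pool_count n q (green_other u r) ->
  0 < slta_assign u n q r p -> p.1 <> (kth r.-1).1.
Proof.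
by move=> h /(slta_assign_gt0 n0 a0 Qq)[Ip + _]; rewrite /slta_set h => -[].
Qed.

(** Green tokens lead into [top r]. Without them [top r] is full, so a vacancy in [top r.+1] is at
    [kth r] and carries a yellow token; yellow tokens lead into [top r] or to [kth r]. *)
Lemma slta_assign_topS r p : (0 < r)%N -> 0 < X r.+1 ->
  0 < slta_assign u n q r p -> p \in top r.+1.
Proof.
move=> r0 XS ap; rewrite top_coordsS// mem_rcons inE.
have := deficit_ge0 Qq (top r); rewrite le_eqVlt => /predU1P[X0|X0]; last first.
  by rewrite (slta_assign_top r0 X0 ap) orbT.
have [Ip Cp room] := slta_assign_gt0 n0 a0 Qq ap; move: Cp.
have g0 : pool_count n q (green u r) = 0.
  apply/eqP; rewrite eq_le (pool_count_ge0 n0 Qq (@green_Iplus r)) andbT.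
  by rewrite leNgt green_count_gt0// -X0 ltxx.
have go0 : pool_count n q (green_other u r) <= 0.
  rewrite leNgt; apply/negP => /(pool_count_gt0P (@green_other_Iplus r))[p' [gp _]].
  move=> pp; have := pool_count_ge n0 Qq (@green_Iplus r) gp.
  by rewrite g0 leNgt pp.
rewrite /slta_set ltNge go0 /= g0 ltxx.
have -> : 0 < pool_count n q (yellow u r).
  apply: lt_le_trans (vacancy_le_yellow r0).
  by move: XS; rewrite deficit_topS// -X0 add0r.
move=> yp; have [pt|->] := yellowP r0 yp; last by rewrite eqxx.
by rewrite pt orbT.
Qed.

Definition slta_down (beta : R) q r : bool :=
  [&& (1 < r)%N, n%:R * beta <= pool_count n q (green u r)
    & 0 < pool_count n q (green_last u r)].

Definition slta_up (beta : R) q r : bool :=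
  ~~ slta_down beta q r &&
  ((pool_count n q (green u r) == 0) && (pool_count n q (yellow u r) <= 1)).

Lemma slta_nextE beta r : slta_next u n beta q r =
  if slta_down beta q r then r.-1 else if slta_up beta q r then r.+1 else r.
Proof. by rewrite /slta_next /slta_up -/(slta_down beta q r); case: ifP. Qed.

(** An up step tolerates one yellow token, hence the bound 1 instead of 0 one rank higher. *)
Lemma slta_up_full beta r : (0 < r)%N -> slta_up beta q r -> X r = 0 /\ X r.+1 <= 1.
Proof.
move=> r0 /andP[_ /andP[/eqP g0 y1]].
have X0 : X r = 0.
  apply/eqP; rewrite eq_le (deficit_ge0 Qq) andbT leNgt -green_count_gt0//.
  by rewrite g0 ltxx.
by split=> //; rewrite deficit_topS// X0 add0r; exact: le_trans (vacancy_le_yellow r0) y1.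
Qed.

Lemma slta_down_vacant beta r : (0 < r)%N -> slta_down beta q r ->
  (1 < r)%N /\ n%:R * beta <= X r.
Proof.
move=> r0 /and3P[r1 h _]; split=> //; exact: le_trans h (green_count_le r0).
Qed.

(** If even [kth r] is full there are neither green nor yellow tokens; a down step is excluded
    because its threshold [n beta] is positive. *)
Lemma slta_full_up beta r : 0 < beta -> (0 < r)%N -> X r.+1 = 0 -> slta_up beta q r.
Proof.
move=> b0 r0 XS; have X0 : X r = 0.
  apply/eqP; rewrite eq_le (deficit_ge0 Qq) andbT -XS.
  by apply: deficit_sub => //; [exact: top_coords_uniq | exact: top_coords_sub].
have g0 : pool_count n q (green u r) = 0.
  apply/eqP; rewrite eq_le (pool_count_ge0 n0 Qq (@green_Iplus r)) andbT.
  by rewrite leNgt green_count_gt0// X0 ltxx.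
rewrite /slta_up g0 eqxx yellow_count_full// ler01 !andbT.
by apply/negP => /(slta_down_vacant r0)[_]; rewrite X0 leNgt mulr_gt0.
Qed.

End tokens.

(** Increment, at a down step, of the excess of [k] over [r] cut at level [K], that is
    [min(k, max(K, r)) - min(k, r)], written additively to stay in [nat]. The next lemma is its
    counterpart for up steps. *)
Lemma minn_pred_diff K r k : (0 < k)%N ->
  ((r < k) * (k <= K) + minn k.-1 (maxn K r) + minn k r =
   minn k (maxn K r) + minn k.-1 r)%N.
Proof. case: (ltnP r k); case: (leqP k K) => /=; lia. Qed.

Lemma minn_succ_diff K r k : (minn k.+1 (maxn K r) + minn k r <=
  minn k (maxn K r) + minn k.+1 r + (r <= k))%N.
Proof. case: (leqP r k) => /=; lia. Qed.

(** * Stationary estimates for SLTA at fixed [n] *)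

Section slta_bounds.
Variables (R : realType) (m : nat) (u : 'I_m.+1 -> R -> R) (lambda mu : R).
Hypothesis u_concave : concave_utilities u.
Hypotheses (lambda0 : 0 < lambda) (mu0 : 0 < mu).
Local Notation coord := (Defs.coord m).
Local Notation occ := (occ R m).
Local Notation top := (top_coords u).
Local Notation kth := (kth u).
Local Notation rho := (lambda / mu).
Variables (n : nat) (a : 'I_m.+1 -> R) (beta : R).
Hypotheses (n0 : (0 < n)%N) (a0 : forall i, 0 < a i) (beta0 : 0 < beta).
Local Notation E := (slta_states u lambda mu n beta a).
Variable pr : (occ * nat)%type -> \bar R.
Hypothesis st : stationary_distribution E (slta_rate u lambda mu n beta) pr.
Variables (rs : nat) (eps delta amin : R).
Hypotheses (rs0 : (0 < rs)%N) (eps0 : 0 < eps) (delta0 : 0 < delta).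
Hypotheses (amin0 : 0 < amin) (amin_le : forall i, amin <= a i).
(** Fewer than [n beta] green tokens at a rank above [rs] leave at most [rs n beta] vacancies in
    [top rs.+1], and an up step tolerates one vacancy. In both cases the tasks present still amount
    to [rho + eps], an unlikely load. *)
Hypothesis overload :
  rho + eps + rs%:R * beta + n%:R^-1 <= capacity a (top rs.+1).
Hypothesis underload : mu * capacity a (top rs) <= lambda - delta.

Implicit Type x : (occ * nat)%type.
Let nR : 0 < n%:R :> R. Proof. by rewrite ltr0n. Qed.
Let nRn0 : n%:R != 0 :> R. Proof. by rewrite gt_eqF. Qed.
Let rho0 : 0 < rho. Proof. exact: divr_gt0. Qed.
Let nl0 : 0 <= n%:R * lambda. Proof. by rewrite mulr_ge0// ltW. Qed.
Let oc := slta_chain u lambda0 mu0 n0 a0 beta.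
Let oQ x : E x -> Qn n a x.1. Proof. by case. Qed.
Let or x : E x -> (0 < x.2)%N. Proof. by case. Qed.
Let ut r : uniq (top r). Proof. exact: top_coords_uniq. Qed.
Local Notation gen := (jumps lambda mu n fst (slta_depart n) (slta_arrive u n beta)
  (fun x => slta_assign u n x.1 x.2)).
Local Notation X r x := (deficit n a (top r) x.1).
Local Notation dn x := (slta_down u n beta x.1 x.2).
Local Notation up x := (slta_up u n beta x.1 x.2).
Local Notation next x := (slta_next u n beta x.1 x.2).
Local Notation A := (capacity a (top rs)).

Definition slta_tau : R := tail_const lambda mu eps / n%:R ^+ 4.
Local Notation tau := slta_tau.

Let tail : mean_le E pr (fun x => (rho + eps <= tasks x.1)%R%:R) tau.
Proof. exact: (mean_tasks_tail lambda0 mu0 oc st n0 eps0). Qed.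

Let X_ge0 r x : E x -> 0 <= X r x.
Proof. by move=> /oQ Qx; exact: (deficit_ge0 Qx). Qed.

Let X_sub r r' x : E x -> (r <= r')%N -> X r x <= X r' x.
Proof.
move=> /oQ Qx rr'; apply: (deficit_sub Qx) => //.
exact: top_coords_sub.
Qed.

Let X_le x : E x -> X rs x <= n%:R * A.
Proof. by move=> /oQ Qx; exact: (deficit_le n0 Qx). Qed.

Let overloaded x : E x -> X rs.+1 x <= n%:R * (rs%:R * beta) + 1 ->
  rho + eps <= tasks x.1.
Proof.
move=> /oQ Qx Xx; have h := full_tasks n0 Qx (ut rs.+1) (@top_coords_Iplus _ _ _ u_concave _).
apply: le_trans h; rewrite lerBrDr; apply: le_trans overload.
by rewrite -[leRHS]addrA lerD2l -(ler_pM2l nR) mulVKf// mulrDr divff.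
Qed.

Lemma slta_up_overloaded x : E x -> (rs <= x.2)%N -> up x -> rho + eps <= tasks x.1.
Proof.
move=> Ex rsx ux; apply: overloaded => //.
have [_ X1] := slta_up_full u_concave n0 (oQ Ex) (or Ex) ux.
apply: (le_trans (X_sub Ex (rsx : (rs.+1 <= x.2.+1)%N))); apply: (le_trans X1).
by rewrite lerDr !mulr_ge0// ltW.
Qed.

Let tame_le x C : 0 <= C -> E x -> C <= C * (1 + n%:R * tasks x.1) ^+ 2.
Proof.
move=> C0 Ex; rewrite ler_peMr//; have := tasks_ge0 n0 (oQ Ex).
have := nR; set t := tasks _ => h1 h2.
have : 0 <= n%:R * t by rewrite mulr_ge0// ltW.
nra.
Qed.

Let lyap f g h b C : (forall x, E x -> 0 <= f x <= C) ->
  (forall x, E x -> 0 <= g x) ->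
  (forall x, E x -> g x + drift gen f x <= h x) ->
  mean_le E pr h b -> mean_le E pr g b.
Proof.
move=> f0 g0 H; apply: (chain_lyapunov lambda0 mu0 oc st n0 (f := f) (C := C)).
- by move=> x /f0/andP[].
- move=> x Ex; have /andP[f1 f2] := f0 _ Ex.
  apply: (le_trans f2); apply: tame_le => //; exact: le_trans f2.
- by move=> x Ex; rewrite g0//= lerBrDr H.
Qed.

Lemma level_drift (phi : nat -> R) x : E x ->
  drift gen (fun x => phi x.2) x <= n%:R * lambda * (phi (next x) - phi x.2).
Proof.
move=> Ex; have := drift_le lambda0 mu0 oc n0 (f := fun x => phi x.2) (s := [::])
  (C := 0) (c0 := 0) (c := phi (next x) - phi x.2) Ex isT.
rewrite !mul0r subr0 add0r; apply => // p _ /=.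
by rewrite mul0r !subrr.
Qed.

(** The Lyapunov function is the excess of the rank over [rs]. It grows only by up steps from ranks
    at least [rs], which need an overload, so down steps from above are as rare. It is truncated at
    [K] since no moment of the rank is known. *)
Lemma mean_down_above :
  mean_le E pr (fun x => ((rs < x.2)%N && dn x)%:R) tau.
Proof.
apply: (mean_le_sup st (N := snd)) => [x _|K]; first exact: ler0n.
pose phi r : R := (minn r (maxn K rs))%:R - (minn r rs)%:R.
have phi0 r : 0 <= phi r <= (maxn K rs)%:R.
  rewrite /phi subr_ge0 ler_nat lerBlDr -natrD ler_nat leq_min geq_minl.
  rewrite (leq_trans (geq_minr _ _) (leq_maxr _ _)).
  exact: leq_trans (geq_minr _ _) (leq_addr _ _).
have : mean_le E pr (fun x => n%:R * lambda *
    (((rs < x.2)%N && dn x)%:R * (x.2 <= K)%N%:R)) (n%:R * lambda * tau).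
  apply: (@lyap (fun x => phi x.2) _
    (fun x => n%:R * lambda * (rho + eps <= tasks x.1)%R%:R) _ (maxn K rs)%:R) => //.
  - by move=> x Ex; rewrite !mulr_ge0// ltW.
  - move=> x Ex; have := level_drift phi Ex.
    move=> /(lerD (lexx (n%:R * lambda * (((rs < x.2)%N && dn x)%:R * (x.2 <= K)%N%:R)))).
    move=> /le_trans; apply; rewrite -mulrDr ler_wpM2l//.
    rewrite slta_nextE /phi; move: (or Ex); set k := x.2 => k0.
    case: (boolP (slta_down u n beta x.1 k)) => dx.
      have [r1 _] := slta_down_vacant u_concave n0 (oQ Ex) (or Ex) dx.
      have /(congr1 (fun i : nat => i%:R : R)) := minn_pred_diff K rs k0.
      rewrite !natrD natrM andbT => e'.
      apply: (@le_trans _ _ 0); last exact: ler0n.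
      by move: e'; lra.
    rewrite andbF mul0r add0r; case: ifP => ux; last by rewrite subrr ler0n.
    have := minn_succ_diff K rs k; rewrite -(ler_nat R) !natrD.
    case: (leqP rs k) => h1 /=.
      by rewrite (slta_up_overloaded Ex h1 ux) /=; lra.
    move=> e'; apply: (@le_trans _ _ 0); last exact: ler0n.
    by move: e'; lra.
  - exact: (mean_leZ st nl0 tail).
have mi : 0 <= (n%:R * lambda)^-1 by rewrite invr_ge0.
move=> /(mean_leZ st mi); apply: (mean_le_mono st).
  by move=> x Ex; rewrite mulr_ge0//= mulKf// gt_eqF// mulr_gt0.
by rewrite mulKf// gt_eqF// mulr_gt0.
Qed.

Local Notation K := (rho + eps).
Let K0 : 0 <= K. Proof. by rewrite addr_ge0// ltW. Qed.

Definition slta_bad x : bool := (K <= tasks x.1) || ((rs < x.2)%N && dn x).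

Lemma mean_slta_bad : mean_le E pr (fun x => (slta_bad x)%:R) (tau + tau).
Proof.
apply: (mean_le_mono st) (mean_leD st tail mean_down_above) => // x _.
rewrite ler0n /slta_bad; case: (K <= tasks x.1) => /=.
  by rewrite lerDl.
by rewrite add0r.
Qed.

Let cap_class i x : R := Num.min (class_tasks (pred1 i) x.1) K.

Let cap_class_ge0 i x : E x -> 0 <= cap_class i x.
Proof.
move=> Ex; rewrite le_min K0 andbT; apply: sumr_ge0 => p _.
exact: (Qn_ge0 n0 (oQ Ex)).
Qed.

Let cap_class_le i x : cap_class i x <= K.
Proof. by rewrite /cap_class ge_min lexx orbT. Qed.

(* When [r] exceeds [rs] and the state is not overloaded, no pool of class
   [i_(r-1)] holds a green token, so tasks of that class only leave. *)
Lemma slta_above_draining x : E x -> (rs < x.2)%N -> ~~ slta_bad x ->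
  [/\ amin <= class_tasks (pred1 (kth x.2.-1).1) x.1,
      next x = x.2 &
      forall p, 0 < slta_assign u n x.1 x.2 p -> p.1 <> (kth x.2.-1).1].
Proof.
move=> Ex rx; rewrite /slta_bad rx negb_or /= -ltNge => /andP[notover ndn].
have Qx := oQ Ex; have r1 : (1 < x.2)%N by exact: leq_ltn_trans rx.
have nover c : X rs.+1 x <= c -> n%:R * (rs%:R * beta) + 1 < c.
  move=> h; rewrite ltNge; apply/negP => c1.
  by have := overloaded Ex (le_trans h c1); rewrite leNgt notover.
(* Without overload there are more than [n rs beta + 1] vacancies in [top rs.+1]. Its [rs]
   coordinates are all green at the current rank, so at least [n beta] green tokens exist. *)
have g1 : n%:R * beta <= pool_count n x.1 (green u x.2).
  have st' : {subset top rs.+1 <= top x.2} by exact: top_coords_sub.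
  have := nover _ (deficit_le_green u_concave n0 Qx (or Ex) st').
  rewrite /top_coords size_map size_iota /=.
  have rsR : (0 : R) < rs%:R by rewrite ltr0n.
  move=> h; rewrite -(ler_pM2l rsR) mulrCA; apply: ltW.
  by apply: lt_trans h; rewrite ltrDl.
have last0 : pool_count n x.1 (green_last u x.2) <= 0.
  by move: ndn; rewrite /slta_down r1 g1 /= -leNgt.
have gpos : 0 < pool_count n x.1 (green u x.2).
  by apply: lt_le_trans g1; exact: mulr_gt0.
split.
- apply: (le_trans (amin_le (kth x.2.-1).1)).
  rewrite -(green_last_full u_concave n0 Qx r1 last0).
  apply: (class_tasks_ge n0 Qx); apply: kth_Iplus => //.
  by case: (x.2) r1 => [|[]].
- rewrite slta_nextE (negbTE ndn) /slta_up.
  by rewrite (gt_eqF gpos) andbF.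
- move=> p; apply: (slta_assign_other n0 a0 Qx).
  exact: (green_other_gt0 n0 Qx last0).
Qed.

(* The Lyapunov function is the number of tasks of class [i_(r-1)], capped in
   order that a switch of the rank changes it by a bounded amount. *)
Lemma mean_above : mean_le E pr (fun x => (rs < x.2)%N%:R)
  ((n%:R * lambda * K / (mu * amin) + 1) * (tau + tau)).
Proof.
pose f x := if (rs < x.2)%N then cap_class (kth x.2.-1).1 x else 0.
have f0 x : E x -> 0 <= f x <= K.
  move=> Ex; rewrite /f; case: ifP => _; last by rewrite lexx K0.
  by rewrite cap_class_ge0// cap_class_le.
have ma0 : 0 < mu * amin by exact: mulr_gt0.
have nlK : 0 <= n%:R * lambda * K by exact: mulr_ge0.
have dep0 x p : E x -> 0 < departs mu n x.1 p -> f (slta_depart n x p) - f x <=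
    - (n%:R^-1 * ((rs < x.2)%N && (p.1 == (kth x.2.-1).1) &&
       (class_tasks (pred1 (kth x.2.-1).1) x.1 <= K)%R)%:R).
  move=> Ex h; have [Ip qp] := departs_gt0 mu0 n0 h.
  have Qd := Qn_depart n0 (oQ Ex) Ip qp.
  rewrite /f /=; case: ifP => rx; last by rewrite subrr mulr0 oppr0.
  rewrite /cap_class /= (class_tasks_depart _ n0 (oQ Ex) Ip Qd) /=.
  set Y := class_tasks _ _; case: (boolP (p.1 == _)) => _ /=; last first.
    by rewrite !mulr0 subr0 subrr oppr0.
  have ni : 0 < n%:R^-1 :> R by rewrite invr_gt0.
  rewrite mulr1; case: (leP Y K) => YK.
    by rewrite mulr1 lerBlDr addrC ge_min lexx.
  by rewrite mulr0 oppr0 subr_le0 ge_min lexx orbT.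
have main : mean_le E pr
    (fun x => mu * amin * ((rs < x.2)%N && ~~ slta_bad x)%:R)
    (n%:R * lambda * K * (tau + tau)).
  apply: (@lyap f _ (fun x => n%:R * lambda * K * (slta_bad x)%:R) _ K) => //.
  - by move=> x _; rewrite mulr_ge0// ltW.
  - move=> x Ex; have Qx := oQ Ex.
    have arrK p : f (slta_arrive u n beta x p) <= K.
      by rewrite /f; case: ifP => // _; exact: cap_class_le.
    have arr_bad : n%:R * lambda * \sum_(p <- box m (height x.1))
        slta_assign u n x.1 x.2 p * (f (slta_arrive u n beta x p) - f x) <=
        n%:R * lambda * (K * (slta_bad x)%:R).
      apply: (arr_drift_le lambda0 oc Ex) => p hp.
      have /andP[fx0 _] := f0 x Ex.
      case: (boolP (slta_bad x)) => nb.
        by rewrite mulr1; have := arrK p; lra.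
      rewrite mulr0 subr_le0; case: (ltnP rs x.2) => rx.
        have [_ nx other] := slta_above_draining Ex rx nb.
        rewrite /f /= nx rx /cap_class /=.
        have [Ip room] := oc_valid oc Ex hp.
        rewrite (class_tasks_arrive _ n0 Qx Ip (Qn_arrive n0 Qx Ip room)) /=.
        by move/eqP/negbTE: (other p hp) => ->; rewrite mulr0 addr0.
      (* From a rank at most [rs] the function becomes positive only by an up step at [rs], which
         requires an overload and hence a bad state. *)
      rewrite /f /= ltnNge; case: (leqP (next x) rs) => //= nx; exfalso.
      move: nx; rewrite slta_nextE; case: ifP => _.
        by rewrite ltnNge (leq_trans (leq_pred _) rx).
      case: ifP => ux; last by rewrite ltnNge rx.
      rewrite ltnS => rx'; move: nb; rewrite /slta_bad negb_or.
      by rewrite (slta_up_overloaded Ex rx' ux).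
    rewrite drift_jumps.
    have dle := dep_drift_le mu0 oc Ex (f := f) (dl := fun x p =>
      - (n%:R^-1 * ((rs < x.2)%N && (p.1 == (kth x.2.-1).1) &&
       (class_tasks (pred1 (kth x.2.-1).1) x.1 <= K)%R)%:R)) (fun p => dep0 x p Ex).
    have dep_le : \sum_(p <- box m (height x.1)) departs mu n x.1 p *
        (f (slta_depart n x p) - f x) <= - (mu * amin * ((rs < x.2)%N && ~~ slta_bad x)%:R).
      apply: (le_trans dle).
      case: (boolP ((rs < x.2)%N && ~~ slta_bad x)) => [/andP[rx nb]|_]; last first.
        rewrite mulr0 oppr0; apply: sumr_le0 => p _.
        rewrite mulrN oppr_le0; apply: mulr_ge0.
          exact: (departs_ge0 (ltW mu0) Qx).
        by apply: mulr_ge0; rewrite ?invr_ge0 ?ler0n.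
      have [Yge _ _] := slta_above_draining Ex rx nb.
      have YK : class_tasks (pred1 (kth x.2.-1).1) x.1 <= K.
        apply: (le_trans (class_tasks_le _ n0 Qx)).
        by move: nb; rewrite /slta_bad negb_or -ltNge => /andP[/ltW].
      rewrite rx YK mulr1.
      (* Tasks of this class leave at total rate [n mu] times their normalised number, hence at
         least [n mu amin], and each departure lowers [f] by [1/n]. *)
      rewrite (eq_bigr (fun p => - n%:R^-1 *
        (if p.1 == (kth x.2.-1).1 then departs mu n x.1 p else 0))); last first.
        by move=> p _; rewrite andbT /=; case: ifP => _; rewrite ?mulr1 ?mulr0 ?oppr0 ?mulr0 1?mulrC//.
      rewrite -mulr_sumr -big_mkcond /=.
      rewrite (sum_departs_class mu n0 Qx (pred1 (kth x.2.-1).1)).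
      rewrite mulNr lerN2 -mulrA mulKf// ler_pM2l//.
    move: dep_le arr_bad; lra.
  - exact: (mean_leZ st nlK mean_slta_bad).
have mi : 0 <= (mu * amin)^-1 by rewrite invr_ge0 ltW.
have := mean_leD st (mean_leZ st mi main) mean_slta_bad.
apply: (mean_le_mono st).
  move=> x Ex; rewrite ler0n mulKf ?gt_eqF//=.
  by case: (rs < x.2)%N; case: (slta_bad x) => /=; lra.
by rewrite le_eqVlt; apply/orP; left; apply/eqP; field; rewrite !gt_eqF.
Qed.

Let arrQ x p : E x -> 0 < slta_assign u n x.1 x.2 p -> Qn n a (arrive n x.1 p).
Proof.
move=> Ex h; have [Ip room] := oc_valid oc Ex h.
exact: (Qn_arrive n0 (oQ Ex) Ip room).
Qed.

Let rate_below r x : E x -> (r <= rs)%N ->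
  n%:R * mu * \sum_(p <- top r) x.1 p <= n%:R * (lambda - delta).
Proof.
move=> Ex rr; rewrite -mulrA ler_pM2l//; apply: le_trans underload.
rewrite ler_pM2l//; apply: le_trans (capacity_le u_concave a0 rr).
by have := X_ge0 r Ex; rewrite /deficit pmulr_rge0// subr_ge0.
Qed.

Let arr_below x p : E x -> 0 < slta_assign u n x.1 x.2 p -> 0 < X x.2 x ->
  forall r, (x.2 <= r)%N -> deficit n a (top r) (arrive n x.1 p) = X r x - 1.
Proof.
move=> Ex hp Xp r rr; rewrite deficit_arrive//.
have pt := slta_assign_top u_concave n0 a0 (oQ Ex) (or Ex) Xp hp.
by rewrite (top_coords_sub rr pt).
Qed.

Let arr_belowS x p : E x -> 0 < slta_assign u n x.1 x.2 p -> 0 < X x.2.+1 x ->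
  deficit n a (top x.2.+1) (arrive n x.1 p) = X x.2.+1 x - 1.
Proof.
move=> Ex hp Xp; rewrite deficit_arrive//.
by rewrite (slta_assign_topS u_concave n0 a0 (oQ Ex) (or Ex) Xp hp).
Qed.

Let arr_full x p r : E x -> 0 < slta_assign u n x.1 x.2 p -> X r x = 0 ->
  deficit n a (top r) (arrive n x.1 p) = 0.
Proof.
move=> Ex hp X0; have := deficit_ge0 (arrQ Ex hp) (top r).
rewrite deficit_arrive// X0 add0r.
by case: (p \in top r) => /=; rewrite ?oppr0//; lra.
Qed.

Let cubic y : R := y ^+ 3 + 3 * lambda / delta * y ^+ 2.

Let cubic_mono y z : 0 <= y -> y <= z -> cubic y <= cubic z.
Proof.
move=> y0 yz; have z0 := le_trans y0 yz.
apply: lerD; first by rewrite ler_pXn2r ?nnegrE.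
rewrite ler_wpM2l ?ler_pXn2r ?nnegrE// divr_ge0 ?(ltW delta0)//.
by rewrite mulr_ge0// ltW.
Qed.

Let cubic0 : cubic 0 = 0. Proof. by rewrite /cubic !expr0n /= mulr0 addr0. Qed.

(** The first term is the constant left in the drift of [cubic]; the second is the cost of entering
    rank [rs] from above, where the deficit is only known to be at most [n A]. *)
Definition slta_sq_bound : R :=
  (lambda * (1 + 2 * (3 * lambda / delta)) + lambda * cubic (n%:R * A) * tau)
    / (3 * delta).

(* The coefficient of the square in [cubic] makes the linear terms of the drift of
   [cubic y] cancel, up to terms with the right sign. *)
Lemma mean_sq_below :
  mean_le E pr (fun x => (x.2 <= rs)%N%:R * X x.2 x ^+ 2) slta_sq_bound.
Proof.
have [c0 c0E] : exists c0, c0 = 3 * lambda / delta by eexists.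
have c00 : 0 < c0 by rewrite c0E !mulr_gt0 ?invr_gt0.
have c0d : c0 * delta = 3 * lambda by rewrite c0E divfK// gt_eqF.
have nA0 : 0 <= n%:R * A by rewrite mulr_ge0// capacity_ge0.
have cA0 : 0 <= cubic (n%:R * A) by rewrite -cubic0 cubic_mono.
pose f x := if (x.2 <= rs)%N then cubic (X x.2 x) else 0.
have f0 x : E x -> 0 <= f x <= cubic (n%:R * A).
  move=> Ex; rewrite /f; case: ifP => rx; last by rewrite lexx cA0.
  rewrite -{1}cubic0 !cubic_mono ?X_ge0//.
  exact: le_trans (X_sub Ex rx) (X_le Ex).
have main : mean_le E pr (fun x => 3 * delta * n%:R * ((x.2 <= rs)%N%:R * X x.2 x ^+ 2))
    (n%:R * (lambda * (1 + 2 * c0)) + n%:R * lambda * cubic (n%:R * A) * tau).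
  apply: (@lyap f _ (fun x => n%:R * (lambda * (1 + 2 * c0)) +
     n%:R * lambda * cubic (n%:R * A) * ((rs < x.2)%N && dn x)%:R) _
     (cubic (n%:R * A))) => //.
  - move=> x Ex; rewrite mulr_ge0//; first by rewrite !mulr_ge0// ltW.
    by rewrite mulr_ge0// sqr_ge0.
  - move=> x Ex; have Qx := oQ Ex; case: (leqP x.2 rs) => rx /=; last first.
      (* Above [rs] the function is zero; only a down step from [rs.+1] can make it positive. *)
      have := drift_le lambda0 mu0 oc n0 (f := f) (s := [::]) (C := 0) (c0 := 0)
        (c := cubic (n%:R * A) * (dn x)%:R) Ex isT.
      have -> : f x = 0 by rewrite /f leqNgt rx.
      rewrite !mul0r mulr0 subr0 !add0r => dl; apply: (le_trans (dl _ _ _ _)) => //.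
      + by move=> p _; rewrite mul0r !subr0 /f /= leqNgt rx.
      + move=> p hp; rewrite subr0 /f /=; case: ifP => nx; last by rewrite mulr_ge0.
        move: nx; rewrite slta_nextE; case: ifP => dx; last first.
          case: ifP => _ h; [have := ltn_trans rx h | have := leq_trans rx h];
          by rewrite ltnn.
        move=> rx'; rewrite mulr1; apply: cubic_mono.
          exact: (deficit_ge0 (arrQ Ex hp)).
        apply: le_trans (deficit_le n0 (arrQ Ex hp) _).
        apply: (deficit_sub (arrQ Ex hp)) => //; exact: top_coords_sub.
      + by rewrite mulrA lerDr !mulr_ge0// ?ltW// addr_gt0// mulr_gt0.
    set y := X x.2 x; have y0 : 0 <= y by exact: X_ge0.
    (* [C] is the increase at a departure from [top x.2] and [c] bounds the change at an arrival:
       with a vacancy the arrival fills one, without any the function stays at zero. *)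
    pose C := cubic (y + 1) - cubic y.
    have C0 : 0 <= C by rewrite subr_ge0 cubic_mono// lerDl.
    pose c := if 0 < y then cubic (y - 1) - cubic y else 0.
    have dl : drift gen f x <= C * (n%:R * mu * \sum_(p <- top x.2) x.1 p)
        - 0 * (n%:R * mu * tasks x.1) + n%:R * lambda * c.
      apply: (drift_le lambda0 mu0 oc n0 Ex) => //.
      + exact: top_coords_downS.
      + move=> p _; rewrite /f /= rx deficit_depart// -/y subr0 /C.
        by case: (p \in _) => /=; rewrite ?mulr1// mulr0 addr0 subrr.
      + move=> p hp; rewrite {2}/f rx -/y /c; case: ltP => yp.
          rewrite lerD2r /f /= slta_nextE.
          have Xr := arr_below Ex hp yp (leqnn _).
          have y1 : 0 <= y - 1 by rewrite /y -Xr (deficit_ge0 (arrQ Ex hp)).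
          case: (boolP (dn x)) => dx.
            rewrite (leq_trans (leq_pred _) rx) /y -Xr.
            apply: cubic_mono; first exact: (deficit_ge0 (arrQ Ex hp)).
            apply: (deficit_sub (arrQ Ex hp)) => //.
            by apply: top_coords_sub; exact: leq_pred.
          case: (boolP (up x)) => ux; last by rewrite rx Xr.
          have [X0 _] := slta_up_full u_concave n0 Qx (or Ex) ux.
          by move: yp; rewrite /y X0 ltxx.
        have X0 : y = 0 by apply/eqP; rewrite eq_le yp y0.
        rewrite X0 cubic0 subr0 /f /= slta_nextE; case: (boolP (dn x)) => dx.
          have [_] := slta_down_vacant u_concave n0 Qx (or Ex) dx.
          by rewrite -/y X0 leNgt mulr_gt0.
        case: (boolP (up x)) => ux; last by rewrite rx (arr_full Ex hp X0) cubic0.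
        (* An up step is taken with at most one vacancy in [top x.2.+1], and the same arrival fills
           it: the deficit at the new rank is zero. *)
        have [_ X1] := slta_up_full u_concave n0 Qx (or Ex) ux.
        case: ifP => // _; have := X_ge0 x.2.+1 Ex.
        rewrite le_eqVlt => /predU1P[/esym XS|XS].
          by rewrite (arr_full Ex hp XS) cubic0.
        have e := arr_belowS Ex hp XS.
        have := deficit_ge0 (arrQ Ex hp) (top x.2.+1); rewrite e => h.
        by rewrite (_ : _ - 1 = 0) ?cubic0//; lra.
    have dl2 : drift gen f x <= C * (n%:R * (lambda - delta)) + n%:R * lambda * c.
      apply: (le_trans dl); rewrite mul0r subr0 lerD2r.
      by rewrite ler_wpM2l// rate_below.
    rewrite mul1r mulr0 addr0.
    have key : 3 * delta * y ^+ 2 + (C * (lambda - delta) + lambda * c) <=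
        lambda * (1 + 2 * c0).
      have dc : 0 < delta * c0 by exact: mulr_gt0.
      have lc : 0 < lambda * c0 by exact: mulr_gt0.
      rewrite /C /c /cubic -c0E; case: ltP => yp; last first.
        have -> : y = 0 by apply/eqP; rewrite eq_le yp y0.
        rewrite [leLHS](_ : _ = lambda - delta + lambda * c0 - delta * c0); last by ring.
        by move: delta0 dc lc; lra.
      have yd : 0 <= y * delta by rewrite mulr_ge0// ltW.
      rewrite [leLHS](_ : _ = 2 * y * (3 * lambda - c0 * delta) - 3 * (y * delta)
        + 2 * (lambda * c0) - delta - delta * c0); last by ring.
      by rewrite c0d subrr mulr0; move: delta0 dc lc yd; lra.
    have := ler_wpM2l (ltW nR) key; move: dl2; lra.
  - apply: (mean_leD st); last first.
      by apply: (mean_leZ st _ mean_down_above); exact: mulr_ge0.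
    apply: (mean_le_cst st); rewrite !mulr_ge0 ?(ltW lambda0)//.
    by rewrite addr_ge0// mulr_ge0// ltW.
have d30 : 0 < 3 * delta * n%:R by rewrite !mulr_gt0.
have mi : 0 <= (3 * delta * n%:R)^-1 by rewrite invr_ge0 ltW.
have := mean_leZ st mi main; apply: (mean_le_mono st).
  move=> x Ex; rewrite mulKf ?gt_eqF// lexx andbT.
  by rewrite mulr_ge0// sqr_ge0.
rewrite /slta_sq_bound -c0E le_eqVlt; apply/orP; left; apply/eqP.
by field; rewrite !gt_eqF.
Qed.

Definition slta_switch_bound : R := slta_sq_bound / (n%:R * beta) ^+ 2.

(** A down step needs [n beta] green tokens, hence a deficit of at least [n beta]; Markov's
    inequality for the square of the deficit. *)
Lemma mean_down_below :
  mean_le E pr (fun x => ((x.2 <= rs)%N && dn x)%:R) slta_switch_bound.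
Proof.
have nb : 0 < n%:R * beta by exact: mulr_gt0.
have ni : 0 <= ((n%:R * beta) ^+ 2)^-1 by rewrite invr_ge0 sqr_ge0.
apply: (mean_le_mono st) (mean_leZ st ni mean_sq_below) => [x Ex|]; last first.
  by rewrite mulrC.
rewrite ler0n /= mulrC ler_pdivlMr ?exprn_gt0//; case: (leqP x.2 rs) => rx /=.
  case: (boolP (dn x)) => dx /=; last by rewrite mul0r mul1r sqr_ge0.
  have [_ h] := slta_down_vacant u_concave n0 (oQ Ex) (or Ex) dx.
  by rewrite !mul1r ler_pXn2r ?nnegrE ?(ltW nb)// X_ge0.
by rewrite !mul0r.
Qed.

(* Below [rs], up and down steps of the rank balance out. *)
Lemma mean_up_below :
  mean_le E pr (fun x => ((x.2 < rs)%N && up x)%:R) slta_switch_bound.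
Proof.
have nl : 0 < n%:R * lambda by exact: mulr_gt0.
have : mean_le E pr (fun x => n%:R * lambda * ((x.2 < rs)%N && up x)%:R)
    (n%:R * lambda * slta_switch_bound).
  apply: (@lyap (fun x => (rs - x.2)%N%:R) _
    (fun x => n%:R * lambda * ((x.2 <= rs)%N && dn x)%:R) _ rs%:R) => //.
  - by move=> x _; rewrite ler0n ler_nat leq_subr.
  - by move=> x _; rewrite mulr_ge0.
  - move=> x Ex; have := level_drift (fun r => (rs - r)%N%:R) Ex.
    move: (slta_nextE u n x.1 beta x.2).
    have : ((x.2 <= rs)%N = true -> (rs - x.2.-1 = (rs - x.2).+1)%N).
      by have := or Ex; case: (x.2) => // k _ h; rewrite subnSK.
    case: (boolP (dn x)) => dx hr.
      have -> : up x = false by rewrite /slta_up dx.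
      move=> -> dl; rewrite andbF mulr0 add0r; apply: (le_trans dl).
      rewrite ler_wpM2l// andbT lerBlDr -natrD ler_nat.
      by case: leqP hr => h hr /=; [rewrite hr// | have := or Ex; move: h; clear; lia].
    case: (boolP (up x)) => ux -> dl.
      rewrite andbF andbT mulr0 -lerBrDl sub0r; apply: (le_trans dl).
      rewrite -mulrN ler_wpM2l// lerBlDr addrC lerBrDr -natrD ler_nat.
      by case: ltnP => h /=; move: h; clear; lia.
    rewrite andbF mulr0 add0r; apply: (le_trans dl).
    by rewrite subrr mulr0 mulr_ge0.
  - by apply: (mean_leZ st _ mean_down_below); exact: ltW.
have mi : 0 <= (n%:R * lambda)^-1 by rewrite invr_ge0 ltW.
move=> /(mean_leZ st mi); apply: (mean_le_mono st).
  by move=> x Ex; rewrite ler0n mulKf ?gt_eqF//= lexx.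
by rewrite mulKf// gt_eqF.
Qed.

(* The deficit one level above the current rank decreases at rate at least
   [n delta], except at the rare switches of the rank. *)
Lemma mean_below : mean_le E pr (fun x => (x.2 < rs)%N%:R)
  (lambda / delta * (n%:R * A + 1) * (slta_switch_bound + slta_switch_bound)).
Proof.
have nA0 : 0 <= n%:R * A by rewrite mulr_ge0// capacity_ge0.
pose f x := if (x.2 < rs)%N then X x.2.+1 x else 0.
have X_le' r x : E x -> (r <= rs)%N -> X r x <= n%:R * A.
  by move=> Ex rr; exact: le_trans (X_sub Ex rr) (X_le Ex).
have f0 x : E x -> 0 <= f x <= n%:R * A.
  move=> Ex; rewrite /f; case: ifP => rx; last by rewrite lexx nA0.
  by rewrite X_ge0// X_le'.
have main : mean_le E pr (fun x => n%:R * delta * (x.2 < rs)%N%:R)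
   (n%:R * lambda * (n%:R * A + 1) * (slta_switch_bound + slta_switch_bound)).
  have nlA : 0 <= n%:R * lambda * (n%:R * A + 1) by rewrite mulr_ge0// addr_ge0.
  apply: (@lyap f _ (fun x => n%:R * lambda * (n%:R * A + 1) *
    (((x.2 < rs)%N && up x)%:R + ((x.2 <= rs)%N && dn x)%:R)) _ (n%:R * A)) => //.
  - by move=> x _; rewrite mulr_ge0// mulr_ge0// ltW.
  - move=> x Ex; have Qx := oQ Ex.
    have arrA p r : 0 < slta_assign u n x.1 x.2 p -> (r <= rs)%N ->
        deficit n a (top r) (arrive n x.1 p) <= n%:R * A.
      move=> hp rr; apply: le_trans (deficit_le n0 (arrQ Ex hp) _).
      by apply: (deficit_sub (arrQ Ex hp)) => //; exact: top_coords_sub.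
    case: (ltnP x.2 rs) => rx /=; last first.
      (* At ranks at least [rs] the function is zero, and only a down step from [rs] can make it
         positive, by at most [n A]. *)
      have fx : f x = 0 by rewrite /f ltnNge rx.
      have dl : drift gen f x <= 0 * (n%:R * mu * \sum_(p <- [::] : seq coord) x.1 p)
          - 0 * (n%:R * mu * tasks x.1)
          + n%:R * lambda * (n%:R * A * ((x.2 <= rs)%N && dn x)%:R).
        apply: (drift_le lambda0 mu0 oc n0 Ex) => //.
          by move=> p _; rewrite mul0r fx !subr0 /f /= ltnNge rx.
        move=> p hp; rewrite fx subr0 /f /=; case: ifP => nx; last by rewrite mulr_ge0.
        move: (nx); rewrite slta_nextE; case: (boolP (dn x)) => dx; last first.
          case: ifP => _ h.
            by have := leq_trans h rx; rewrite ltnNge leqnSn.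
          by have := leq_ltn_trans rx h; rewrite ltnn.
        rewrite (prednK (or Ex)) => h; rewrite h mulr1; exact: arrA.
      rewrite !mul0r subr0 add0r in dl; rewrite mulr0 add0r.
      apply: (le_trans dl); rewrite add0r mulrA ler_wpM2r ?ler0n//.
      by rewrite ler_wpM2l// lerDl.
    set y := X x.2.+1 x.
    (* An arrival lowers the function by at least one unless the rank goes up, in which case only
       the trivial bound [n A] is used. *)
    pose c := - 1 + (n%:R * A + 1) * (up x)%:R.
    have dl : drift gen f x <= 1 * (n%:R * mu * \sum_(p <- top x.2.+1) x.1 p)
        - 0 * (n%:R * mu * tasks x.1) + n%:R * lambda * c.
      apply: (drift_le lambda0 mu0 oc n0 Ex) => //.
      + exact: top_coords_downS.
      + by move=> p _; rewrite /f /= rx deficit_depart// -/y subr0 mul1r addrAC subrr add0r.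
      + move=> p hp; rewrite {2}/f rx -/y /c.
        have y0 : 0 <= y by exact: X_ge0.
        case: (boolP (up x)) => ux.
          rewrite mulr1 [leRHS](_ : _ = n%:R * A); last by ring.
          rewrite lerBlDr (@le_trans _ _ (n%:R * A))//; last by rewrite lerDl.
          by rewrite /f /=; case: ifP => // nx; exact: arrA.
        rewrite mulr0 addr0 lerBlDr addrC /f /= slta_nextE (negbTE ux).
        (* With no vacancy in [top x.2.+1] the rank would go up; so a vacancy exists, and the
           arrival fills one. *)
        have yp : 0 < y.
          rewrite lt_neqAle y0 andbT; apply/eqP => /esym X0.
          by move/negP: ux; apply; exact: (slta_full_up u_concave n0 Qx beta0 (or Ex)).
        have e := arr_belowS Ex hp yp.
        case: (boolP (dn x)) => dx; last by rewrite rx e.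
        rewrite (leq_ltn_trans (leq_pred _) rx) (prednK (or Ex)) -e.
        by apply: (deficit_sub (arrQ Ex hp)) => //; exact: top_coords_sub.
    have dl2 := rate_below Ex rx.
    have h : 0 <= n%:R * lambda * (n%:R * A + 1) * ((x.2 <= rs)%N && dn x)%:R.
      by rewrite mulr_ge0.
    move: dl dl2 h; rewrite /c mul1r mul0r subr0 mulr1.
    set F := n%:R * mu * _; lra.
  - apply: (mean_leZ st nlA); apply: (mean_leD st mean_up_below mean_down_below).
have nd : 0 < n%:R * delta by exact: mulr_gt0.
have mi : 0 <= (n%:R * delta)^-1 by rewrite invr_ge0 ltW.
have := mean_leZ st mi main; apply: (mean_le_mono st).
  by move=> x Ex; rewrite ler0n mulKf ?gt_eqF//= lexx.
rewrite le_eqVlt; apply/orP; left; apply/eqP.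
by field; rewrite !gt_eqF.
Qed.

Definition slta_off_bound : R :=
  (n%:R * lambda * K / (mu * amin) + 1) * (tau + tau) +
  lambda / delta * (n%:R * A + 1) * (slta_switch_bound + slta_switch_bound).

Lemma mean_off : mean_le E pr (fun x => (x.2 != rs)%:R) slta_off_bound.
Proof.
apply: (mean_le_mono st) (mean_leD st mean_above mean_below) => // x _.
by rewrite ler0n neq_ltn; case: ltngtP => _ /=; rewrite ?addr0 ?add0r.
Qed.

(** At rank [rs] every arrival goes to [top rs.+1] while it has a vacancy. The exceptional states
    have a wrong rank, or a full [top rs.+1], which is an overload. *)
Lemma slta_outside :
  mean_le E pr (fun x => tasks x.1 - \sum_(p <- top rs.+1) x.1 p)
    (rho * (slta_off_bound + tau)).
Proof.
apply: (mean_tasks_outside lambda0 mu0 oc st n0 (ut _)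
  (@top_coords_Iplus _ _ _ u_concave _) (@top_coords_downS _ _ _ u_concave _)
  (B := fun x => (x.2 != rs) || (X rs.+1 x == 0))).
  move=> x p Ex; rewrite negb_or negbK => /andP[/eqP rx nX] hp.
  rewrite -rx; apply: (slta_assign_topS u_concave n0 a0 (oQ Ex) (or Ex)) hp.
  by rewrite rx lt_neqAle eq_sym nX X_ge0.
apply: (mean_le_mono st) (mean_leD st mean_off tail) => // x Ex.
rewrite ler0n /=; case: (x.2 != rs) => /=; first by rewrite lerDl.
rewrite add0r; case: eqP => // X0; rewrite overloaded// X0 addr_ge0//.
by rewrite !mulr_ge0// ltW.
Qed.

(** At rank [rs] this is [mean_sq_below]; elsewhere the trivial bound [(n A)^2] is paid with the
    probability of a wrong rank. After division by [n^2] it suffices that this probability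
    vanishes. *)
Lemma slta_deficit_sq :
  mean_le E pr (fun x => X rs x ^+ 2)
    (slta_sq_bound + (n%:R * A) ^+ 2 * slta_off_bound).
Proof.
have nA0 : 0 <= n%:R * A by rewrite mulr_ge0// capacity_ge0.
apply: (mean_le_mono st) (mean_leD st mean_sq_below (mean_leZ st (sqr_ge0 _) mean_off)) => // x Ex.
rewrite sqr_ge0 /=; case: (eqVneq x.2 rs) => [->|ne] /=.
  by rewrite leqnn mul1r mulr0 addr0.
rewrite mulr1; apply: (@le_trans _ _ ((n%:R * A) ^+ 2)).
  by rewrite ler_pXn2r ?nnegrE ?X_ge0 ?X_le.
by rewrite lerDr mulr_ge0// sqr_ge0.
Qed.

End slta_bounds.

(** * Weak convergence from stationary means *)

Section discrete_expectation.
Variables (R : realType) (d : measure_display) (W : measurableType d).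
Variables (P : probability W R) (S : topologicalType) (E : set S) (X : W -> S).
Hypothesis XE : random_element E X.
Hypotheses (countable_E : countable E) (closed_E : forall x, E x -> closed [set x]).

Local Notation law := (fun x => P (X @^-1` [set x])).

Let measurable_point x : E x -> measurable (X @^-1` [set x]).
Proof.
move=> Ex; have [_ mX] := XE.
have -> : X @^-1` [set x] = ~` (X @^-1` (~` [set x])) by rewrite preimage_setC setCK.
apply: measurableC; apply: mX.
by apply: closed_openC; exact: closed_E.
Qed.

Let slice_cases (e : S -> nat) A k : {in E &, injective e} ->
  [set x | [/\ A x, E x & e x = k]] = set0 \/
  exists2 x, E x & [set x | [/\ A x, E x & e x = k]] = [set x].
Proof.
move=> ei; have [[x [Ax Ex ek]]|none] := pselect (exists x, [/\ A x, E x & e x = k]).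
  right; exists x => //; apply/seteqP; split=> [y [_ Ey eyk]|_ ->]//=.
  by apply: ei; rewrite ?inE//; rewrite eyk ek.
by left; apply/seteqP; split=> // x [Ax Ex ek]; apply: none; exists x.
Qed.

Let measurable_slice (e : S -> nat) A k : {in E &, injective e} ->
  measurable (X @^-1` [set x | [/\ A x, E x & e x = k]]).
Proof.
by move=> ei; case: (slice_cases A k ei) => [->|[x Ex ->]];
  [rewrite preimage_set0; exact: measurable0 | exact: measurable_point].
Qed.

(** [X] takes countably many values, each a closed point, so every preimage is a countable union of
    measurable sets. Hence any function of [X], such as the utility, is measurable. *)
Lemma measurable_preimage A : measurable (X @^-1` A).
Proof.
have /countable_injP[e ei] := countable_E; have [EX _] := XE.
have -> : X @^-1` A = \bigcup_k X @^-1` [set x | [/\ A x, E x & e x = k]].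
  apply/seteqP; split=> [w Aw|w [k _ [Aw _ _]]]//.
  by exists (e (X w)).
by apply: bigcup_measurable => k _; exact: measurable_slice.
Qed.

Lemma measurable_discrete d' (T : measurableType d') (h : S -> T) :
  measurable_fun setT (h \o X).
Proof.
move=> _ Y _; rewrite setTI comp_preimage; exact: measurable_preimage.
Qed.

(** The sample space splits into the level sets of [X], on each of which the integrand is
    constant. *)
Lemma integral_le_mean g b : mean_le E law g b ->
  (\int[P]_w (g (X w))%:E <= b%:E)%E.
Proof.
move=> [g0 gb]; have /countable_injP[e ei] := countable_E; have [EX _] := XE.
pose J k := [set x | [/\ [set: S] x, E x & e x = k]].
have JE : E = \bigcup_k J k.
  by apply/seteqP; split=> [x Ex|x [k _ [_ Ex _]]]//; exists (e x).
have JT : trivIset setT J by move=> i j _ _ [x [[_ _ <-] [_ _ <-]]].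
have WE : [set: W] = \bigcup_k X @^-1` J k.
  by apply/seteqP; split=> // w _; exists (e (X w)).
have mg : measurable_fun [set: W] (fun w => (g (X w))%:E).
  by apply/measurable_EFinP; exact: measurable_discrete.
rewrite WE ge0_integral_bigcup//; first last.
- by move=> i j _ _ [w [wi wj]]; apply: (JT i j) => //; exists (X w).
- by move=> w _; rewrite lee_fin g0.
- by rewrite -WE.
- by move=> k; exact: measurable_slice.
apply: le_trans gb; rewrite /mean le_eqVlt; apply/orP; left; apply/eqP.
rewrite nneseries_esumT; last first.
  by move=> k; apply: integral_ge0 => w _; rewrite lee_fin g0.
rewrite [in RHS]JE esum_bigcup; first last.
- by move=> x; rewrite -JE => Ex; rewrite mule_ge0// lee_fin g0.
- by apply: sub_trivIset JT.
apply: eq_esum => k _; case: (slice_cases setT k ei) => [e0|[x Ex e1]].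
  by rewrite /J e0 preimage_set0 integral_set0 esum_set0.
rewrite /J e1 esum_set1 ?mule_ge0 ?lee_fin ?g0//.
rewrite (eq_integral (cst (g x)%:E)); last by move=> w; rewrite inE => ->.
by rewrite (integral_cst _ (measurable_point Ex)) muleC.
Qed.

Lemma expectation_near h c b : mean_le E law (fun x => `|h x - c|) b ->
  ('E_P[h \o X])%E \is a fin_num /\ `|fine ('E_P[h \o X])%E - c| <= b.
Proof.
move=> hb; have := integral_le_mean hb.
pose Y w := h (X w) - c => Yb.
have mY : measurable_fun setT Y by exact: (@measurable_discrete _ _ (fun x => h x - c)).
have iY : P.-integrable setT (EFin \o Y).
  apply/integrableP; split; first exact/measurable_EFinP.
  by apply: le_lt_trans Yb _; exact: ltry.
have ic : P.-integrable setT (EFin \o cst c).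
  apply/integrableP; split; first exact/measurable_EFinP.
  rewrite (eq_integral (cst `|c|%:E))//.
  by rewrite (integral_cst P measurableT) [X in (_ * X)%E]probability_setT mule1 ltry.
have -> : ('E_P[h \o X] = \int[P]_w (EFin \o Y) w + c%:E)%E.
  rewrite unlock; transitivity (\int[P]_w ((EFin \o Y) w + (EFin \o cst c) w))%E.
    by apply: eq_integral => w _ /=; rewrite -EFinD /Y subrK.
  rewrite integralD//; congr (_ + _)%E.
  by rewrite (integral_cst P measurableT c%:E) [X in (_ * X)%E]probability_setT mule1.
have fY : (\int[P]_w (EFin \o Y) w)%E \is a fin_num by exact: integrable_fin_num.
rewrite fin_numD fY; split=> //; rewrite fineD//= addrK.
rewrite -lee_fin -abse_EFin ?fineK//.
apply: le_trans Yb; apply: (le_trans (le_abse_integral _ measurableT _)) => //.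
exact/measurable_EFinP.
Qed.

End discrete_expectation.

(** * Functions whose stationary mean tends to zero *)

Section vanishing.
Variables (R : realType) (S : choiceType) (E : nat -> set S).
Variables (rate : nat -> S -> S -> R) (p : nat -> S -> \bar R).
Hypothesis st : \forall n \near \oo, stationary_distribution (E n) (rate n) (p n).

Definition vanishing (g : nat -> S -> R) : Prop :=
  forall e : R, 0 < e -> \forall n \near \oo, mean_le (E n) (p n) (g n) e.

Lemma vanishing_le g h :
  (\forall n \near \oo, forall x, E n x -> 0 <= g n x <= h n x) ->
  vanishing h -> vanishing g.
Proof.
move=> gh hv e e0; have he := hv e e0; near=> n.
apply: (mean_le_mono (near st n _) _ (lexx e)) => //; last exact: (near he n).
exact: (near gh n).
Unshelve. all: by end_near. Qed.

Lemma vanishingD g h : vanishing g -> vanishing h ->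
  vanishing (fun n x => g n x + h n x).
Proof.
move=> gv hv e e0; have e2 : 0 < e / 2 by exact: divr_gt0.
have ge := gv _ e2; have he := hv _ e2; near=> n.
rewrite (splitr e); apply: (mean_leD (near st n _)) => //.
  exact: (near ge n).
exact: (near he n).
Unshelve. all: by end_near. Qed.

Lemma vanishingZ (c : R) g : 0 <= c -> vanishing g ->
  vanishing (fun n x => c * g n x).
Proof.
move=> c0 gv e e0; have c1 : 0 < c + 1 by rewrite ltr_wpDl.
have ge := gv _ (divr_gt0 e0 c1); near=> n.
have stn : stationary_distribution (E n) (rate n) (p n) by near: n.
have gn : mean_le (E n) (p n) (g n) (e / (c + 1)) by near: n.
apply: (mean_le_mono stn _ _ (mean_leZ stn c0 gn)).
  by move=> x Ex; rewrite lexx andbT mulr_ge0//; case: gn => + _; apply.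
by rewrite mulrCA ler_piMr ?ltW// ltr_pdivrMr// mul1r ltrDl.
Unshelve. all: by end_near. Qed.

Lemma vanishing_bound g (b : nat -> R) : b n @[n --> \oo] --> 0 ->
  (\forall n \near \oo, mean_le (E n) (p n) (g n) (b n)) -> vanishing g.
Proof.
move=> b0 gb e e0; have be : \forall n \near \oo, b n <= e.
  have /cvgrPdist_le/(_ _ e0) := b0; apply: filterS => n; rewrite sub0r normrN.
  exact: le_trans (ler_norm _).
near=> n; have stn : stationary_distribution (E n) (rate n) (p n) by near: n.
have gn : mean_le (E n) (p n) (g n) (b n) by near: n.
apply: (mean_le_mono stn _ _ gn); last by near: n.
by move=> x Ex; rewrite lexx andbT; case: gn => + _; apply.
Unshelve. all: by end_near. Qed.

(* AM-GM: [g <= (g^2 / e + e) / 2]. *)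
Lemma vanishing_sqr g : (\forall n \near \oo, forall x, E n x -> 0 <= g n x) ->
  vanishing (fun n x => g n x ^+ 2) -> vanishing g.
Proof.
move=> g0 gv e e0; have ge := gv _ (mulr_gt0 e0 e0); near=> n.
have stn : stationary_distribution (E n) (rate n) (p n) by near: n.
have gn : mean_le (E n) (p n) (fun x => g n x ^+ 2) (e * e) by near: n.
have ei : 0 <= (2 * e)^-1 by rewrite invr_ge0 mulr_ge0// ltW.
have := mean_leD stn (mean_leZ stn ei gn)
  (mean_le_cst stn (ltW (divr_gt0 e0 (ltr0n R 2)))).
have -> : (2 * e)^-1 * (e * e) + e / 2 = e by field; rewrite gt_eqF.
apply: (mean_le_mono stn) => // x Ex.
rewrite (_ : _ <= _)/=; last by have h := near g0 n; apply: h.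
have -> : (2 * e)^-1 * g n x ^+ 2 + e / 2 = ((g n x - e) ^+ 2) / (2 * e) + g n x.
  by field; rewrite gt_eqF.
by rewrite lerDr divr_ge0 ?sqr_ge0// mulr_ge0// ltW.
Unshelve. all: by end_near. Qed.

End vanishing.

Section stationary_limits.
Variables (R : realType) (S : topologicalType) (E : nat -> set S).
Variables (rate : nat -> S -> S -> R).
Variables (d : nat -> measure_display) (W : forall n, measurableType (d n)).
Variables (P : forall n, probability (W n) R) (X : forall n, W n -> S).
Local Notation law := (fun n x => P n (@X n @^-1` [set x])).
Hypothesis XE : \forall n \near \oo,
  has_stationary_distribution (P n) (E n) (rate n) (@X n).
Hypothesis countable_E : \forall n \near \oo, countable (E n).
Hypothesis closed_E : forall x : S, closed [set x].

Let st : \forall n \near \oo, stationary_distribution (E n) (rate n) (law n).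
Proof. by apply: filterS XE => n []. Qed.

Lemma expectation_cvg (h : S -> R) c :
  vanishing E law (fun n x => `|h x - c|) ->
  ('E_(P n)[h \o @X n])%E @[n --> \oo] --> c%:E.
Proof.
move=> hv; apply/fine_cvgP; split.
  have h1 := hv 1 ltr01; near=> n.
  have XEn : random_element (E n) (@X n) by have [] := near XE n _.
  have cn : countable (E n) by near: n.
  have hn : mean_le (E n) (law n) (fun x => `|h x - c|) 1 by near: n.
  by have [] := expectation_near XEn cn (fun x _ => @closed_E x) hn.
apply/cvgrPdist_le => e e0; have he := hv e e0; near=> n.
have XEn : random_element (E n) (@X n) by have [] := near XE n _.
have cn : countable (E n) by near: n.
have hn : mean_le (E n) (law n) (fun x => `|h x - c|) e by near: n.
rewrite distrC /=.
by have [] := expectation_near XEn cn (fun x _ => @closed_E x) hn.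
Unshelve. all: by end_near. Qed.

(** Where [G < del] the test function is within [e / 2] of its value at [x0]; elsewhere
    [2 M <= 2 M G / del], which has small mean. [G] plays the role of a distance, so that pairs of
    an occupancy and a rank are treated through their topology alone. *)
Lemma weak_cvg (G : S -> R) (x0 : S) : (forall x, 0 <= G x) ->
  (forall U, nbhs x0 U -> exists2 e, 0 < e & forall x, G x < e -> U x) ->
  vanishing E law (fun=> G) -> converges_weakly P X x0.
Proof.
move=> G0 Gloc Gv f cf [M fM]; apply: expectation_cvg => e e0.
have M0 : 0 <= M by apply: le_trans (fM x0).
have [del del0 Hdel] : exists2 del, 0 < del &
    forall x, G x < del -> `|f x - f x0| <= e / 2.
  have /cvgrPdist_le/(_ _ (divr_gt0 e0 (ltr0n R 2))) := cf x0.
  move=> /Gloc[del del0 H]; exists del => // x Gx.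
  by rewrite distrC; exact: H.
have c0 : 0 <= 2 * M / del by rewrite divr_ge0 ?mulr_ge0// ltW.
have /(_ (e / 2)) Gd := vanishingZ st c0 Gv; have Ge := Gd (divr_gt0 e0 (ltr0n R 2)).
near=> n; have stn : stationary_distribution (E n) (rate n) (law n) by near: n.
have Gn : mean_le (E n) (law n) (fun x => 2 * M / del * G x) (e / 2) by near: n.
have := mean_leD stn Gn (mean_le_cst stn (ltW (divr_gt0 e0 (ltr0n R 2)))).
apply: (mean_le_mono stn) => [x Ex|]; last by rewrite -splitr.
rewrite normr_ge0/=; case: (ltP (G x) del) => Gx.
  by apply: (le_trans (Hdel x Gx)); rewrite lerDr mulr_ge0.
apply: (@le_trans _ _ (2 * M)).
  apply: (le_trans (ler_normB _ _)); have := fM x; have := fM x0; lra.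
apply: (@le_trans _ _ (2 * M / del * G x)); last first.
  by rewrite lerDl divr_ge0// ltW.
by rewrite -mulrA ler_peMr ?mulr_ge0// mulrC ler_pdivlMr// mul1r.
Unshelve. all: by end_near. Qed.

End stationary_limits.

(** * The limit point *)

Section finite_support.
Variables (R : realType) (I : choiceType).

Lemma esum_seq_supp (s : seq I) (F : I -> \bar R) : uniq s ->
  (forall i, (0 <= F i)%E) -> (forall i, i \notin s -> F i = 0%E) ->
  (\esum_(i in [set: I]) F i = \sum_(i <- s) F i)%E.
Proof.
move=> us F0 Fs; rewrite (esumID [set` s])// setTI setTI.
rewrite [X in (_ + X)%E]esum1 ?adde0; last by move=> i /= /negP; exact: Fs.
by rewrite esum_fset//; rewrite -fsbig_seq.
Qed.

Lemma l1_ofE (s : seq I) (f : I -> R) : uniq s ->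
  (forall i, i \notin s -> f i = 0) -> l1_of f = f :> (I -> R).
Proof.
move=> us fs; rewrite /l1_of insubdK//; apply/l1_predP.
rewrite /summable (esum_seq_supp us); last by move=> i /fs /= ->; rewrite normr0.
  by rewrite (eq_bigr (fun i => `|f i|%:E))// sumEFin ltry.
by move=> i; exact: abse_ge0.
Qed.

Lemma l1_norm_seq (s : seq I) (f : l1 R I) : uniq s ->
  (forall i, i \notin s -> f i = 0) -> `|f| = \sum_(i <- s) `|f i|.
Proof.
move=> us fs; apply: EFin_inj; rewrite -[`|f|]/(l1_norm f) l1_norm_fin.
rewrite (esum_seq_supp us); last by move=> i /fs /= ->; rewrite normr0.
  by rewrite (eq_bigr (fun i => `|f i|%:E))// sumEFin.
by move=> i; exact: abse_ge0.
Qed.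

End finite_support.

Section state_space.
Variables (R : realType) (m : nat).
Local Notation coord := (Defs.coord m).
Local Notation occ := (occ R m).

Definition full_box J : seq coord := [seq (i, 0%N) | i <- enum 'I_m.+1] ++ box m J.

Lemma mem_full_box J p : (p \in full_box J) = (p.2 <= J)%N.
Proof.
rewrite mem_cat mem_box; case: p => i [|j] /=.
  by rewrite map_f// mem_enum.
case: (j < J)%N; rewrite ?orbT// orbF.
by apply/negP => /mapP[k _].
Qed.

Lemma full_box_uniq J : uniq (full_box J).
Proof.
rewrite cat_uniq box_uniq andbT map_inj_uniq ?enum_uniq; last by move=> i j [].
apply/hasPn => p /box_Iplus Ip; apply/negP => /mapP[i _ e].
by move: Ip; rewrite e.
Qed.

Lemma sum_full_box J (F : coord -> R) : \sum_(p <- full_box J) F p =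
  \sum_(i < m.+1) F (i, 0%N) + \sum_(p <- box m J) F p.
Proof. by rewrite big_cat big_map big_enum. Qed.

Lemma l1_sumE (T : Type) (s : seq T) (f : T -> occ) p :
  (\sum_(x <- s) f x) p = \sum_(x <- s) f x p.
Proof. by elim/big_rec2: _ => // x y z _ <-. Qed.

(** A state is determined by the integers [n q p] at its finitely many nonzero coordinates, hence is
    the image of a finite list. *)
Lemma countable_Qn n a : (0 < n)%N -> countable (@Qn R m n a).
Proof.
move=> n0.
pose g (s : seq (coord * nat)) : occ :=
  \sum_(x <- s) (x.2%:R / n%:R) *: l1_unit R x.1.
have nR : n%:R != 0 :> R by rewrite pnatr_eq0 -lt0n.
apply: (@sub_countable _ _ _ (range g)); last first.
  apply: (sub_countable (card_image_le g setT)); exact: countableP.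
apply: subset_card_le => q Qq.
pose k p := Num.truncn (n%:R * q p).
exists [seq (p, k p) | p <- full_box (height q)] => //.
apply: occ_ext => p; rewrite /g l1_sumE big_map /=.
rewrite (eq_bigr (fun p' => q p' * (p' == p)%:R)); last first.
  move=> p' _; have [j e] := Qn_nat Qq p'.
  rewrite -[LHS]/(_ / n%:R * (p == p')%:R) /k e natrK -e [n%:R * _]mulrC mulfK//.
  by rewrite eq_sym.
have [pb|npb] := boolP (p \in full_box (height q)).
  rewrite (bigD1_seq p) ?full_box_uniq//= eqxx mulr1 big1 ?addr0// => p' /negbTE ->.
  by rewrite mulr0.
rewrite big_seq big1; last first.
  move=> p' p'b; case: eqVneq => [e|]; last by rewrite mulr0.
  by rewrite -e p'b in npb.
move: npb; rewrite mem_full_box -ltnNge; case: p => i j /= hj.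
by rewrite (heightP n0 Qq)// ltnW.
Qed.

Lemma closed_occ (q : occ) : closed [set q].
Proof. by apply: accessible_closed_set1; apply: hausdorff_accessible; exact: norm_hausdorff. Qed.

Lemma closed_occ_nat (x : (occ * nat)%type) : closed [set x].
Proof.
have -> : [set x] = fst @^-1` [set x.1] `&` snd @^-1` [set x.2].
  apply/seteqP; split=> [_ ->//|[q r] /= [-> ->]]; by case: x.
apply: closedI.
  apply: preimage_closed; last exact: closed_occ.
  by move=> y _; exact: cvg_fst.
apply: preimage_closed; last exact: discrete_closed.
by move=> y _; exact: cvg_snd.
Qed.

End state_space.

Lemma exists_lower_bound (R : realDomainType) (I : finType) (f : I -> R) :
  (forall i, 0 < f i) -> exists2 c, 0 < c & forall i, c <= f i.
Proof.
move=> f0; exists (\big[Num.min/1]_i f i) => [|i]; last exact: bigmin_le_cond.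
exact: lt_bigmin.
Qed.

(** * The threshold element and the coordinates of the limit point *)

Section thresholds.
Variables (R : realType) (m : nat) (u : 'I_m.+1 -> R -> R).
Hypothesis u_concave : concave_utilities u.
Local Notation coord := (Defs.coord m).
Local Notation occ := (occ R m).
Local Notation top := (top_coords u).
Local Notation kth := (kth u).
Variables (a : 'I_m.+1 -> R) (rho : R).
Hypotheses (a0 : forall i, 0 < a i) (rho0 : 0 <= rho).

Lemma load_above_kth r : (0 < r)%N -> load_above u a (kth r) = (capacity a (top r))%:E.
Proof.
move=> r0; rewrite /load_above; have -> : [set p | Iplus p /\ prec u (kth r) p] = [set` top r].
  apply/seteqP; split=> p /=.
    by move=> [Ip]; rewrite -mem_top_coords.
  by move=> pt; have Ip := top_coords_Iplus u_concave pt; rewrite -mem_top_coords.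
rewrite esum_fset//; last by move=> p _; rewrite lee_fin ltW.
by rewrite -fsbig_seq ?top_coords_uniq// /capacity sumEFin.
Qed.

Lemma load_from_kth r : (0 < r)%N ->
  load_from u a (kth r) = (capacity a (top r.+1))%:E.
Proof.
move=> r0; rewrite /load_from.
have -> : [set p | Iplus p /\ preceq u (kth r) p] = [set` top r.+1].
  apply/seteqP; split=> p /=; rewrite top_coordsS// mem_rcons inE /preceq.
    by move=> [Ip]; rewrite eq_sym -mem_top_coords.
  move=> /predU1P[->|pt]; first by rewrite eqxx; split=> //; exact: kth_Iplus.
  have Ip := top_coords_Iplus u_concave pt.
  by rewrite mem_top_coords// in pt; rewrite pt orbT.
rewrite esum_fset//; last by move=> p _; rewrite lee_fin ltW.
by rewrite -fsbig_seq ?top_coords_uniq// /capacity sumEFin.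
Qed.

(** For uniqueness: if [s] differs from [kth r], everything at or above the larger of the two is
    strictly above the smaller, which contradicts one of the two bounds on [rho]. *)
Lemma threshold_kth r : (0 < r)%N ->
  capacity a (top r) <= rho < capacity a (top r.+1) ->
  threshold u a rho = kth r /\ threshold_rank u a rho = r.
Proof.
move=> r0 hr; have th : threshold u a rho = kth r.
  apply: xget_unique.
    split; first exact: kth_Iplus.
    by rewrite load_above_kth// load_from_kth// lee_fin lte_fin.
  move=> s [Is /andP[h1 h2]]; apply/eqP/negPn/negP => ne; case/andP: hr => r1 r2.
  have /orP[sk|ks] := prec_total u ne.
    have : (load_from u a (kth r) <= load_above u a s)%E.
      rewrite /load_from /load_above esum_mkcond [leRHS]esum_mkcond.
      apply: le_esum => p _; case: ifPn => [/set_mem[Ip kp]|_].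
        rewrite mem_set//; split=> //.
        by case/predU1P: kp => [<-//|]; exact: prec_trans.
      by case: ifP => // _; rewrite lee_fin ltW.
    rewrite load_from_kth// => /le_trans/(_ h1).
    by rewrite lee_fin leNgt r2.
  have : (load_from u a s <= load_above u a (kth r))%E.
    rewrite /load_from /load_above esum_mkcond [leRHS]esum_mkcond.
    apply: le_esum => p _; case: ifPn => [/set_mem[Ip kp]|_].
      rewrite mem_set//; split=> //.
      by case/predU1P: kp => [<-//|]; exact: prec_trans.
    by case: ifP => // _; rewrite lee_fin ltW.
  move=> /(lt_le_trans h2); rewrite load_above_kth// lte_fin.
  by rewrite ltNge r1.
split=> //; apply: xget_unique => /=; first by rewrite th.
by move=> k [k0]; rewrite th => /(kth_inj u_concave k0 r0).
Qed.

(** Each rank adds at least the smallest supply, so the capacities are unbounded; take the first one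
    that exceeds [rho]. *)
Lemma exists_threshold : exists2 r, (0 < r)%N &
  capacity a (top r) <= rho < capacity a (top r.+1).
Proof.
have [amin am0 am] := exists_lower_bound a0.
have grow k : k%:R * amin <= capacity a (top k.+1).
  elim: k => [|k IH]; first by rewrite mul0r sumr_ge0// => p _; exact: ltW.
  by rewrite capacityS// -natr1 mulrDl mul1r lerD.
pose P k := rho < capacity a (top k.+1).
have exP : exists k, P k.
  exists (Num.truncn (rho / amin)).+1; apply: lt_le_trans (grow _).
  by rewrite -ltr_pdivrMr// truncnS_gt.
case: (ex_minnP exP) => k Pk kmin.
case: k Pk kmin => [|k] Pk kmin.
  by exfalso; move: Pk; rewrite /P /capacity big_nil ltNge rho0.
exists k.+1 => //; apply/andP; split=> //; rewrite leNgt; apply/negP => h.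
by have := kmin k h; rewrite ltnn.
Qed.

Variable r : nat.
Hypotheses (r0 : (0 < r)%N).
Hypothesis rP : capacity a (top r) <= rho < capacity a (top r.+1).

(** The defining family has finite support, so [l1_of] does not fall back on its default. *)
Lemma qstarE p : qstar u a rho p =
  if p.2 == 0%N then a p.1 else if p \in top r then a p.1
  else if p == kth r then rho - capacity a (top r) else 0.
Proof.
have [th _] := threshold_kth r0 rP; rewrite /qstar th.
set f := fun p => _.
have fE p' : f p' = if p'.2 == 0%N then a p'.1 else if p' \in top r then a p'.1
    else if p' == kth r then rho - capacity a (top r) else 0.
  rewrite /f; case: eqP => // /eqP; rewrite -lt0n => Ip.
  rewrite mem_top_coords//; case: (boolP (prec u p' (kth r))) => h1.
    rewrite (prec_asym h1); case: eqP => // e.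
    by move: h1; rewrite e prec_irr.
  case: (boolP (prec u (kth r) p')) => h2 //.
  have [_|ne] := eqVneq p' (kth r); first by rewrite load_above_kth.
  by have := prec_total u ne; rewrite (negbTE h1) (negbTE h2).
pose J := \max_(p <- top r.+1) p.2.
rewrite (@l1_ofE _ _ (full_box m J))//; first exact: full_box_uniq.
move=> p'; rewrite mem_full_box -ltnNge => hJ; rewrite fE.
case: eqP => [e|_]; first by move: hJ; rewrite e.
have npt : p' \notin top r.+1.
  apply/negP => pt; move: hJ; rewrite ltnNge.
  by rewrite (@leq_bigmax_seq _ (top r.+1) predT (fun p : coord => p.2) _ pt erefl).
move: npt; rewrite top_coordsS// mem_rcons inE negb_or => /andP[/negbTE -> /negbTE ->].
by [].
Qed.

End thresholds.

Lemma sum_sub_split (R : nmodType) (T : eqType) (s t : seq T) (F : T -> R) :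
  uniq s -> uniq t -> {subset s <= t} ->
  \sum_(x <- t) F x = \sum_(x <- s) F x + \sum_(x <- t | x \notin s) F x.
Proof.
move=> us ut st; rewrite (bigID (mem s))/=; congr (_ + _).
rewrite -big_filter; apply: perm_big; apply: uniq_perm => //.
  exact: filter_uniq.
move=> x; rewrite mem_filter; case: (boolP (x \in s)) => //= xs.
exact: st.
Qed.

(** * Distance to the limit point *)

Section limit_distance.
Variables (R : realType) (m : nat) (u : 'I_m.+1 -> R -> R).
Hypothesis u_concave : concave_utilities u.
Local Notation coord := (Defs.coord m).
Local Notation occ := (occ R m).
Local Notation top := (top_coords u).
Local Notation kth := (kth u).
Variables (alpha : 'I_m.+1 -> R) (rho : R) (r : nat).
Hypotheses (alpha0 : forall i, 0 < alpha i) (rho0 : 0 <= rho) (r0 : (0 < r)%N).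
Hypothesis rP : capacity alpha (top r) <= rho < capacity alpha (top r.+1).

Definition supply_gap (a : 'I_m.+1 -> R) : R := \sum_(i < m.+1) `|a i - alpha i|.

Lemma supply_gap_ge0 a : 0 <= supply_gap a.
Proof. by apply: sumr_ge0. Qed.

Lemma supply_gap_ge a i : `|a i - alpha i| <= supply_gap a.
Proof. by rewrite /supply_gap (bigD1 i)//= lerDl sumr_ge0. Qed.

Lemma sum_gap_le a (s : seq coord) :
  \sum_(p <- s) `|a p.1 - alpha p.1| <= (size s)%:R * supply_gap a.
Proof.
elim: s => [|p s IH]; first by rewrite big_nil mul0r.
by rewrite big_cons /= -natr1 mulrDl mul1r addrC lerD ?supply_gap_ge.
Qed.

Lemma capacity_gap a s : `|capacity a s - capacity alpha s| <= (size s)%:R * supply_gap a.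
Proof.
rewrite /capacity -sumrB; apply: le_trans (sum_gap_le a s).
exact: ler_norm_sum.
Qed.

Lemma size_top k : size (top k) = k.-1.
Proof. by rewrite size_map size_iota. Qed.

(** Level 0 costs the supply gap, [top r] its vacancies, the coordinates outside [top r.+1] their
    tasks. The coordinate [kth r] is recovered from the total mass, through which the term in [rho]
    arises. The assumptions on [q] are weaker than [Qn], so that [q] may also be [qstar u a rho]. *)
Lemma qstar_dist (a : 'I_m.+1 -> R) (q : occ) J :
  {subset top r.+1 <= box m J} ->
  (forall i j, (J <= j)%N -> q (i, j.+1) = 0) ->
  (forall i, q (i, 0%N) = a i) -> (forall p, 0 <= q p <= a p.1) ->
  `|q - qstar u alpha rho| <= (1 + 2 * r%:R) * supply_gap a +
    2 * (capacity a (top r) - \sum_(p <- top r) q p) +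
    `|\sum_(p <- box m J) q p - rho| +
    2 * (\sum_(p <- box m J) q p - \sum_(p <- top r.+1) q p).
Proof.
move=> topJ hJ q0 qa; set U := \sum_(p <- box m J) q p.
have qs := qstarE u_concave alpha0 r0 rP.
have ut k := top_coords_uniq u_concave k.
have diffE p : (q - qstar u alpha rho) p = q p - qstar u alpha rho p by [].
have qs0 p : p.2 != 0%N -> p \notin top r.+1 -> qstar u alpha rho p = 0.
  move=> p2; rewrite top_coordsS// mem_rcons inE negb_or => /andP[p3 p4].
  by rewrite qs (negbTE p2) (negbTE p3) (negbTE p4).
rewrite (@l1_norm_seq _ _ (full_box m J)) ?full_box_uniq//; last first.
  move=> p; rewrite mem_full_box -ltnNge => Jp.
  have p2 : p.2 != 0%N by case: (p.2) Jp.
  rewrite diffE qs0//; last first.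
    by apply/negP => /topJ; rewrite mem_box => /andP[_]; rewrite leqNgt Jp.
  by rewrite subr0; case: p Jp {p2} => i [//|j] /= Jj; apply: hJ.
rewrite sum_full_box.
have -> : \sum_(i < m.+1) `|(q - qstar u alpha rho) (i, 0%N)| = supply_gap a.
  by apply: eq_bigr => i _; rewrite diffE qs /= q0.
rewrite (sum_sub_split _ (ut r.+1) (box_uniq m J) topJ).
have -> : \sum_(p <- box m J | p \notin top r.+1) `|(q - qstar u alpha rho) p| =
    U - \sum_(p <- top r.+1) q p.
  rewrite /U (sum_sub_split _ (ut r.+1) (box_uniq m J) topJ) addrAC subrr add0r.
  rewrite big_seq_cond [RHS]big_seq_cond; apply: eq_bigr => p /andP[pb pt].
  rewrite diffE qs0// ?subr0 ?ger0_norm//; first by case/andP: (qa p).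
  by rewrite -lt0n; exact: box_Iplus pb.
set W := U - _.
have W0 : 0 <= W.
  rewrite subr_ge0; apply: ler_sum_sub => // p; by case/andP: (qa p).
pose D := capacity a (top r) - \sum_(p <- top r) q p.
rewrite -/D.
have topS (F : coord -> R) :
    \sum_(p <- top r.+1) F p = \sum_(p <- top r) F p + F (kth r).
  by rewrite top_coordsS// -cats1 big_cat big_seq1.
have kI : (kth r).2 == 0%N = false.
  by apply/negbTE; rewrite -lt0n; exact: kth_Iplus.
have e1 : \sum_(p <- top r) `|(q - qstar u alpha rho) p| <= r%:R * supply_gap a + D.
  apply: (@le_trans _ _ (\sum_(p <- top r) (`|a p.1 - alpha p.1| + (a p.1 - q p)))).
    rewrite big_seq [leRHS]big_seq; apply: ler_sum => p pt.
    have := top_coords_Iplus u_concave pt; rewrite /Iplus/= lt0n => /negbTE p2.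
    change (`|q p - qstar u alpha rho p| <= `|a p.1 - alpha p.1| + (a p.1 - q p)).
    have -> : q p - qstar u alpha rho p = (a p.1 - alpha p.1) - (a p.1 - q p).
      by rewrite qs p2 pt; ring.
    have ap : 0 <= a p.1 - q p by rewrite subr_ge0; case/andP: (qa p).
    by rewrite -[in leRHS](ger0_norm ap); exact: ler_normB.
  rewrite big_split/= lerD//; last by rewrite sumrB.
  apply: (le_trans (sum_gap_le _ _)); rewrite ler_wpM2r ?supply_gap_ge0//.
  by rewrite ler_nat size_top leq_pred.
have e2 : `|(q - qstar u alpha rho) (kth r)| <=
    `|U - rho| + W + D + r%:R * supply_gap a.
  have kn := negbTE (kth_notin u_concave r0).
  have hq : q (kth r) = U - W - \sum_(p <- top r) q p.
    by rewrite /W topS; ring.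
  have D0 : 0 <= D.
    rewrite subr_ge0; apply: ler_sum => p _; by case/andP: (qa p).
  have gap := capacity_gap a (top r).
  have gap2 : `|capacity a (top r) - capacity alpha (top r)| <= r%:R * supply_gap a.
    apply: (le_trans gap); rewrite ler_wpM2r ?supply_gap_ge0//.
    by rewrite ler_nat size_top leq_pred.
  change (`|q (kth r) - qstar u alpha rho (kth r)| <=
    `|U - rho| + W + D + r%:R * supply_gap a).
  rewrite qs kI kn eqxx hq; move: gap2; rewrite /D in D0 *.
  set s1 := \sum_(p <- top r) q p in D0 *.
  rewrite !ler_norml => /andP[g1 g2].
  have n1 := ler_norm (U - rho); have n2 := ler_norm (- (U - rho)).
  rewrite normrN in n2; 
  by apply/andP; split; lra.
rewrite topS; lra.
Qed.

Lemma qstar_dist_Qn n (a : 'I_m.+1 -> R) (q : occ) : (0 < n)%N -> Qn n a q ->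
  `|q - qstar u alpha rho| <= (1 + 2 * r%:R) * supply_gap a +
    2 * (n%:R^-1 * deficit n a (top r) q) + `|tasks q - rho| +
    2 * (tasks q - \sum_(p <- top r.+1) q p).
Proof.
move=> n0 Qq; pose J := maxn (height q) (\max_(p <- top r.+1) p.2).
have hJ i j : (J <= j)%N -> q (i, j.+1) = 0.
  move=> h; apply: (heightP n0 Qq); apply: leqW; apply: leq_trans h.
  exact: leq_maxl.
have topJ : {subset top r.+1 <= box m J}.
  move=> p pt; rewrite mem_box (top_coords_Iplus u_concave pt)/=.
  apply: leq_trans (leq_maxr _ _).
  exact: (@leq_bigmax_seq _ (top r.+1) predT (fun p : coord => p.2) _ pt erefl).
have := qstar_dist topJ hJ (Qn_0 Qq).
rewrite -[\sum_(p <- box m J) q p](class_tasksE n0 Qq predT hJ).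
rewrite /deficit mulKf ?pnatr_eq0 -?lt0n// => h; apply: h => p.
by rewrite (Qn_ge0 n0 Qq) (Qn_le_a Qq).
Qed.

(* The threshold rank for the supplies [a] is at most [r]. *)
Lemma qstar_qstar_dist (a : 'I_m.+1 -> R) : (forall i, 0 < a i) ->
  rho < capacity a (top r.+1) ->
  `|qstar u a rho - qstar u alpha rho| <= (1 + 4 * r%:R) * supply_gap a.
Proof.
move=> a0 ra; have [k k0 kP] := exists_threshold u a0 rho0.
have kr : (k <= r)%N.
  rewrite leqNgt; apply/negP => rk; case/andP: kP => h _.
  have := le_trans (capacity_le u_concave a0 rk) h.
  by rewrite leNgt ra.
have qa := qstarE u_concave a0 k0 kP.
have ut k := top_coords_uniq u_concave k.
pose J := \max_(p <- top r.+1) p.2.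
have topJ : {subset top r.+1 <= box m J}.
  move=> p pt; rewrite mem_box (top_coords_Iplus u_concave pt)/=.
  exact: (@leq_bigmax_seq _ (top r.+1) predT (fun p : coord => p.2) _ pt erefl).
have zero p : p.2 != 0%N -> p \notin top k.+1 -> qstar u a rho p = 0.
  move=> p2; rewrite top_coordsS// mem_rcons inE negb_or => /andP[p3 p4].
  by rewrite qa (negbTE p2) (negbTE p3) (negbTE p4).
have sub : {subset top k.+1 <= top r.+1} by exact: top_coords_sub.
have sumk : \sum_(p <- top k.+1) qstar u a rho p = rho.
  rewrite top_coordsS// -cats1 big_cat big_seq1 qa.
  have -> : (kth k).2 == 0%N = false.
    by apply/negbTE; rewrite -lt0n; exact: kth_Iplus.
  rewrite (negbTE (kth_notin u_concave k0)) eqxx.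
  have -> : \sum_(p <- top k) qstar u a rho p = capacity a (top k).
    apply: eq_big_seq => p pt; rewrite qa pt.
    by have := top_coords_Iplus u_concave pt; rewrite /Iplus/= lt0n => /negbTE ->.
  by rewrite /=; ring.
have sumr s : uniq s -> (forall p, p \in s -> Iplus p) -> {subset top k.+1 <= s} ->
    \sum_(p <- s) qstar u a rho p = rho.
  move=> us sI ks; rewrite (sum_sub_split _ (ut k.+1) us ks) sumk.
  rewrite big_seq_cond big1 ?addr0// => p /andP[ps pk]; apply: zero => //.
  by rewrite -lt0n; exact: sI.
have Ur : \sum_(p <- box m J) qstar u a rho p = rho.
  apply: sumr; [exact: box_uniq | by move=> p /box_Iplus |].
  by move=> p /sub; exact: topJ.
have Tr : \sum_(p <- top r.+1) qstar u a rho p = rho.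
  by apply: sumr => // p; exact: top_coords_Iplus.
have := qstar_dist (a := a) (q := qstar u a rho) topJ.
rewrite Ur Tr !subrr normr0 mulr0 !addr0 => h.
have D : capacity a (top r) - \sum_(p <- top r) qstar u a rho p <= r%:R * supply_gap a.
  have rg : 0 <= r%:R * supply_gap a by rewrite mulr_ge0 ?supply_gap_ge0.
  move: kr; rewrite leq_eqVlt => /predU1P[<-|kr].
    rewrite (_ : \sum_(p <- top k) _ = capacity a (top k)) ?subrr ?mulr_ge0 ?supply_gap_ge0//.
    apply: eq_big_seq => p pt; rewrite qa pt.
    by have := top_coords_Iplus u_concave pt; rewrite /Iplus/= lt0n => /negbTE ->.
  (* When [k < r], the whole mass [rho] of [qstar u a rho] lies in [top r], and [rho] is at least
     the limiting capacity of [top r]. *)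
  rewrite sumr//; last 2 first.
  - by move=> p; exact: top_coords_Iplus.
  - exact: top_coords_sub.
  have := capacity_gap a (top r); rewrite size_top => g.
  apply: (@le_trans _ _ (capacity a (top r) - capacity alpha (top r))).
    by rewrite lerD2l lerN2; case/andP: rP.
  apply: (le_trans (ler_norm _)); apply: (le_trans g).
  by rewrite ler_wpM2r ?supply_gap_ge0// ler_nat leq_pred.
apply: (le_trans (h _ _ _)).
- move=> i j Jj; apply: zero => //; apply/negP => /sub/topJ.
  by rewrite mem_box /= ltnNge Jj.
- by move=> i; rewrite qa.
- move=> p; rewrite qa; case: ifP => _; first by rewrite lexx ltW.
  case: ifP => _; first by rewrite lexx ltW.
  case: eqP => [->|_]; last by rewrite lexx ltW.
  case/andP: kP => h1 h2; rewrite subr_ge0 h1 lerBlDr addrC ltW//.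
  by move: h2; rewrite capacityS.
- have := supply_gap_ge0 a; move: D; set g := supply_gap a; nra.
Qed.

End limit_distance.

(** * Utilities *)

Section utility.
Variables (R : realType) (m : nat) (u : 'I_m.+1 -> R -> R).
Local Notation coord := (Defs.coord m).
Local Notation occ := (occ R m).

(* Summation by parts: a pool with [k] tasks contributes [u i 0] and the
   marginal utilities of its first [k] tasks. *)
Lemma utilityE (q : occ) J : (forall i j, (J <= j)%N -> q (i, j.+1) = 0) ->
  utility u q = \sum_(i < m.+1) u i 0 * q (i, 0%N) +
    \sum_(p <- box m J) Delta u p.1 p.2.-1 * q p.
Proof.
move=> hJ; rewrite big_box -big_split; apply: eq_bigr => i _ /=.
apply: lim_near_cst => //; near=> M.
have JM : (J < M)%N by near: M; exact: nbhs_infty_gt.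
have parts K : \sum_(0 <= j < K) u i j%:R * (q (i, j) - q (i, j.+1)) =
    u i 0 * q (i, 0%N) + \sum_(0 <= j < K) Delta u i j * q (i, j.+1) -
    u i K%:R * q (i, K).
  elim: K => [|K IH]; first by rewrite !big_geq// addr0 subrr.
  by rewrite !big_nat_recr//= IH /Delta; ring.
rewrite /series /= parts; have -> : q (i, M) = 0 by case: (M) JM => // M1 JM; exact: hJ.
rewrite mulr0 subr0.
rewrite (big_cat_nat (n := J))//=; last exact: ltnW.
have -> : \sum_(J <= j < M) Delta u i j * q (i, j.+1) = 0.
  by rewrite big_nat big1// => j /andP[Jj _]; rewrite hJ ?mulr0.
by rewrite addr0.
Unshelve. all: by end_near. Qed.

Variable M : R.
Hypothesis uM : forall i j, `|Delta u i j| <= M.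

Definition utility_lip : R := \sum_(i < m.+1) `|u i 0| + M.

Lemma utility_lip_ge0 : 0 <= utility_lip.
Proof. by rewrite addr_ge0 ?sumr_ge0// (le_trans _ (uM ord0 0)). Qed.

Lemma utility_lipschitz (q q' : occ) :
  (exists J, forall i j, (J <= j)%N -> q (i, j.+1) = 0) ->
  (exists J, forall i j, (J <= j)%N -> q' (i, j.+1) = 0) ->
  `|utility u q - utility u q'| <= utility_lip * `|q - q'|.
Proof.
move=> [J1 h1] [J2 h2]; pose J := maxn J1 J2.
have {}h1 i j : (J <= j)%N -> q (i, j.+1) = 0 by rewrite geq_max => /andP[/h1].
have {}h2 i j : (J <= j)%N -> q' (i, j.+1) = 0 by rewrite geq_max => /andP[_ /h2].
rewrite (utilityE h1) (utilityE h2).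
rewrite (@l1_norm_seq _ _ (full_box m J)) ?full_box_uniq//; last first.
  move=> [i [|j]]; rewrite mem_full_box -ltnNge//= => Jj.
  by change (q (i, j.+1) - q' (i, j.+1) = 0); rewrite h1// h2// subrr.
rewrite sum_full_box opprD addrACA -!sumrB.
have M0 : 0 <= M by apply: le_trans (uM ord0 0).
have B0 : 0 <= \sum_(i < m.+1) `|u i 0| by rewrite sumr_ge0.
set B := \sum_(i < m.+1) `|u i 0| in B0 *.
set s1 := \sum_(i < m.+1) `|(q - q') (i, 0%N)|; set s2 := \sum_(p <- _) `|_|.
have s10 : 0 <= s1 by rewrite sumr_ge0.
have s20 : 0 <= s2 by rewrite sumr_ge0.
apply: (@le_trans _ _ (B * s1 + M * s2)); last first.
  by rewrite /utility_lip -/B mulrDr !mulrDl; have := mulr_ge0 B0 s20; have := mulr_ge0 M0 s10; lra.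
apply: (le_trans (ler_normD _ _)); apply: lerD.
  apply: (le_trans (ler_norm_sum _ _ _)); rewrite /s1 mulr_sumr.
  apply: ler_sum => i _; rewrite -mulrBr normrM ler_wpM2r//.
  by rewrite /B (bigD1 i)//= lerDl sumr_ge0.
apply: (le_trans (ler_norm_sum _ _ _)); rewrite /s2 mulr_sumr.
by apply: ler_sum => p _; rewrite -mulrBr normrM ler_wpM2r.
Qed.

(** The norm of [q] is [1 + tasks q] because the supplies add up to 1, and the zero of [l1], to
    which [q] is compared, has utility 0. *)
Lemma utility_bound n a (q : occ) : (0 < n)%N -> \sum_(i < m.+1) a i = 1 ->
  Qn n a q -> `|utility u q| <= utility_lip * (1 + tasks q).
Proof.
move=> n0 a1 Qq; have hq i j : (height q <= j)%N -> q (i, j.+1) = 0.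
  by move=> h; apply: (heightP n0 Qq); exact: leqW.
have := @utility_lipschitz q 0; rewrite subr0 => h.
have -> : 1 + tasks q = `|q|.
  rewrite (@l1_norm_seq _ _ (full_box m (height q))) ?full_box_uniq//; last first.
    by move=> [i [|j]]; rewrite mem_full_box -ltnNge//= => /hq.
  rewrite sum_full_box -a1 -[tasks q](class_tasksE n0 Qq predT hq) /=; congr (_ + _).
    apply: eq_bigr => i _; rewrite ger0_norm ?(Qn_ge0 n0 Qq)//.
    by rewrite (Qn_0 Qq).
  rewrite (class_tasksE n0 Qq predT hq).
  by apply: eq_bigr => p _; rewrite ger0_norm ?(Qn_ge0 n0 Qq).
have u0 : utility u (0 : occ) = 0.
  rewrite (@utilityE 0 0)// big1 ?add0r => [|i _]; last by rewrite mulr0.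
  by rewrite big1_seq// => p _; rewrite mulr0.
by rewrite -[utility u q]subr0 -[in leLHS]u0; apply: h; [exists (height q) | exists 0%N].
Qed.

End utility.

(** * Uniform integrability from second moments *)

Section uniform_integrability.
Variables (R : realType) (S : topologicalType) (N : set nat) (E : nat -> set S).
Variables (rate : nat -> S -> S -> R).
Variables (d : nat -> measure_display) (W : forall n, measurableType (d n)).
Variables (P : forall n, probability (W n) R) (X : forall n, W n -> S).
Local Notation law := (fun n x => P n (@X n @^-1` [set x])).
Hypothesis XE : forall n, N n ->
  has_stationary_distribution (P n) (E n) (rate n) (@X n).
Hypothesis countable_E : forall n, N n -> countable (E n).
Hypothesis closed_E : forall x : S, closed [set x].

(** Where [|h| >= K] one has [|h| <= h^2 / K]. The second moments are bounded for every [n] in [N],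
    not only eventually, so one [K] serves all. *)
Lemma uniformly_integrable_sqr (h : S -> R) V :
  (forall n, N n -> mean_le (E n) (law n) (fun x => h x ^+ 2) V) ->
  uniformly_integrable N P (fun n => h \o @X n).
Proof.
(* [V' + 1] keeps [K] positive even when the bound on the second moments is zero. *)
move=> hV e e0; pose V' := Num.max V 0; pose K := (V' + 1) / e.
have V0 : 0 <= V' by rewrite le_max lexx orbT.
have K0 : 0 < K by rewrite divr_gt0// ltr_pwDr.
exists K => n Nn; have [XEn st] := XE Nn.
pose g x := if K <= `|h x| then `|h x| else 0.
have gK : mean_le (E n) (law n) g (K^-1 * V).
  have Ki : 0 <= K^-1 by rewrite invr_ge0 ltW.
  apply: (mean_le_mono st _ (lexx _) (mean_leZ st Ki (hV n Nn))) => x _.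
  rewrite /g; case: ifP => Kh; last by rewrite lexx mulr_ge0// sqr_ge0.
  rewrite normr_ge0/= mulrC ler_pdivlMr// -[leRHS]real_normK ?num_real// expr2.
  by rewrite ler_wpM2l.
rewrite integral_mkcond (eq_integral (fun w => (g (X w))%:E)).
  apply: le_trans (integral_le_mean XEn (countable_E Nn) (fun x _ => @closed_E x) gK) _.
  rewrite lee_fin mulrC ler_pdivrMr// /K mulrCA divff ?gt_eqF// mulr1.
  by apply: (@le_trans _ _ V'); rewrite ?lerDl// /V' le_max lexx.
move=> w _; rewrite patchE /g /=; case: ifPn.
  by rewrite inE /= => ->.
by move=> /negP; rewrite inE /= => /negP/negbTE ->.
Qed.

End uniform_integrability.

(** * Asymptotics *)

Section scaling.
Variable R : realType.

Lemma cvg_sumr (I : Type) (s : seq I) (f : nat -> I -> R) (l : I -> R) :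
  (forall i, f n i @[n --> \oo] --> l i) ->
  \sum_(i <- s) f n i @[n --> \oo] --> \sum_(i <- s) l i.
Proof.
by move=> fl; apply: cvg_big => [|i _]; [exact: add_continuous | exact: fl].
Qed.

Lemma cvg_exprn (f : nat -> R) (l : R) k :
  f n @[n --> \oo] --> l -> f n ^+ k @[n --> \oo] --> l ^+ k.
Proof.
move=> fl; elim: k => [|k IH]; first exact: cvg_cst.
by rewrite exprS; under eq_fun do rewrite exprS; exact: cvgM.
Qed.

Lemma invn_cvg : (n%:R^-1 : R) @[n --> \oo] --> 0.
Proof. by rewrite -cvg_shiftS; exact: cvg_harmonic. Qed.

Lemma cvg_powRN (r : R) : 0 < r -> (n%:R `^ (- r) : R) @[n --> \oo] --> 0.
Proof.
move=> r0; have /cvgrPdist_lt h := powR_cvg0 r0; apply/cvgrPdist_lt => e e0.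
have [del /= del0 Hdel] := h e e0.
have /cvgrPdist_lt/(_ _ del0) := invn_cvg; apply: filterS2 (nbhs_infty_gt 0).
move=> n n0 hn; have nR : 0 < n%:R :> R by rewrite ltr0n.
have -> : n%:R `^ (- r) = (n%:R^-1) `^ r :> R.
  by rewrite -powR_inv1 ?ler0n// -powRrM mulN1r.
by apply: Hdel => //=; rewrite invr_gt0.
Qed.

Lemma limn_einf_gt0 (f : nat -> R) : (0 < limn_einf (EFin \o f))%E ->
  exists2 c, 0 < c & \forall n \near \oo, c <= f n.
Proof.
rewrite limn_einf_lim (cvg_lim _ (@cvg_einfs_sup _ _))//.
move=> /ereal_sup_gt[_ [k _ <-]]; rewrite /einfs /=; case E: (ereal_inf _) => [b| |]//= b0.
- exists b; first by rewrite -lte_fin.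
  exists k => // n /= kn; rewrite -lee_fin -E; apply: ereal_inf_lbound; exists n => //.
- exists 1 => //; exists k => // n /= kn.
  have : (ereal_inf (sdrop (EFin \o f) k) <= (f n)%:E)%E.
    by apply: ereal_inf_lbound; exists n.
  by rewrite E leye_eq.
Qed.

(** From [n^gamma beta >= c] follows [1 / (n beta^2) <= n^(-(1 - 2 gamma)) / c^2], and the exponent
    is negative because [gamma < 1/2]. *)
Lemma token_threshold_cvg (gamma : R) (beta : nat -> R) : gamma < 2^-1 ->
  (0 < limn_einf (fun n => (n%:R `^ gamma * beta n)%:E))%E ->
  (n%:R * beta n ^+ 2)^-1 @[n --> \oo] --> 0.
Proof.
move=> g2 /limn_einf_gt0[c c0 hc]; have c2 : 0 < c ^+ 2 by rewrite exprn_gt0.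
pose h n := (c ^+ 2)^-1 * n%:R `^ (- (1 - 2 * gamma)).
have h0 : h n @[n --> \oo] --> 0.
  rewrite -(mulr0 (c ^+ 2)^-1); apply: cvgM; first exact: cvg_cst.
  by apply: cvg_powRN; lra.
apply: (squeeze_cvgr _ (cvg_cst 0) h0); near=> n.
have n0 : 0 < n%:R :> R by rewrite ltr0n; near: n; exact: nbhs_infty_gt.
have cn : c <= n%:R `^ gamma * beta n by near: n.
have b0 : 0 < beta n.
  by move: (lt_le_trans c0 cn); rewrite pmulr_rgt0// powR_gt0.
have p0 : 0 < n%:R `^ gamma :> R by rewrite powR_gt0.
apply/andP; split; first by rewrite invr_ge0 mulr_ge0 ?sqr_ge0 ?ltW.
have hE : h n = (c ^+ 2)^-1 * (n%:R^-1 * (n%:R `^ gamma) ^+ 2).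
  rewrite /h opprB powRB ?(gt_eqF n0) ?implybT// powRr1 ?ltW// [2 * _]mulrC powRrM.
  by rewrite powR_mulrn ?ltW//; congr (_ * _); rewrite mulrC.
rewrite hE invfM mulrCA ler_pM2l ?invr_gt0//.
rewrite [leRHS]mulrC ler_pdivlMr// mulrC ler_pdivrMr ?exprn_gt0//.
rewrite -exprMn lerXn2r ?nnegrE ?(ltW c0)//; last by rewrite mulr_ge0 ?ltW.
Unshelve. all: by end_near. Qed.

End scaling.

Section limits.
Variables (R : realType) (m : nat) (u : 'I_m.+1 -> R -> R).
Hypothesis u_concave : concave_utilities u.
Local Notation occ := (occ R m).
Local Notation top := (top_coords u).
Variables (alpha : 'I_m.+1 -> R) (lambda mu : R) (r : nat).
Hypotheses (lambda0 : 0 < lambda) (mu0 : 0 < mu).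
Local Notation rho := (lambda / mu).
Hypotheses (alpha0 : forall i, 0 < alpha i) (r0 : (0 < r)%N).
Hypothesis rP : capacity alpha (top r) <= rho < capacity alpha (top r.+1).
Variable a : nat -> 'I_m.+1 -> R.
Hypothesis a0 : \forall n \near \oo, forall i, 0 < a n i.
Hypothesis a_cvg : forall i, a n i @[n --> \oo] --> alpha i.

Let n0 : \forall n \near \oo, (0 < n)%N. Proof. exact: nbhs_infty_gt. Qed.

Lemma supply_gap_cvg : supply_gap alpha (a n) @[n --> \oo] --> 0.
Proof.
have e0 : \sum_(i < m.+1) `|alpha i - alpha i| = 0.
  by rewrite big1// => i _; rewrite subrr normr0.
rewrite -e0; apply: cvg_sumr => i; apply: cvg_norm.
by apply: cvgB; [exact: a_cvg | exact: cvg_cst].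
Qed.

Lemma capacity_cvg s : capacity (a n) s @[n --> \oo] --> capacity alpha s.
Proof. by apply: cvg_sumr => p; exact: a_cvg. Qed.

Section chains.
Variables (S : choiceType) (E : nat -> set S) (rate : nat -> S -> S -> R).
Variables (pr : nat -> S -> \bar R) (occ_of : S -> occ).
Hypothesis st : \forall n \near \oo, stationary_distribution (E n) (rate n) (pr n).
Hypothesis EQ : forall n x, E n x -> Qn n (a n) (occ_of x).

(** The three inputs are the terms of [qstar_dist_Qn]; load and deficit enter through second
    moments, the form in which the Lyapunov bounds provide them. *)
Lemma vanishing_dist :
  vanishing E pr (fun n x => (tasks (occ_of x) - rho) ^+ 2) ->
  vanishing E pr (fun n x => (n%:R^-1 * deficit n (a n) (top r) (occ_of x)) ^+ 2) ->
  vanishing E pr (fun n x =>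
    tasks (occ_of x) - \sum_(p <- top r.+1) occ_of x p) ->
  vanishing E pr (fun n x => `|occ_of x - qstar u alpha rho|).
Proof.
move=> v1 v2 v3.
have gv : vanishing E pr (fun n x => (1 + 2 * r%:R) * supply_gap alpha (a n)).
  apply: (@vanishing_bound _ _ _ rate _ st _
    (fun n => (1 + 2 * r%:R) * supply_gap alpha (a n))).
    rewrite -[X in _ --> X](mulr0 (1 + 2 * r%:R)).
    by apply: cvgM; [exact: cvg_cst | exact: supply_gap_cvg].
  near=> n; have stn : stationary_distribution (E n) (rate n) (pr n) by near: n.
  by apply: (mean_le_cst stn); rewrite mulr_ge0 ?supply_gap_ge0// addr_ge0 ?mulr_ge0.
have tv : vanishing E pr (fun n x => `|tasks (occ_of x) - rho|).
  apply: (vanishing_sqr st); first by near=> n => x _.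
  by apply: (vanishing_le st _ v1); near=> n => x _; rewrite real_normK ?num_real// sqr_ge0 lexx.
have dv : vanishing E pr (fun n x => n%:R^-1 * deficit n (a n) (top r) (occ_of x)).
  apply: (vanishing_sqr st) v2; near=> n => x Ex.
  by rewrite mulr_ge0 ?invr_ge0// (deficit_ge0 (EQ Ex)).
have c2 : 0 <= 2 :> R by [].
apply: (vanishing_le st _
  (vanishingD st (vanishingD st (vanishingD st gv (vanishingZ st c2 dv)) tv)
    (vanishingZ st c2 v3))).
near=> n => x Ex; rewrite normr_ge0/=.
apply: (qstar_dist_Qn u_concave alpha0 r0 rP); last exact: EQ.
by near: n; exact: n0.
Unshelve. all: by end_near. Qed.

Lemma vanishing_load (dep arr : nat -> S -> Defs.coord m -> S)
    (asg : nat -> S -> Defs.coord m -> R) :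
  (\forall n \near \oo,
    occ_chain lambda mu n (a n) (E n) (rate n) occ_of (dep n) (arr n) (asg n)) ->
  vanishing E pr (fun n x => (tasks (occ_of x) - rho) ^+ 2).
Proof.
move=> oc; apply: (vanishing_bound st (b := fun n => rho / n%:R)).
  rewrite -[X in _ --> X](mulr0 rho).
  by apply: cvgM; [exact: cvg_cst | exact: invn_cvg].
near=> n; have stn : stationary_distribution (E n) (rate n) (pr n) by near: n.
have ocn : occ_chain lambda mu n (a n) (E n) (rate n) occ_of (dep n) (arr n) (asg n).
  by near: n.
have nn : (0 < n)%N by near: n; exact: n0.
exact: (mean_tasks_var lambda0 mu0 ocn stn nn).
Unshelve. all: by end_near. Qed.

End chains.

Lemma jlmu_vanishing (pr : nat -> occ -> \bar R) :
  (\forall n \near \oo, stationary_distribution (jlmu_states u lambda mu n (a n))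
    (jlmu_rate u lambda mu n) (pr n)) ->
  vanishing (fun n => jlmu_states u lambda mu n (a n)) pr
    (fun n q => `|q - qstar u alpha rho|).
Proof.
move=> st; have nv := @invn_cvg R; have gv := supply_gap_cvg.
apply: (vanishing_dist st (occ_of := id)).
- by move=> n q [].
- apply: (vanishing_load st (dep := @depart R m) (arr := @arrive R m)
    (asg := fun=> jlmu_assign u)).
  near=> n; apply: jlmu_chain => //; near: n; [exact: n0 | exact: a0].
- pose b n := (r%:R * supply_gap alpha (a n)) ^+ 2 +
    n%:R^-1 * (capacity (a n) (top r) + rho).
  apply: (vanishing_bound st (b := b)).
    rewrite (_ : 0 = (r%:R * 0) ^+ 2 + 0 * (capacity alpha (top r) + rho)); last by ring.
    apply: cvgD; first by apply: cvg_exprn; apply: cvgM => //; exact: cvg_cst.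
    apply: cvgM => //; apply: cvgD; [exact: capacity_cvg | exact: cvg_cst].
  near=> n.
  have nn : (0 < n)%N by near: n; exact: n0.
  have nR : n%:R != 0 :> R by rewrite pnatr_eq0 -lt0n.
  have an : forall i, 0 < a n i by near: n; exact: a0.
  have stn : stationary_distribution (jlmu_states u lambda mu n (a n))
    (jlmu_rate u lambda mu n) (pr n) by near: n.
  have ni : 0 <= (n%:R^-1) ^+ 2 :> R by rewrite sqr_ge0.
  have := mean_leZ stn ni (jlmu_deficit_sq u_concave nn an lambda0 mu0 stn r0).
  apply: (mean_le_mono stn) => [q _|]; first by rewrite sqr_ge0 exprMn lexx.
  have -> : (n%:R^-1) ^+ 2 * (n%:R ^+ 2 * Num.max 0 (capacity (a n) (top r) - rho) ^+ 2 +
      n%:R * (capacity (a n) (top r) + rho)) =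
      Num.max 0 (capacity (a n) (top r) - rho) ^+ 2 +
      n%:R^-1 * (capacity (a n) (top r) + rho) by field; rewrite nR gt_eqF.
  (* As [capacity alpha (top r) <= rho], the excess of [capacity (a n) (top r)] over [rho] is at
     most a multiple of the supply gap. *)
  rewrite lerD2r lerXn2r ?nnegrE ?mulr_ge0 ?supply_gap_ge0// ?le_max ?lexx//.
  rewrite ge_max mulr_ge0 ?supply_gap_ge0//=.
  have := capacity_gap alpha (a n) (top r); rewrite size_top => cg.
  apply: (@le_trans _ _ (r.-1%:R * supply_gap alpha (a n))); last first.
    by rewrite ler_wpM2r ?supply_gap_ge0// ler_nat leq_pred.
  apply: le_trans cg; apply: le_trans (ler_norm _); rewrite lerD2l lerN2.
  by case/andP: rP.
(* Half of the spare capacity in [top r.+1]; this much remains for the supplies [a n] once [n] is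
   large. *)
- pose eps := (capacity alpha (top r.+1) - rho) / 2.
  have e0 : 0 < eps by rewrite divr_gt0// subr_gt0; case/andP: rP.
  have hcap : \forall n \near \oo, rho + eps <= capacity (a n) (top r.+1).
    apply: (cvgr_ge (capacity alpha (top r.+1)) (capacity_cvg (s := top r.+1))).
    by rewrite /eps; case/andP: rP; lra.
  apply: (vanishing_bound st
    (b := fun n => rho * (tail_const lambda mu eps * (n%:R^-1) ^+ 4))).
    rewrite (_ : 0 = rho * (tail_const lambda mu eps * 0 ^+ 4)); last by ring.
    by apply: cvgM; [exact: cvg_cst | apply: cvgM; [exact: cvg_cst | exact: cvg_exprn]].
  near=> n; rewrite exprVn.
  have nn : (0 < n)%N by near: n; exact: n0.
  have an : forall i, 0 < a n i by near: n; exact: a0.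
  have stn : stationary_distribution (jlmu_states u lambda mu n (a n))
    (jlmu_rate u lambda mu n) (pr n) by near: n.
  have cn : rho + eps <= capacity (a n) (top r.+1) by near: n.
  exact: (jlmu_outside u_concave nn an lambda0 mu0 stn (ltn0Sn r) e0 cn).
Unshelve. all: by end_near. Qed.

End limits.

(** * The SLTA bounds as [n] grows *)

Section slta_limits.
Variables (R : realType) (m : nat) (u : 'I_m.+1 -> R -> R).
Hypothesis u_concave : concave_utilities u.
Local Notation occ := (occ R m).
Local Notation top := (top_coords u).
Variables (alpha : 'I_m.+1 -> R) (lambda mu : R) (r : nat).
Hypotheses (lambda0 : 0 < lambda) (mu0 : 0 < mu).
Local Notation rho := (lambda / mu).
Hypotheses (alpha0 : forall i, 0 < alpha i) (r0 : (0 < r)%N).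
Hypothesis rP : capacity alpha (top r) < rho < capacity alpha (top r.+1).
Variable a : nat -> 'I_m.+1 -> R.
Hypothesis a0 : \forall n \near \oo, forall i, 0 < a n i.
Hypothesis a_cvg : forall i, a n i @[n --> \oo] --> alpha i.
Variable beta : nat -> R.
Hypothesis beta0 : \forall n \near \oo, 0 < beta n.
Hypothesis beta_cvg : beta n @[n --> \oo] --> 0.
Hypothesis beta_large : (n%:R * beta n ^+ 2)^-1 @[n --> \oo] --> 0.
Variable pr : nat -> occ * nat -> \bar R.
Local Notation E := (fun n => slta_states u lambda mu n (beta n) (a n)).
Local Notation rate := (fun n => slta_rate u lambda mu n (beta n)).
Hypothesis st : \forall n \near \oo, stationary_distribution (E n) (rate n) (pr n).

Section constants.
Variables (eps delta amin : R).
Hypotheses (delta0 : 0 < delta) (amin0 : 0 < amin).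
Local Notation C := (tail_const lambda mu eps).
Local Notation off := (fun n => slta_off_bound u lambda mu n (a n) (beta n) r eps delta amin).
Local Notation sq := (fun n => slta_sq_bound u lambda mu n (a n) r eps delta).

(** The bounds become polynomials in the capacity [k], [v = 1/n] and [s = 1 / (n beta^2)], so that
    limits follow by continuity. The tail contributes [v^4], which leaves positive powers of [v]
    after multiplication by the cubic or by the arrival rate. *)
Let sqf (k v : R) := (lambda * (1 + 2 * (3 * lambda / delta)) +
  lambda * C * (k ^+ 3 * v + 3 * lambda / delta * k ^+ 2 * v ^+ 2)) / (3 * delta).
Let offf (k v s : R) := (lambda * (rho + eps) / (mu * amin) + v) * (2 * C) * v ^+ 3 +
  lambda / delta * (k + v) * (2 * sqf k v) * s.

Let sqE n : (0 < n)%N -> sq n = sqf (capacity (a n) (top r)) n%:R^-1.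
Proof.
move=> n0; have nR : n%:R != 0 :> R by rewrite pnatr_eq0 -lt0n.
rewrite /slta_sq_bound /slta_tau /sqf; move: (C) (capacity _ _) => c k.
by field; rewrite nR gt_eqF.
Qed.

Let offE n : (0 < n)%N -> 0 < beta n ->
  off n = offf (capacity (a n) (top r)) n%:R^-1 (n%:R * beta n ^+ 2)^-1.
Proof.
move=> n0 b0; have nR : n%:R != 0 :> R by rewrite pnatr_eq0 -lt0n.
rewrite /slta_off_bound /slta_switch_bound (sqE n0) /slta_tau /offf.
move: (C) (capacity _ _) (sqf _ _) => c k s.
by field; rewrite nR !gt_eqF.
Qed.

Let kv := @capacity_cvg R m alpha a a_cvg (top r).
Let vv := @invn_cvg R.

Let sqf_cvg : sqf (capacity (a n) (top r)) n%:R^-1 @[n --> \oo] -->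
  sqf (capacity alpha (top r)) 0.
Proof.
rewrite /sqf; repeat first [exact: kv | exact: vv | exact: cvg_cst | apply: cvgD
  | apply: cvg_exprn | apply: cvgM].
Qed.

Let offf_cvg :
  offf (capacity (a n) (top r)) n%:R^-1 (n%:R * beta n ^+ 2)^-1 @[n --> \oo] --> 0.
Proof.
rewrite (_ : 0 = offf (capacity alpha (top r)) 0 0); last by rewrite /offf; ring.
rewrite /offf; repeat first [exact: kv | exact: vv | exact: beta_large
  | exact: sqf_cvg | exact: cvg_cst | apply: cvgD | apply: cvg_exprn | apply: cvgM].
Qed.

Lemma slta_off_cvg : off n @[n --> \oo] --> 0.
Proof.
apply: cvg_trans offf_cvg; apply: near_eq_cvg; near=> n; rewrite offE//.
  by near: n; exact: nbhs_infty_gt.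
by near: n.
Unshelve. all: by end_near. Qed.

Lemma slta_sq_cvg :
  (n%:R^-1) ^+ 2 * (sq n + (n%:R * capacity (a n) (top r)) ^+ 2 * off n)
    @[n --> \oo] --> 0.
Proof.
pose f n := (n%:R^-1) ^+ 2 * sqf (capacity (a n) (top r)) n%:R^-1 +
  capacity (a n) (top r) ^+ 2 * off n.
have fv : f n @[n --> \oo] --> 0.
  rewrite (_ : 0 = 0 ^+ 2 * sqf (capacity alpha (top r)) 0 +
    capacity alpha (top r) ^+ 2 * 0); last by ring.
  apply: cvgD; apply: cvgM; [|exact: sqf_cvg| |exact: slta_off_cvg].
    by apply: cvg_exprn; exact: vv.
  by apply: cvg_exprn; exact: kv.
apply: cvg_trans fv; apply: near_eq_cvg; near=> n.
have n0 : (0 < n)%N by near: n; exact: nbhs_infty_gt.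
have nR : n%:R != 0 :> R by rewrite pnatr_eq0 -lt0n.
rewrite /f -(sqE n0); move: (sq n) (capacity _ _) (off n) => x y z.
by field; rewrite nR.
Unshelve. all: by end_near. Qed.

End constants.

Lemma slta_vanishing : vanishing E pr (fun n x => `|x.1 - qstar u alpha rho|) /\
  vanishing E pr (fun n x => (x.2 != r)%:R).
Proof.
have [rP1 rP2] := andP rP.
(* [eps], [delta] and [amin / 2] are half of the limiting margins, so the corresponding inequalities
   persist for the supplies [a n] when [n] is large. *)
pose eps := (capacity alpha (top r.+1) - rho) / 2.
have e0 : 0 < eps by rewrite divr_gt0// subr_gt0.
pose delta := (lambda - mu * capacity alpha (top r)) / 2.
have d0 : 0 < delta.
  rewrite divr_gt0// subr_gt0 mulrC -ltr_pdivlMr//.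
have [amin amin0 aminP] := exists_lower_bound alpha0.
have am0 : 0 < amin / 2 by rewrite divr_gt0.
have hn : \forall n \near \oo, (0 < n)%N by exact: nbhs_infty_gt.
have overload : \forall n \near \oo,
    rho + eps + r%:R * beta n + n%:R^-1 <= capacity (a n) (top r.+1).
  have h : capacity (a n) (top r.+1) - (r%:R * beta n + n%:R^-1) @[n --> \oo] -->
      capacity alpha (top r.+1) - (r%:R * 0 + 0).
    apply: cvgB; first exact: capacity_cvg.
    by apply: cvgD; [apply: cvgM => //; exact: cvg_cst | exact: invn_cvg].
  have {}h := cvgr_ge _ h (rho + eps).
  have /h : rho + eps < capacity alpha (top r.+1) - (r%:R * 0 + 0) by rewrite /eps; lra.
  by apply: filterS => n; lra.
have underload : \forall n \near \oo,
    mu * capacity (a n) (top r) <= lambda - delta.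
  have h : mu * capacity (a n) (top r) @[n --> \oo] --> mu * capacity alpha (top r).
    by apply: cvgM; [exact: cvg_cst | exact: capacity_cvg].
  by apply: (cvgr_le _ h); move: d0; rewrite /delta; lra.
have amin_le : \forall n \near \oo, forall i, amin / 2 <= a n i.
  have gl : \forall n \near \oo, supply_gap alpha (a n) <= amin / 2.
    by apply: (cvgr_le 0) => //; exact: supply_gap_cvg a_cvg.
  apply: filterS gl => n gn i.
  have := le_trans (supply_gap_ge alpha (a n) i) gn.
  by rewrite ler_norml => /andP[h _]; have := aminP i; lra.
have offv := slta_off_cvg eps d0 am0; have sqv := slta_sq_cvg eps d0 am0.
split; last first.
  apply: (vanishing_bound st offv); near=> n.
  by apply: (mean_off u_concave lambda0 mu0) => //; near: n.
have rP' : capacity alpha (top r) <= rho < capacity alpha (top r.+1) by rewrite ltW.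
apply: (vanishing_dist u_concave alpha0 r0 rP' a_cvg st (occ_of := fst)).
- by move=> n x [].
- apply: (vanishing_load lambda0 mu0 st
    (dep := @slta_depart R m)).
  near=> n; apply: slta_chain => //; by near: n.
- apply: (vanishing_bound st sqv); near=> n.
  have stn : stationary_distribution (E n) (rate n) (pr n) by near: n.
  have ni : 0 <= (n%:R^-1) ^+ 2 :> R by rewrite sqr_ge0.
  have D : mean_le (E n) (pr n) (fun x => deficit n (a n) (top r) x.1 ^+ 2)
    (slta_sq_bound u lambda mu n (a n) r eps delta +
     (n%:R * capacity (a n) (top r)) ^+ 2 *
     slta_off_bound u lambda mu n (a n) (beta n) r eps delta (amin / 2)).
    by apply: slta_deficit_sq => //; near: n.
  apply: (mean_le_mono stn _ (lexx _) (mean_leZ stn ni D)) => x _.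
  by rewrite sqr_ge0 exprMn lexx.
- apply: (vanishing_bound st (b := fun n => rho *
    (slta_off_bound u lambda mu n (a n) (beta n) r eps delta (amin / 2) +
     tail_const lambda mu eps * (n%:R^-1) ^+ 4))).
    rewrite (_ : 0 = rho * (0 + tail_const lambda mu eps * 0 ^+ 4)); last by ring.
    apply: cvgM; first exact: cvg_cst.
    apply: cvgD => //; apply: cvgM; first exact: cvg_cst.
    by apply: cvg_exprn; exact: invn_cvg.
  near=> n; rewrite exprVn.
  by apply: (slta_outside u_concave lambda0 mu0) => //; near: n.
Unshelve. all: by end_near. Qed.

End slta_limits.

(** * Limits of the stationary laws and of the utilities *)

Section policies.
Variables (R : realType) (m : nat) (u : 'I_m.+1 -> R -> R).
Hypothesis u_concave : concave_utilities u.
Local Notation occ := (occ R m).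
Local Notation top := (top_coords u).
Variables (lambda mu : R).
Hypotheses (lambda0 : 0 < lambda) (mu0 : 0 < mu).
Local Notation rho := (lambda / mu).

Let rho0 : 0 <= rho. Proof. by rewrite ltW// divr_gt0. Qed.

Lemma qstar_height (a : 'I_m.+1 -> R) : (forall i, 0 < a i) ->
  exists J, forall i j, (J <= j)%N -> qstar u a rho (i, j.+1) = 0.
Proof.
move=> a0; have [k k0 kP] := exists_threshold u a0 rho0.
exists (\max_(p <- top k.+1) p.2) => i j Jj.
have : (i, j.+1) \notin top k.+1.
  apply/negP => pt; have := @leq_bigmax_seq _ (top k.+1) predT
    (fun p : Defs.coord m => p.2) _ pt erefl.
  by rewrite leqNgt ltnS Jj.
rewrite top_coordsS// mem_rcons inE negb_or => /andP[p3 p4].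
by rewrite (qstarE u_concave a0 k0 kP) (negbTE p3) (negbTE p4).
Qed.

Variables (N : set nat) (alpha : 'I_m.+1 -> R) (r : nat) (a : nat -> 'I_m.+1 -> R).
Hypotheses (N_near : \forall n \near \oo, N n) (N0 : forall n, N n -> (0 < n)%N).
Hypotheses (alpha0 : forall i, 0 < alpha i) (r0 : (0 < r)%N).
Hypothesis rP : capacity alpha (top r) <= rho < capacity alpha (top r.+1).
Hypothesis a0 : forall n, N n -> forall i, 0 < a n i.
Hypothesis a1 : forall n, N n -> \sum_(i < m.+1) a n i = 1.
Hypothesis a_cvg : forall i, a n i @[n --> \oo] --> alpha i.

Lemma utility_qstar_cvg : bounded_marginals u ->
  utility u (qstar u (a n) rho) @[n --> \oo] --> utility u (qstar u alpha rho).
Proof.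
move=> [M uM]; pose L := utility_lip u M; have L0 : 0 <= L := utility_lip_ge0 uM.
pose b n := L * ((1 + 4 * r%:R) * supply_gap alpha (a n)).
have b0 : b n @[n --> \oo] --> 0.
  rewrite (_ : 0 = L * ((1 + 4 * r%:R) * 0)); last by ring.
  apply: cvgM; first exact: cvg_cst.
  by apply: cvgM; [exact: cvg_cst | exact: supply_gap_cvg].
have cap : \forall n \near \oo, rho < capacity (a n) (top r.+1).
  by apply: (cvgr_gt _ (capacity_cvg a_cvg (s := top r.+1))); case/andP: rP.
apply/cvgrPdist_le => e e0.
have be : \forall n \near \oo, b n <= e by exact: (cvgr_le 0 b0).
near=> n; rewrite distrC; apply: (@le_trans _ _ (b n)); last by near: n.
have an : forall i, 0 < a n i by apply: a0; near: n.
apply: (le_trans (utility_lipschitz uM (qstar_height an) (qstar_height alpha0))).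
rewrite ler_wpM2l//; apply: (qstar_qstar_dist u_concave alpha0 rho0 r0 rP an).
by near: n.
Unshelve. all: by end_near. Qed.

Section utilities.
Variables (S : topologicalType) (E : nat -> set S) (rate : nat -> S -> S -> R).
Variables (occ_of : S -> occ) (dep arr : nat -> S -> Defs.coord m -> S).
Variable asg : nat -> S -> Defs.coord m -> R.
Variables (d : nat -> measure_display) (W : forall n, measurableType (d n)).
Variables (P : forall n, probability (W n) R) (X : forall n, W n -> S).
Local Notation law := (fun n x => P n (@X n @^-1` [set x])).
Hypothesis XE : forall n, N n ->
  has_stationary_distribution (P n) (E n) (rate n) (@X n).
Hypothesis countable_E : forall n, N n -> countable (E n).
Hypothesis closed_E : forall x : S, closed [set x].
Hypothesis oc : forall n, N n ->
  occ_chain lambda mu n (a n) (E n) (rate n) occ_of (dep n) (arr n) (asg n).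
Hypothesis dist : vanishing E law (fun n x => `|occ_of x - qstar u alpha rho|).

Lemma utility_limits : bounded_marginals u ->
  [/\ uniformly_integrable N P (fun n => (utility u \o occ_of) \o @X n),
      ('E_(P n)[(utility u \o occ_of) \o @X n])%E @[n --> \oo] -->
        (utility u (qstar u alpha rho))%:E &
      utility u (qstar u (a n) rho) @[n --> \oo] -->
        utility u (qstar u alpha rho)].
Proof.
move=> bm; have [M uM] := bm.
pose L := utility_lip u M; have L0 : 0 <= L := utility_lip_ge0 uM.
have nearXE : \forall n \near \oo,
  has_stationary_distribution (P n) (E n) (rate n) (@X n) by exact: filterS N_near.
have nearC : \forall n \near \oo, countable (E n) by exact: filterS N_near.
have st : \forall n \near \oo, stationary_distribution (E n) (rate n) (law n).
  by apply: filterS nearXE => n [].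
split; last exact: utility_qstar_cvg.
  (* From [(1 + t)^2 <= 2 + 2 t^2] and [t^2 <= 2 rho^2 + 2 (t - rho)^2], with the variance bound
     [rho / n] replaced by [rho] to be uniform in [n]. *)
  pose V := L ^+ 2 * (2 + 4 * rho ^+ 2 + 4 * rho).
  apply: (uniformly_integrable_sqr XE countable_E closed_E (V := V)) => n Nn.
  have [_ stn] := XE Nn; have n0 := N0 Nn.
  have c1 : 0 <= 2 + 4 * rho ^+ 2 by rewrite addr_ge0// mulr_ge0// sqr_ge0.
  have c4 : 0 <= 4 :> R by [].
  have := mean_leZ stn (sqr_ge0 L) (mean_leD stn (mean_le_cst stn c1)
    (mean_leZ stn c4 (mean_tasks_var lambda0 mu0 (oc Nn) stn n0))).
  apply: (mean_le_mono stn) => [x Ex|]; last first.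
    rewrite ler_wpM2l ?sqr_ge0// lerD2l ler_wpM2l// ler_pdivrMr ?ltr0n//.
    by rewrite ler_peMr// ler1n.
  have Qx := oc_Qn (oc Nn) Ex; have t0 := tasks_ge0 n0 Qx.
  rewrite sqr_ge0/= -real_normK ?num_real//.
  have := utility_bound uM n0 (a1 Nn) Qx; rewrite -/L => ub.
  apply: (@le_trans _ _ ((L * (1 + tasks (occ_of x))) ^+ 2)).
    by rewrite lerXn2r ?nnegrE// mulr_ge0// addr_ge0.
  rewrite exprMn ler_wpM2l ?sqr_ge0//; set t := tasks _.
  have := sqr_ge0 (t - 1); have := sqr_ge0 (t - 2 * rho).
  by rewrite !expr2; lra.
apply: (expectation_cvg nearXE nearC closed_E).
apply: (vanishing_le st _ (vanishingZ st L0 dist)); near=> n => x Ex.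
have Nn : N n by near: n.
have n0 := N0 Nn; have Qx := oc_Qn (oc Nn) Ex.
rewrite normr_ge0/=; apply: (utility_lipschitz uM); last exact: qstar_height.
by exists (height (occ_of x)) => i j h; apply: (heightP n0 Qx); exact: leqW.
Unshelve. all: by end_near. Qed.

End utilities.

Lemma countable_jlmu_states n : (0 < n)%N ->
  countable (jlmu_states u lambda mu n (a n)).
Proof.
move=> n0; apply: (sub_countable _ (countable_Qn (a n) n0)).
by apply: subset_card_le => q [].
Qed.

Lemma countable_slta_states n beta : (0 < n)%N ->
  countable (slta_states u lambda mu n beta (a n)).
Proof.
move=> n0; have := countableX (countable_Qn (a n) n0) (countableP [set: nat]).
apply: sub_countable; apply: subset_card_le => x [Qx _ _].
by split.
Qed.

Section jlmu.
Variables (d : nat -> measure_display) (W : forall n, measurableType (d n)).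
Variables (P : forall n, probability (W n) R) (q : forall n, W n -> occ).
Hypothesis XE : forall n, N n -> has_stationary_distribution (P n)
  (jlmu_states u lambda mu n (a n)) (jlmu_rate u lambda mu n) (@q n).

Lemma jlmu_limits : converges_weakly P q (qstar u alpha rho) /\
  (bounded_marginals u ->
    [/\ uniformly_integrable N P (fun n => utility u \o @q n),
        ('E_(P n)[utility u \o @q n])%E @[n --> \oo] -->
          (utility u (qstar u alpha rho))%:E &
        utility u (qstar u (a n) rho) @[n --> \oo] -->
          utility u (qstar u alpha rho)]).
Proof.
have nearXE : \forall n \near \oo, has_stationary_distribution (P n)
  (jlmu_states u lambda mu n (a n)) (jlmu_rate u lambda mu n) (@q n).
  exact: filterS N_near.
have st : \forall n \near \oo, stationary_distribution
  (jlmu_states u lambda mu n (a n)) (jlmu_rate u lambda mu n)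
  (fun x => P n (@q n @^-1` [set x])).
  by apply: filterS nearXE => n [].
have near0 : \forall n \near \oo, forall i, 0 < a n i by exact: filterS N_near.
have dist := jlmu_vanishing u_concave lambda0 mu0 alpha0 r0 rP near0 a_cvg st.
split.
  apply: (weak_cvg nearXE _ _ _ _ dist) => //.
  - by apply: filterS N_near => n /N0; exact: countable_jlmu_states.
  - exact: closed_occ.
  - move=> U /nbhs_ballP[e /= e0 eU]; exists e => // x xe; apply: eU.
    by rewrite -ball_normE /= distrC.
apply: (utility_limits XE (occ_of := id) (dep := @depart R m)
  (arr := @arrive R m) (asg := fun=> jlmu_assign u)) => //.
- by move=> n /N0; exact: countable_jlmu_states.
- exact: closed_occ.
- by move=> n Nn; apply: jlmu_chain => //; [exact: N0 | exact: a0].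
Qed.

End jlmu.

Section slta.
Variables (beta : nat -> R) (gamma : R).
Hypothesis beta0 : forall n, N n -> 0 < beta n.
Hypothesis load_lt : capacity alpha (top r) < rho.
Hypothesis gamma_lt : gamma < 2^-1.
Hypothesis beta_cvg : beta n @[n --> \oo] --> 0.
Hypothesis beta_large : (0 < limn_einf (fun n => (n%:R `^ gamma * beta n)%:E))%E.
Variables (d : nat -> measure_display) (W : forall n, measurableType (d n)).
Variables (P : forall n, probability (W n) R) (x : forall n, W n -> occ * nat).
Hypothesis XE : forall n, N n -> has_stationary_distribution (P n)
  (slta_states u lambda mu n (beta n) (a n)) (slta_rate u lambda mu n (beta n)) (@x n).

Lemma slta_limits : converges_weakly P x (qstar u alpha rho, r) /\
  (bounded_marginals u ->
    [/\ uniformly_integrable N P (fun n w => utility u (@x n w).1),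
        ('E_(P n)[(fun w => utility u (@x n w).1)])%E @[n --> \oo] -->
          (utility u (qstar u alpha rho))%:E &
        utility u (qstar u (a n) rho) @[n --> \oo] -->
          utility u (qstar u alpha rho)]).
Proof.
have nearXE : \forall n \near \oo, has_stationary_distribution (P n)
  (slta_states u lambda mu n (beta n) (a n)) (slta_rate u lambda mu n (beta n)) (@x n).
  exact: filterS N_near.
have st : \forall n \near \oo, stationary_distribution
  (slta_states u lambda mu n (beta n) (a n)) (slta_rate u lambda mu n (beta n))
  (fun y => P n (@x n @^-1` [set y])).
  by apply: filterS nearXE => n [].
have near0 : \forall n \near \oo, forall i, 0 < a n i by exact: filterS N_near.
have nearb : \forall n \near \oo, 0 < beta n by exact: filterS N_near.
have rP' : capacity alpha (top r) < rho < capacity alpha (top r.+1).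
  by rewrite load_lt; case/andP: rP.
have [dist rank] := slta_vanishing u_concave lambda0 mu0 alpha0 r0 rP' near0 a_cvg
  nearb beta_cvg (token_threshold_cvg gamma_lt beta_large) st.
split.
  apply: (weak_cvg (G := fun y => `|y.1 - qstar u alpha rho| + (y.2 != r)%:R)
    nearXE _ _ _ _ (vanishingD st dist rank)) => //.
  - by apply: filterS N_near => n /N0; exact: countable_slta_states.
  - exact: closed_occ_nat.
  - move=> U [[A B] /= [/nbhs_ballP[e /= e0 eA] Br] ABU].
    (* A value of [G] below 1 forces the rank to equal [r], which handles the discrete factor. *)
    exists (Num.min e 1) => [|y]; first by rewrite lt_min e0 ltr01.
    rewrite lt_min => /andP[ye y1]; apply: ABU; split => /=.
      apply: eA; rewrite -ball_normE /= distrC; apply: le_lt_trans ye.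
      by rewrite lerDl.
    move: y1; case: eqVneq => [-> _|_]; first exact: nbhs_singleton.
    by rewrite /= ltNge lerDr normr_ge0.
apply: (utility_limits XE (occ_of := fst) (dep := @slta_depart R m)
  (arr := fun n => slta_arrive u n (beta n))
  (asg := fun n y => slta_assign u n y.1 y.2)) => //.
- by move=> n /N0; exact: countable_slta_states.
- exact: closed_occ_nat.
- by move=> n Nn; apply: slta_chain => //; [exact: N0 | exact: a0].
Qed.

End slta.

End policies.

Theorem theorem2 (R : realType) (m : nat) (u : 'I_m.+1 -> R -> R)
    (lambda mu : R) (n0 : nat) (A : nat -> 'I_m.+1 -> nat)
    (alpha : 'I_m.+1 -> R)
    (rho := lambda / mu)
    (alphan := fun n i => (A n i)%:R / n%:R : R)
    (N := [set n : nat | (n0 <= n)%N])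
    (u_concave : concave_utilities u)
    (lambda_gt0 : 0 < lambda) (mu_gt0 : 0 < mu)
    (n0_ge : (m.+1 <= n0)%N)
    (A_ge1 : forall n i, N n -> (1 <= A n i)%N)
    (A_sum : forall n, N n -> (\sum_(i < m.+1) A n i = n)%N)
    (alpha01 : forall i, 0 < alpha i < 1)
    (alphan_cvg : forall i, alphan n i @[n --> \oo] --> alpha i) :
  (* JLMU *)
  (forall
      (d' : measure_display) (W' : measurableType d') (P' : probability W' R)
      (qinit : nat -> W' -> occ R m) (qinit_lim : W' -> occ R m),
    (forall n, N n ->
      random_element (jlmu_states u lambda mu n (alphan n)) (qinit n)) ->
    random_element setT qinit_lim ->
    {ae P', forall w, `|qinit n w - qinit_lim w| @[n --> \oo] --> (0 : R)} ->
    forall (d : nat -> measure_display) (W : forall n, measurableType (d n))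
      (P : forall n, probability (W n) R) (q : forall n, W n -> occ R m),
    (forall n, N n -> has_stationary_distribution (P n)
      (jlmu_states u lambda mu n (alphan n)) (jlmu_rate u lambda mu n) (q n)) ->
    converges_weakly P q (qstar u alpha rho) /\
    (bounded_marginals u ->
      [/\ uniformly_integrable N P (fun n => utility u \o q n),
          ('E_(P n)[utility u \o q n])%E @[n --> \oo] -->
            (utility u (qstar u alpha rho))%:E &
          utility u (qstar u (alphan n) rho) @[n --> \oo] -->
            utility u (qstar u alpha rho)])) /\
  (* SLTA *)
  (forall (beta : nat -> R) (gamma0 : R)
      (d' : measure_display) (W' : measurableType d') (P' : probability W' R)
      (xinit : nat -> W' -> occ R m * nat) (qinit_lim : W' -> occ R m)
      (rmax : {RV P' >-> R}),
    (forall n, N n -> 0 < beta n) ->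
    (load_above u alpha (threshold u alpha rho) < rho%:E)%E ->
    0 < gamma0 < 2^-1 ->
    beta n @[n --> \oo] --> (0 : R) ->
    (0 < limn_einf (fun n => (n%:R `^ gamma0 * beta n)%:E))%E ->
    (forall n, N n -> random_element
      (slta_states u lambda mu n (beta n) (alphan n)) (xinit n)) ->
    random_element setT qinit_lim ->
    {ae P', forall w, `|(xinit n w).1 - qinit_lim w| @[n --> \oo] --> (0 : R)} ->
    (forall w, 1 <= rmax w) ->
    {ae P', forall w, forall n, N n ->
      (xinit n w).2%:R <= rmax w /\
      (forall p, Iplus p -> preceq u p (kth u (xinit n w).2) ->
        (xinit n w).1 p < alphan n p.1)} ->
    forall (d : nat -> measure_display) (W : forall n, measurableType (d n))
      (P : forall n, probability (W n) R) (x : forall n, W n -> occ R m * nat),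
    (forall n, N n -> has_stationary_distribution (P n)
      (slta_states u lambda mu n (beta n) (alphan n))
      (slta_rate u lambda mu n (beta n)) (x n)) ->
    converges_weakly P x (qstar u alpha rho, threshold_rank u alpha rho) /\
    (bounded_marginals u ->
      [/\ uniformly_integrable N P (fun n w => utility u (x n w).1),
          ('E_(P n)[(fun w => utility u (x n w).1)])%E @[n --> \oo] -->
            (utility u (qstar u alpha rho))%:E &
          utility u (qstar u (alphan n) rho) @[n --> \oo] -->
            utility u (qstar u alpha rho)])).
Proof.
have rho0 : 0 <= rho by rewrite ltW// divr_gt0.
have alpha0 i : 0 < alpha i by case/andP: (alpha01 i).
have [r r0 rP] := exists_threshold u alpha0 rho0.
have [th rank] := threshold_kth u_concave alpha0 r0 rP.
have N_near : \forall n \near \oo, N n by exact: nbhs_infty_ge.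
have N0 n : N n -> (0 < n)%N by apply: leq_trans; exact: leq_trans n0_ge.
have a0 n : N n -> forall i, 0 < alphan n i.
  by move=> Nn i; rewrite divr_gt0// ltr0n; [exact: A_ge1 | exact: N0].
have a1 n : N n -> \sum_(i < m.+1) alphan n i = 1.
  move=> Nn; rewrite -mulr_suml -natr_sum A_sum// divff// pnatr_eq0 -lt0n.
  exact: N0.
split=> [d' W' P' qinit qlim _ _ _ d W P q XE|].
  exact: (jlmu_limits u_concave lambda_gt0 mu_gt0 N_near N0 alpha0 r0 rP a0 a1
    alphan_cvg XE).
move=> beta gamma0 d' W' P' xinit qlim rmax beta0 load gamma_lt beta_cvg beta_large.
move=> _ _ _ _ _ d W P x XE; rewrite rank.
(* The strict inequality at the threshold is what leaves room for a positive [delta] in the SLTA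
   estimates. *)
have load_lt : capacity alpha (top_coords u r) < rho.
  by move: load; rewrite th (load_above_kth u_concave alpha0 r0) lte_fin.
have [_ gamma2] := andP gamma_lt.
exact: (slta_limits u_concave lambda_gt0 mu_gt0 N_near N0 alpha0 r0 rP a0 a1
  alphan_cvg beta0 load_lt gamma2 beta_cvg beta_large XE).
Qed.
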